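(* Let $n\geq 4$. A quiver $Q$ is mutation equivalent to the $D_n$ quiver (vertices $1,\dots,n$; exactly one arrow $i\to i+1$ for each $1\le i\le n-3$, one arrow $(n-2)\to(n-1)$, one arrow $(n-2)\to n$, and no other arrows) if and only if $Q\in\mathcal{M}^D_n$, i.e. if and only if $Q$ has $n$ vertices and is of Type I, Type II, Type III or Type IV.
   Context: A quiver is a finite directed graph $Q=(Q_0,Q_1,h,t)$ with vertex set $Q_0$, arrow set $Q_1$, head and tail maps $h,t:Q_1\to Q_0$; multiple arrows are allowed, but throughout quivers have no loops and no 2-cycles (no arrows $\alpha,\beta$ with $h(\beta)=t(\alpha)$, $t(\beta)=h(\alpha)$). Isomorphic quivers are regarded as equal. The valency of a vertex $i$ is the number of vertices $j\neq i$ joined to $i$ by at least one arrow (in either direction). A full subquiver on a set of vertices contains all arrows of $Q$ between these vertices. Deleting a vertex also deletes its incident arrows. Mutation: for $i\in Q_0$, $\mu_i(Q)$ is obtained from $Q$ by: reversing all arrows incident with $i$; and whenever there are $r>0$ arrows $j\to i$ and $s>0$ arrows $i\to k$ in $Q$, adding $rs$ arrows $j\to k$ and then removing a maximal number of 2-cycles. Two quivers are mutation equivalent if one is obtained from the other by a finite (possibly empty) sequence of mutations, up to isomorphism. The set $\mathcal{M}^A_k$ ($k\ge1$) consists of the connected quivers such that: (i) there are $k$ vertices; (ii) all cycles are oriented and of length 3, where a cycle means a (non-trivial) simple cycle in the underlying graph, i.e. a closed walk of positive length that repeats no edge and no vertex apart from its start and end point (two parallel arrows count as a cycle of length 2 and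 so do not occur); (iii) every vertex has valency at most four; (iv) if a vertex has valency four, then two of its incident arrows belong to one 3-cycle and the other two belong to another 3-cycle; (v) if a vertex has valency three, then two of its incident arrows belong to a 3-cycle and the third incident arrow belongs to no 3-cycle. Put $\mathcal{M}^A=\bigcup_{k\geq 1}\mathcal{M}^A_k$. A vertex $v$ of $\Gamma\in\mathcal{M}^A$ is a connecting vertex for $\Gamma$ if $v$ has valency at most 2 in $\Gamma$ and, in case $v$ has valency 2, $v$ lies on a 3-cycle in $\Gamma$. $\mathcal{M}^D_n$ is the set of quivers $Q$ with $n$ vertices belonging to at least one of the following types. Type I: $Q$ has two distinct vertices $a,b$ of valency one, each joined by exactly one arrow (of arbitrary direction) to the same vertex $c$, such that $Q'=Q\setminus\{a,b\}$ is in $\mathcal{M}^A_{n-2}$ and $c$ is a connecting vertex for $Q'$. Type II: $Q$ has a full subquiver on four vertices $a,b,c,d$ whose arrows are exactly one each of $d\to c$, $c\to a$, $c\to b$, $a\to d$, $b\to d$; the vertices $a$ and $b$ have valency 2 in $Q$; and after deleting $a$, $b$ and the arrow $d\to c$, the quiver is the disjoint union of two connected components $Q'$ and $Q''$, one containing $c$ and the other containing $d$, both in $\mathcal{M}^A$, with $c$ and $d$ connecting vertices for their respective components. Type III: $Q$ has a full subquiver which is a directed 4-cycle $c\to a\to d\to b\to c$ (one arrow each); $a$ and $b$ have valency 2 in $Q$; and $Q\setminus\{a,b\}$ is the disjoint union of two connected components $Q'$ and $Q''$, one containing $c$ and the other containing $d$, both in $\mathcal{M}^A$, with $c$ and $d$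 connecting vertices for their respective components. Type IV: $Q$ has a full subquiver which is a directed $k$-cycle, $k\ge3$ (the central cycle). For each arrow $\alpha:a\to b$ of the central cycle there may or may not be a vertex $c_\alpha$ not on the central cycle such that there is an oriented 3-cycle $a\overset{\alpha}{\to}b\to c_\alpha\to a$ which is a full subquiver (one arrow each); such a 3-cycle is called a spike (at most one for each $\alpha$). There are no arrows of $Q$ starting or ending in vertices of the central cycle other than those of the central cycle and of the spikes. Deleting all vertices of the central cycle and their incident arrows leaves a disjoint union of connected quivers, exactly one for each spike, each in $\mathcal{M}^A$, such that the component corresponding to the spike of $\alpha$ contains $c_\alpha$ and has $c_\alpha$ as a connecting vertex. (There may be no spikes, in which case $Q$ is just the central cycle.) The components $Q',Q'',\dots$ may consist of a single vertex. *)

(* Defs.v *)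
From mathcomp Require Import all_boot.

Set Implicit Arguments.
Unset Strict Implicit.
Unset Printing Implicit Defensive.

Record quiver : Type := Quiver {
  vertex : finType;
  arrow : finType;
  qtail : arrow -> vertex;
  qhead : arrow -> vertex;
  no_loop : forall x : arrow, qtail x <> qhead x;
  no_2cycle : forall x y : arrow, ~ (qhead y = qtail x /\ qtail y = qhead x)
}.

Arguments qtail {q} x.
Arguments qhead {q} x.

Definition isomorphic (Q Q' : quiver) : Prop :=
  exists (f : vertex Q -> vertex Q') (g : arrow Q -> arrow Q'),
    [/\ bijective f, bijective g,
        forall x, qtail (g x) = f (qtail x)
      & forall x, qhead (g x) = f (qhead x)].

Definition narrows (Q : quiver) (i j : vertex Q) : nat :=
  #|[set x : arrow Q | (qtail x == i) && (qhead x == j)]|.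

Definition incident (Q : quiver) (v : vertex Q) : {set arrow Q} :=
  [set x : arrow Q | (qtail x == v) || (qhead x == v)].

Definition adjacent (Q : quiver) : rel (vertex Q) :=
  [rel i j | (0 < narrows i j) || (0 < narrows j i)].

Definition valency (Q : quiver) (i : vertex Q) : nat :=
  #|[set j : vertex Q | (j != i) && adjacent i j]|.

Definition component (Q : quiver) (v : vertex Q) : {set vertex Q} :=
  [set x | connect (@adjacent Q) v x].

Definition connected_quiver (Q : quiver) : Prop :=
  forall x y : vertex Q, connect (@adjacent Q) x y.

(* The quiver with exactly [m i j] arrows from i to j. Taking i = j in the    *)
(* hypothesis gives [m i i = 0], so it excludes loops as well as 2-cycles.    *)
Section QuiverOfMultiplicity.

Variables (V : finType) (m : V -> V -> nat).
Hypothesis m_anti : forall i j, m i j = 0 \/ m j i = 0.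

Let marrow : finType := {p : V * V & 'I_(m p.1 p.2)}.

Lemma mult_arrow_gt0 (x : marrow) : 0 < m (tag x).1 (tag x).2.
Proof. by case: x => p i /=; exact: leq_ltn_trans (leq0n i) (ltn_ord i). Qed.

Lemma mult_no_2cycle (x y : marrow) :
  ~ ((tag y).2 = (tag x).1 /\ (tag y).1 = (tag x).2).
Proof.
move=> [e1 e2]; have := mult_arrow_gt0 x; have := mult_arrow_gt0 y.
by rewrite e1 e2; case: (m_anti (tag x).1 (tag x).2) => ->; rewrite ?ltnn.
Qed.

Lemma mult_no_loop (x : marrow) : (tag x).1 <> (tag x).2.
Proof. by move=> e; apply: (@mult_no_2cycle x x). Qed.

Definition quiver_of_mult : quiver :=
  Quiver mult_no_loop mult_no_2cycle.

End QuiverOfMultiplicity.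

(* Number of arrows j -> k after mutation at i. Away from i, the truncated    *)
(* subtraction is the cancellation of a maximal number of 2-cycles among the  *)
(* old arrows and the arrows added for the paths through i.                   *)
Definition mut_mult (Q : quiver) (i j k : vertex Q) : nat :=
  if (j == i) || (k == i) then narrows k j
  else (narrows j k + narrows j i * narrows i k)
       - (narrows k j + narrows k i * narrows i j).

Lemma narrows_anti (Q : quiver) (i j : vertex Q) :
  narrows i j = 0 \/ narrows j i = 0.
Proof.
have [->|nz] := posnP (narrows i j); first by left.
right; apply/eqP; rewrite cards_eq0; apply/eqP/setP => y; rewrite !inE.
move: nz; rewrite card_gt0 => /set0Pn[x]; rewrite inE => /andP[/eqP tx /eqP hx].
apply/negP => /andP[/eqP ty /eqP hy].
by apply: (@no_2cycle Q x y); rewrite hy tx ty hx.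
Qed.

Lemma mut_mult_anti (Q : quiver) (i j k : vertex Q) :
  mut_mult i j k = 0 \/ mut_mult i k j = 0.
Proof.
rewrite /mut_mult [(k == i) || _]orbC; case: ifP => _; first exact: narrows_anti.
set u := (X in X - _ = 0); set w := (X in _ - X = 0).
by case/orP: (leq_total u w) => uw; [left|right]; apply/eqP.
Qed.

Definition mutation (Q : quiver) (i : vertex Q) : quiver :=
  quiver_of_mult (@mut_mult_anti Q i).

Inductive mutates_to (Q Q' : quiver) : Prop :=
| mutates_iso of isomorphic Q Q'
| mutates_step (i : vertex Q) of mutates_to (mutation i) Q'.

Definition mutation_equivalent (Q Q' : quiver) : Prop :=
  mutates_to Q Q' \/ mutates_to Q' Q.

(* The vertex i : 'I_n carries the label i + 1 in {1, ..., n}.                *)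
Definition D_edge (n u v : nat) : bool :=
  [|| (1 <= u <= n - 3) && (v == u.+1),
      (u == n - 2) && (v == n - 1)
    | (u == n - 2) && (v == n)].

Definition D_mult (n : nat) (i j : 'I_n) : nat := D_edge n i.+1 j.+1.

Lemma D_edge_lt (n u v : nat) : 0 < u -> D_edge n u v -> u < v.
Proof.
move=> u_gt0 /or3P[/andP[_ /eqP->]//||] /andP[/eqP eu /eqP->].
  by case: n eu => [|[|n]] eu; move: u_gt0; rewrite eu // !subSS !subn0.
by case: n eu => [|[|n]] eu; move: u_gt0; rewrite eu // !subSS !subn0.
Qed.

Lemma D_mult_anti (n : nat) (i j : 'I_n) : D_mult i j = 0 \/ D_mult j i = 0.
Proof.
rewrite /D_mult; case: (boolP (D_edge n i.+1 j.+1)) => [ij|_]; last by left.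
case: (boolP (D_edge n j.+1 i.+1)) => [ji|_]; last by right.
have := ltn_trans (D_edge_lt (ltn0Sn _) ij) (D_edge_lt (ltn0Sn _) ji).
by rewrite ltnn.
Qed.

Definition D_quiver (n : nat) : quiver := quiver_of_mult (@D_mult_anti n).

Section Subquiver.

Variables (Q : quiver) (A : {set vertex Q}) (B : {set arrow Q}).

Let sub_vertex : finType := {v : vertex Q | v \in A}.
Let sub_arrow : finType :=
  {x : arrow Q | [&& x \in B, qtail x \in A & qhead x \in A]}.

Lemma sub_tail_proof (x : sub_arrow) : qtail (val x) \in A.
Proof. by case/and3P: (valP x). Qed.

Lemma sub_head_proof (x : sub_arrow) : qhead (val x) \in A.
Proof. by case/and3P: (valP x). Qed.

Definition sub_tail (x : sub_arrow) : sub_vertex := exist (fun v => v \in A) _ (sub_tail_proof x).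
Definition sub_head (x : sub_arrow) : sub_vertex := exist (fun v => v \in A) _ (sub_head_proof x).

Lemma sub_no_loop (x : sub_arrow) : sub_tail x <> sub_head x.
Proof. by move/(congr1 val); exact: no_loop. Qed.

Lemma sub_no_2cycle (x y : sub_arrow) :
  ~ (sub_head y = sub_tail x /\ sub_tail y = sub_head x).
Proof.
case=> /(congr1 val) e1 /(congr1 val) e2.
exact: (@no_2cycle Q (val x) (val y)).
Qed.

Definition subquiver : quiver := Quiver sub_no_loop sub_no_2cycle.

Definition sub_incl (v : vertex subquiver) : vertex Q := sval v.

End Subquiver.

Definition full_subquiver (Q : quiver) (A : {set vertex Q}) : quiver :=
  subquiver A [set: arrow Q].

Definition delete_vertices (Q : quiver) (A : {set vertex Q}) : quiver :=
  full_subquiver (~: A).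

(* The full subquiver on the distinct vertices S has exactly the arrows       *)
(* listed, with multiplicity, in E as (tail, head) pairs.                     *)
Definition full_on (Q : quiver) (S : seq (vertex Q))
    (E : seq (vertex Q * vertex Q)) : Prop :=
  uniq S /\
  forall x y, x \in S -> y \in S -> narrows x y = count_mem (x, y) E.

(* A walk in the underlying graph is a sequence of steps (x, b): the arrow x  *)
(* is traversed from tail to head if b = true, backwards if b = false.        *)
Definition step_src (Q : quiver) (p : arrow Q * bool) : vertex Q :=
  if p.2 then qtail p.1 else qhead p.1.

Definition step_dst (Q : quiver) (p : arrow Q * bool) : vertex Q :=
  if p.2 then qhead p.1 else qtail p.1.

Definition simple_cycle (Q : quiver) (s : seq (arrow Q * bool)) : Prop :=
  [/\ s <> [::],
      cycle [rel p q | step_dst p == step_src q] s,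
      uniq [seq p.1 | p <- s]
    & uniq [seq step_src p | p <- s]].

Definition oriented_cycle (Q : quiver) (s : seq (arrow Q * bool)) : Prop :=
  constant [seq p.2 | p <- s].

Definition three_cycle (Q : quiver) (C : {set arrow Q}) : Prop :=
  exists s : seq (arrow Q * bool),
    [/\ simple_cycle s, size s = 3 & C = [set:: [seq p.1 | p <- s]]].

Definition MA_k (k : nat) (Q : quiver) : Prop :=
  connected_quiver Q /\
  [/\ #|vertex Q| = k,
      forall s : seq (arrow Q * bool),
        simple_cycle s -> oriented_cycle s /\ size s = 3,
      forall v : vertex Q, valency v <= 4,
      forall v : vertex Q, valency v = 4 ->
        exists C1 C2 I1 I2 : {set arrow Q},
          [/\ three_cycle C1, three_cycle C2 & C1 <> C2] /\
          [/\ I1 :|: I2 = incident v, [disjoint I1 & I2],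
              #|I1| = 2 /\ #|I2| = 2, I1 \subset C1 & I2 \subset C2]
    & forall v : vertex Q, valency v = 3 ->
        exists (C I : {set arrow Q}) (y : arrow Q),
          [/\ y |: I = incident v, y \notin I, #|I| = 2,
              three_cycle C /\ I \subset C
            & forall C' : {set arrow Q}, three_cycle C' -> y \notin C']].

Definition MA (Q : quiver) : Prop := exists2 k, 1 <= k & MA_k k Q.

Definition connecting_vertex (Q : quiver) (v : vertex Q) : Prop :=
  valency v <= 2 /\
  (valency v = 2 ->
     exists (C : {set arrow Q}) (x : arrow Q),
       [/\ three_cycle C, x \in C & x \in incident v]).

Lemma component_refl (Q : quiver) (v : vertex Q) : v \in component v.
Proof. by rewrite inE connect0. Qed.

Definition component_quiver (Q : quiver) (v : vertex Q) : quiver :=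
  full_subquiver (component v).

Definition component_base (Q : quiver) (v : vertex Q) :
  vertex (component_quiver v) :=
  exist (fun w => w \in component v) v (component_refl v).

Definition MA_component (Q : quiver) (v : vertex Q) : Prop :=
  MA (component_quiver v) /\ connecting_vertex (component_base v).

Definition two_MA_components (Q : quiver) (c d : vertex Q) : Prop :=
  [/\ component c <> component d,
      component c :|: component d = [set: vertex Q],
      MA_component c
    & MA_component d].

Definition type_I (n : nat) (Q : quiver) : Prop :=
  exists (a b : vertex Q) (c : vertex (delete_vertices [set a; b])),
    [/\ a <> b, valency a = 1 /\ valency b = 1,
        narrows a (sub_incl c) + narrows (sub_incl c) a = 1 /\
        narrows b (sub_incl c) + narrows (sub_incl c) b = 1,
        MA_k (n - 2) (delete_vertices [set a; b])
      & connecting_vertex c].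

Definition type_II (Q : quiver) : Prop :=
  exists a b c d : vertex Q,
    [/\ full_on [:: a; b; c; d] [:: (d, c); (c, a); (c, b); (a, d); (b, d)],
        valency a = 2, valency b = 2
      & let dc := [set x : arrow Q | (qtail x == d) && (qhead x == c)] in
        exists c' d' : vertex (subquiver (~: [set a; b]) (~: dc)),
          [/\ sub_incl c' = c, sub_incl d' = d & two_MA_components c' d']].

Definition type_III (Q : quiver) : Prop :=
  exists a b c d : vertex Q,
    [/\ full_on [:: a; b; c; d] [:: (c, a); (a, d); (d, b); (b, c)],
        valency a = 2, valency b = 2
      & exists c' d' : vertex (delete_vertices [set a; b]),
          [/\ sub_incl c' = c, sub_incl d' = d & two_MA_components c' d']].

(* p lists the central cycle in order; its arrows are a -> next p a, a \in p. *)
(* The spike of this arrow, if any, has as third vertex the value of tip a,   *)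
(* a vertex of the quiver left after deleting the central cycle.              *)
Definition type_IV (Q : quiver) : Prop :=
  exists p : seq (vertex Q),
    [/\ 3 <= size p,
        full_on p [seq (a, next p a) | a <- p]
      & let R := delete_vertices [set a in p] in
        exists tip : vertex Q -> option (vertex R),
          [/\ forall a v, a \in p -> tip a = Some v ->
                full_on [:: a; next p a; sub_incl v]
                  [:: (a, next p a); (next p a, sub_incl v); (sub_incl v, a)],
              forall x : arrow Q, (qtail x \in p) || (qhead x \in p) ->
                exists2 a, a \in p &
                  (qtail x, qhead x) = (a, next p a) \/
                  exists2 v, tip a = Some v &
                    (qtail x, qhead x) = (next p a, sub_incl v) \/
                    (qtail x, qhead x) = (sub_incl v, a),
              forall w : vertex R, exists a v,
                [/\ a \in p, tip a = Some v & w \in component v],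
              forall a a' v v', a \in p -> a' \in p ->
                tip a = Some v -> tip a' = Some v' ->
                component v = component v' -> a = a'
            & forall a v, a \in p -> tip a = Some v -> MA_component v]].

Definition MD (n : nat) (Q : quiver) : Prop :=
  #|vertex Q| = n /\
  [\/ type_I n Q, type_II Q, type_III Q | type_IV Q].

(* Main.v *)
(* The quivers of type D_n are those of the tagged triangulations of a        *)
(* once-punctured n-gon, and mutation is the flip of an arc.  A connected     *)
(* quiver in M^A with a chosen connecting vertex is the same thing as a       *)
(* nonempty binary tree (a triangulated polygon with a chosen arc), and       *)
(* flipping a non-root arc is a tree rotation.  A punctured polygon is either *)
(* a cyclic sequence of at least two radii with a (possibly empty) tree       *)
(* between any two consecutive ones, or two parallel tagged radii with two    *)
(* trees.  The former gives Type IV, or Type III or I when there are only two *)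
(* radii, whose opposite arrows cancel; the latter gives Type II or I.  In    *)
(* terms of the skew-symmetric matrix of the quiver every flip is one         *)
(* identity between sums of oriented triangles, so the set of these data is   *)
(* closed under mutation; conversely, flips reduce the number of radii to two *)
(* and then straighten the trees until the D_n quiver is reached.             *)

Require Import Defs.
From mathcomp Require Import all_boot all_order all_algebra ring zify.
Import Order.TTheory GRing.Theory Num.Theory.

Set Implicit Arguments.
Unset Strict Implicit.
Unset Printing Implicit Defensive.

(** Everything is read off the skew-symmetric matrix [bmat]: it determines a quiver up to
    isomorphism ([isomorphic_bmat]) and turns mutation into [mut] ([bmat_mutation]). A datum
    [X : dtri V] is a triangulation of a punctured polygon with arcs named by [V], and [cb X] is its
    matrix. [realize X] says that the arcs of [X] are the vertices of the quiver, each occurring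
    once, and that the two matrices agree. Both sides of the theorem are shown equivalent to the
    existence of such an [X].

    Mutation side. [cb X] is a sum of matrices of oriented triangles, and mutation at an arc i
    changes only the summands at i. For an ordinary arc the two triangles of a quadrilateral are
    exchanged for the two cut out by the other diagonal ([mut_flip]); near a pair of tagged radii a
    direct computation replaces this ([dmut_dbl_cyc], [dmut_dbl_root]). So every arc can be flipped
    inside the class ([dmut_exists]). Realizability therefore passes along mutations and, mutation
    being an involution, also backwards. The D_n quiver is realized ([D_quiver_realize]), hence so
    is everything mutation equivalent to it. Conversely, flips bring any [X] to a tagged pair with
    one empty tree and one comb, whose quiver is the D_n quiver ([mutates_realized]).

    Type side. The bridge is [MA_tree]: a quiver of M^A with a connecting vertex v is a binary tree
    with root v. For a connected quiver, membership in M^A is a statement about the underlying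
    graph: all cycles are oriented triangles ([oriented_triangles]) and no vertex has three pairwise
    nonadjacent neighbours ([claw_free]); a connecting vertex is one whose neighbours are pairwise
    adjacent ([simplicial]). Deleting v and cutting the triangle at v, if there is one, leaves at
    most two pieces. Each hangs from a neighbour of v that is simplicial in its piece, so induction
    builds the tree ([tree_exists]). Conversely, subtrees are glued at cut vertices, so the only
    cycles of a tree quiver are its triangles ([tree_triangles]), and the neighbours of a vertex
    form at most two cliques ([tree_claw_free]). With trees in place of the components, the four
    types become the possible shapes of [X] ([MD_realized]). *)

(** * Mutation of skew-symmetric matrices *)

Section Matrices.

Variable V : eqType.
Implicit Types (b R : V -> V -> int) (x y z w : option V) (i j k : V).

Local Open Scope ring_scope.

Definition antisymm b := forall j k, b j k = - b k j.

Definition pos (a : int) : int := if 0 <= a then a else 0.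

Definition mut b i j k : int :=
  if (j == i) || (k == i) then - b j k
  else b j k + pos (b j i) * pos (b i k) - pos (b k i) * pos (b i j).

Lemma eq_mut b1 b2 i : b1 =2 b2 -> mut b1 i =2 mut b2 i.
Proof. by move=> eb j k; rewrite /mut !eb. Qed.

(** Row and column i have changed sign, so the two correction terms of the second mutation are those
    of the first with opposite signs. *)
Lemma mut_mut b i : antisymm b -> mut (mut b i) i =2 b.
Proof.
move=> sb j k; rewrite /mut !eqxx !orbT.
case: (boolP ((j == i) || (k == i))) => [_|nji] /=; first by rewrite opprK.
by rewrite -(sb i j) -(sb j i) -(sb i k) -(sb k i); ring.
Qed.

(* The truncated products in a mutation become bilinear once the row of i is  *)
(* split into its positive part P and its negative part M.                    *)
Lemma mut_split b i (P M : V -> int) :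
    antisymm b -> (forall j, b i j = P j - M j) ->
    (forall j, 0 <= P j) -> (forall j, 0 <= M j) ->
    (forall j, P j * M j = 0) ->
  forall b', antisymm b' -> (forall k, b' i k = - b i k) ->
    (forall j k, j != i -> k != i -> b' j k = b j k + M j * P k - M k * P j) ->
  mut b i =2 b'.
Proof.
move=> sb bPM P0 M0 PM0 b' sb' b'i eb' j k; rewrite /mut.
have PM l : (P l == 0) || (M l == 0) by rewrite -mulf_eq0 PM0.
have pP l : pos (b i l) = P l.
  by rewrite bPM /pos; case/orP: (PM l) => /eqP e; have := P0 l;
     have := M0 l; case: ifP; rewrite e; lia.
have pM l : pos (b l i) = M l.
  by rewrite sb bPM /pos; case/orP: (PM l) => /eqP e; have := P0 l;
     have := M0 l; case: ifP; rewrite e; lia.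
case: (j =P i) => [->|/eqP ji] /=; first by rewrite b'i.
case: (k =P i) => [->|/eqP ki]; first by rewrite sb sb' b'i.
by rewrite eb' // !pP !pM.
Qed.

Definition delta x j : int := (x == Some j)%:R.

Definition arr x y j k : int := delta x j * delta y k - delta x k * delta y j.

(* An oriented triangle x -> y -> z -> x, in which the corner None stands for a *)
(* boundary side: the arrows at None vanish.                                  *)
Definition tri x y z j k : int := arr x y j k + arr y z j k + arr z x j k.

Lemma tri_antisymm x y z : antisymm (tri x y z).
Proof. by move=> j k; rewrite /tri /arr; ring. Qed.

Lemma delta_ge0 x j : 0 <= delta x j.
Proof. by rewrite /delta; case: eqP. Qed.

Lemma delta_id i : delta (Some i) i = 1.
Proof. by rewrite /delta eqxx. Qed.

Lemma delta_neq x j : x != Some j -> delta x j = 0.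
Proof. by rewrite /delta => /negbTE->. Qed.

Lemma delta_some v j : delta (Some v) j = Posz (v == j).
Proof. by rewrite /delta (inj_eq Some_inj); case: eqP. Qed.

Lemma delta_None j : delta None j = 0.
Proof. by []. Qed.

(* Distinct, except that boundary sides need not be.                          *)
Definition sep x y := (x == None) || (x != y).

Lemma sep_delta x y j : sep x y -> delta x j * delta y j = 0.
Proof.
rewrite /sep /delta; case: x => [x|] /=; last by rewrite mul0r.
case: (Some x =P Some j) => [->|]; last by rewrite mul0r.
by case: (y =P Some j) => [->|]; [rewrite eqxx | rewrite mulr0].
Qed.

(* Flipping the diagonal i of the quadrilateral with sides x, y, z, w.         *)
Lemma mut_flip b R i x y z w :
    (forall j k, b j k = tri (Some i) x y j k + tri (Some i) z w j k + R j k) ->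
    antisymm R -> (forall j, R i j = 0) ->
    x != Some i -> y != Some i -> z != Some i -> w != Some i ->
    sep x y -> sep x w -> sep z y -> sep z w ->
  forall j k, mut b i j k =
    tri (Some i) y z j k + tri (Some i) w x j k + R j k.
Proof.
move=> eb sR Ri xi yi zi wi xy xw zy zw.
pose d0 := (delta_neq xi, delta_neq yi, delta_neq zi, delta_neq wi).
apply: (@mut_split b i (fun l => delta x l + delta z l)
                       (fun l => delta y l + delta w l)).
- by move=> l m; rewrite !eb sR (tri_antisymm _ x) (tri_antisymm _ z); ring.
- by move=> l; rewrite eb Ri /tri /arr delta_id !d0; ring.
- by move=> l; rewrite addr_ge0 ?delta_ge0.
- by move=> l; rewrite addr_ge0 ?delta_ge0.
- by move=> l; rewrite mulrDl !mulrDr !sep_delta.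
- by move=> l m; rewrite sR (tri_antisymm _ y) (tri_antisymm _ w); ring.
- by move=> k; rewrite eb Ri /tri /arr delta_id !d0; ring.
- move=> j k ji ki; rewrite eb /tri /arr.
  by rewrite !(@delta_neq (Some i)) ?(inj_eq Some_inj) 1?eq_sym //; ring.
Qed.

End Matrices.

(** * Binary trees and rotations *)

(* A node is an arc v and its children are the other two sides of the triangle *)
(* below it, E being a boundary side; the arrows are v -> l -> r -> v.         *)
Inductive tree (V : Type) : Type := E | N (v : V) (l r : tree V).
Arguments E {V}.

Section TreeDefs.

Variables (V W : Type).

Definition troot (t : tree V) : option V :=
  if t is N v _ _ then Some v else None.

Fixpoint labels (t : tree V) : seq V :=
  if t is N v l r then v :: labels l ++ labels r else [::].

Fixpoint map_tree (f : V -> W) (t : tree V) : tree W :=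
  if t is N v l r then N (f v) (map_tree f l) (map_tree f r) else E.

(** The normal form of the reduction: the quiver of a comb is a path with all arrows running from
    child to parent. *)
Fixpoint comb (s : seq V) : tree V :=
  if s is v :: s' then N v E (comb s') else E.

End TreeDefs.

(** The flip of i in the quadrilateral made of the triangle below i and the one above it. The parent
    p keeps its place and the new diagonal keeps the name i; the root, a side of the whole polygon,
    is never flipped. *)
Inductive tree_rot (V : Type) (i : V) : tree V -> tree V -> Prop :=
| tree_rot_right p l m r : tree_rot i (N p (N i l m) r) (N p l (N i m r))
| tree_rot_left p l m r : tree_rot i (N p l (N i m r)) (N p (N i l m) r)
| tree_rot_in_left v l l' r of tree_rot i l l' : tree_rot i (N v l r) (N v l' r)
| tree_rot_in_right v l r r' of tree_rot i r r' : tree_rot i (N v l r) (N v l r').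

Section Trees.

Variable V : eqType.
Implicit Types (t l r : tree V) (x y z : option V) (R : V -> V -> int) (i j k v : V).

Local Open Scope ring_scope.

Fixpoint tb t j k : int :=
  if t is N v l r
  then tri (Some v) (troot l) (troot r) j k + tb l j k + tb r j k else 0.

Lemma tb_antisymm t : antisymm (tb t).
Proof.
elim: t => [|v l IHl r IHr] j k /=; first by rewrite oppr0.
by rewrite IHl IHr tri_antisymm; ring.
Qed.

Lemma troot_neq t j : j \notin labels t -> troot t != Some j.
Proof.
by case: t => //= v l r; rewrite inE negb_or (inj_eq Some_inj) eq_sym;
   case/andP.
Qed.

Lemma tri_out x y z j k : x != Some j -> y != Some j -> z != Some j ->
  tri x y z j k = 0.
Proof.
by move=> nx ny nz; rewrite /tri /arr !(delta_neq nx, delta_neq ny, delta_neq nz);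
   ring.
Qed.

Lemma tb_out t j k : j \notin labels t -> tb t j k = 0.
Proof.
elim: t => //= v l IHl r IHr; rewrite inE mem_cat !negb_or => /and3P[jv jl jr].
rewrite IHl // IHr // tri_out ?troot_neq //.
by rewrite (inj_eq Some_inj) eq_sym.
Qed.

Lemma tb_out2 t j k : k \notin labels t -> tb t j k = 0.
Proof. by move=> kt; rewrite tb_antisymm tb_out ?oppr0. Qed.

Lemma sep_troot l r :
  (forall j, j \in labels l -> j \notin labels r) -> sep (troot l) (troot r).
Proof.
rewrite /sep; case: l => //= v l l' /(_ v); rewrite inE eqxx => /(_ isT).
by case: r => //= w r r'; rewrite inE negb_or (inj_eq Some_inj) => /andP[].
Qed.

Lemma uniq_node v l r : uniq (labels (N v l r)) ->
  [/\ v \notin labels l, v \notin labels r, uniq (labels l), uniq (labels r)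
    & forall j, j \in labels l -> j \notin labels r].
Proof.
rewrite /= mem_cat negb_or cat_uniq => /and3P[/andP[vl vr] ul /andP[lr ur]].
by split=> // j jl; apply: contra lr => jr; apply/hasP; exists j.
Qed.

Lemma tree_rot_perm i t t' : tree_rot i t t' -> perm_eq (labels t') (labels t).
Proof.
elim=> {t t'} [p l m r|p l m r|v l l' r _ IH|v l r r' _ IH] /=;
  last 1 [by rewrite perm_cons perm_cat2r|by rewrite perm_cons perm_cat2l];
rewrite perm_cons; apply/permP => a;
  rewrite !count_cat /= !count_cat /= ?count_cat; lia.
Qed.

Lemma tree_rot_root i t t' : tree_rot i t t' -> troot t' = troot t.
Proof. by case. Qed.

Lemma tree_rot_nonroot i t t' : tree_rot i t t' -> uniq (labels t) ->
  (i \in labels t) /\ troot t != Some i.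
Proof.
elim=> {t t'} [p l m r|p l m r|v l l' r _ IH|v l r r' _ IH]
  /uniq_node[vl vr ul ur lr] /=; rewrite ?inE ?mem_cat ?(inj_eq Some_inj).
- move: vl; rewrite /= !inE !mem_cat !negb_or eqxx => /and3P[pi _ _].
  by rewrite orbT.
- move: vr; rewrite /= !inE !mem_cat !negb_or eqxx => /and3P[pi _ _].
  by rewrite !orbT.
- have [il _] := IH ul; rewrite il orbT; split=> //.
  by apply: contraNneq vl => ->.
- have [ir _] := IH ur; rewrite ir !orbT; split=> //.
  by apply: contraNneq vr => ->.
Qed.

Lemma sepC x y : sep x y -> sep y x.
Proof. by rewrite /sep [_ == y]eq_sym; case: x => [x|]; case: y => [y|]. Qed.

Lemma sep_node v t : v \notin labels t -> sep (Some v) (troot t).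
Proof. by move/troot_neq; rewrite /sep eq_sym. Qed.

Lemma tri_rot x y z j k : tri x y z j k = tri y z x j k.
Proof. by rewrite /tri; ring. Qed.

(** [R] is the part of the matrix outside the tree. It may touch any label except i, so the
    induction can move the triangle of a node and the sibling subtree into it. *)
Lemma tree_rot_mut i t t' : tree_rot i t t' -> uniq (labels t) ->
  forall b R, (forall j k, b j k = tb t j k + R j k) ->
    antisymm R -> (forall j, R i j = 0) ->
  forall j k, mut b i j k = tb t' j k + R j k.
Proof.
elim=> {t t'} [p l m r|p l m r|v l l' r rl IH|v l r r' rr IH]
  /uniq_node[vl vr ul ur lr] b R eb sR Ri j k.
- have [il im _ _ lm] := uniq_node ul.
  move: vl; rewrite /= inE mem_cat !negb_or => /and3P[pi pl pm].
  have ir : i \notin labels r by apply: lr; rewrite /= inE eqxx.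
  have lr' w : w \in labels l -> w \notin labels r.
    by move=> wl; apply: lr; rewrite /= inE mem_cat wl orbT.
  have mr w : w \in labels m -> w \notin labels r.
    by move=> wm; apply: lr; rewrite /= inE mem_cat wm !orbT.
  (* The two triangles at i are i, r, p above and i, l, m below. *)
  rewrite (@mut_flip _ b (fun j k => tb l j k + tb m j k + tb r j k + R j k) i
     (troot r) (Some p) (troot l) (troot m)).
  + by rewrite /= (tri_rot (Some p)) (tri_rot _ _ (Some p)); ring.
  + by move=> j' k'; rewrite eb /= /tri; ring.
  + by move=> j' k'; rewrite (tb_antisymm l) (tb_antisymm m) (tb_antisymm r) sR; ring.
  + by move=> j'; rewrite !tb_out // Ri; ring.
  + exact: troot_neq.
  + by rewrite (inj_eq Some_inj).
  + exact: troot_neq.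
  + exact: troot_neq.
  + by apply: sepC; exact: sep_node.
  + by apply: sepC; exact: sep_troot.
  + by apply: sepC; exact: sep_node.
  + exact: sep_troot.
- have [im ir _ _ mr] := uniq_node ur.
  move: vr; rewrite /= inE mem_cat !negb_or => /and3P[pi pm pr].
  have il : i \notin labels l.
    by apply/negP => /lr; rewrite /= inE eqxx.
  have lm w : w \in labels l -> w \notin labels m.
    by move/lr; rewrite /= inE mem_cat !negb_or => /and3P[].
  have lr' w : w \in labels l -> w \notin labels r.
    by move/lr; rewrite /= inE mem_cat !negb_or => /and3P[].
  rewrite (@mut_flip _ b (fun j k => tb l j k + tb m j k + tb r j k + R j k) i
     (Some p) (troot l) (troot m) (troot r)).
  + by rewrite /= /tri; ring.
  + by move=> j' k'; rewrite eb /= /tri; ring.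
  + by move=> j' k'; rewrite (tb_antisymm l) (tb_antisymm m) (tb_antisymm r) sR; ring.
  + by move=> j'; rewrite !tb_out // Ri; ring.
  + by rewrite (inj_eq Some_inj).
  + exact: troot_neq.
  + exact: troot_neq.
  + exact: troot_neq.
  + exact: sep_node.
  + exact: sep_node.
  + by apply: sepC; exact: sep_troot.
  + exact: sep_troot.
- have [il nil] := tree_rot_nonroot rl ul.
  have vi : v != i by apply: contraNneq vl => ->.
  rewrite (IH ul b (fun j k => tri (Some v) (troot l) (troot r) j k
     + tb r j k + R j k)) /=.
  + by rewrite (tree_rot_root rl); ring.
  + by move=> j' k'; rewrite eb /=; ring.
  + by move=> j' k'; rewrite tb_antisymm tri_antisymm sR; ring.
  + move=> j'; rewrite Ri (tb_out _ (lr _ il)) tri_out ?(inj_eq Some_inj) //.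
    by apply/troot_neq/lr.
- have [ir nir] := tree_rot_nonroot rr ur.
  have vi : v != i by apply: contraNneq vr => ->.
  have il : i \notin labels l by apply/negP => /lr; rewrite ir.
  rewrite (IH ur b (fun j k => tri (Some v) (troot l) (troot r) j k
     + tb l j k + R j k)) /=.
  + by rewrite (tree_rot_root rr); ring.
  + by move=> j' k'; rewrite eb /=; ring.
  + by move=> j' k'; rewrite tb_antisymm tri_antisymm sR; ring.
  + move=> j'; rewrite Ri (tb_out _ il) tri_out ?(inj_eq Some_inj) //.
    exact: troot_neq.
Qed.

Lemma tree_rot_exists i t : i \in labels t -> troot t != Some i ->
  exists t', tree_rot i t t'.
Proof.
elim: t => //= v l IHl r IHr; rewrite inE mem_cat (inj_eq Some_inj).
move=> + /negbTE vi; rewrite eq_sym vi /= => /orP[].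
- case: (troot l =P Some i) => [el|/eqP nl] il.
    case: l el {IHl il} => //= _ m m' [->].
    by exists (N v m (N i m' r)); constructor.
  by have [l' rl] := IHl il nl; exists (N v l' r); constructor.
- case: (troot r =P Some i) => [er|/eqP nr] ir.
    case: r er {IHr ir} => //= _ m m' [->].
    by exists (N v (N i l m) m'); constructor.
  by have [r' rr] := IHr ir nr; exists (N v l r'); constructor.
Qed.

(** Termination measure for straightening: a right rotation at the left child w of a node lowers it
    by one more than the size of the left subtree of w. *)
Fixpoint leftness t : nat :=
  if t is N v l r then (size (labels l) + leftness l + leftness r)%N else 0%N.

Lemma tree_rot_comb t :
  t = comb (labels t) \/ exists i t', tree_rot i t t' /\ (leftness t' < leftness t)%N.
Proof.
elim: t => [|v l IHl r IHr] /=; first by left.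
case: l IHl => [|w l m] IHl /=; last first.
  right; exists w, (N v l (N w m r)); split; first by constructor.
  by rewrite /= size_cat; lia.
case: IHr => [er|[i [t' [rt lt]]]]; first by left; rewrite -er.
by right; exists i, (N v E t'); split; [constructor | rewrite /= !add0n].
Qed.

Lemma labels_comb (s : seq V) : labels (comb s) = s.
Proof. by elim: s => //= v s ->. Qed.

End Trees.

Section MapTree.

Variables (V W : eqType) (f : V -> W).

Lemma labels_map t : labels (map_tree f t) = map f (labels t).
Proof. by elim: t => //= v l -> r ->; rewrite map_cat. Qed.

Lemma troot_map t : troot (map_tree f t) = omap f (troot t).
Proof. by case: t. Qed.

Lemma map_comb s : map_tree f (comb s) = comb (map f s).
Proof. by elim: s => //= v s ->. Qed.

Hypothesis f_inj : injective f.

Lemma arr_map x y j k : arr (omap f x) (omap f y) (f j) (f k) = arr x y j k.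
Proof.
have e z l : delta (omap f z) (f l) = delta z l.
  by case: z => //= z; rewrite /delta !(inj_eq Some_inj) (inj_eq f_inj).
by rewrite /arr !e.
Qed.

Lemma tb_map t j k : tb (map_tree f t) (f j) (f k) = tb t j k.
Proof.
elim: t => //= v l -> r ->; congr (_ + _ + _)%R.
by rewrite /tri !troot_map -!(arr_map _ _ j k).
Qed.

End MapTree.

(** * Triangulations of a punctured polygon *)

(* Dbl a b l r: two tagged radii a and b enclosed by the triangle with sides l *)
(* and r.  Cyc s: radii in cyclic order, each with the tree hanging between it *)
(* and the next one.                                                          *)
Inductive dtri (V : Type) : Type :=
| Dbl (a b : V) (l r : tree V)
| Cyc (s : seq (V * tree V)).

Section DTriangulations.

Variable V : eqType.
Implicit Types (t l r : tree V) (s : seq (V * tree V)) (X : dtri V).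
Implicit Types (a b i j k c h e : V).

Definition slabels s : seq V := flatten [seq p.1 :: labels p.2 | p <- s].

Definition dlabels X : seq V :=
  match X with
  | Dbl a b l r => a :: b :: labels l ++ labels r
  | Cyc s => slabels s
  end.

(** A lone radius lies in a self-folded triangle, which is encoded by [Dbl] instead. *)
Definition good X : bool := if X is Cyc s then 1 < size s else true.

Local Open Scope ring_scope.

(** The cyclic sum cut open: [e] stands for the radius after the last one. Lists can then be split
    ([chain_cat]) and rotated ([cb_rot]); [cb] closes the chain by taking the first radius for
    [e]. *)
Fixpoint chain s e j k : int :=
  if s is p :: s' then
    tri (Some p.1) (Some (head e (unzip1 s'))) (troot p.2) j k
      + tb p.2 j k + chain s' e j k
  else 0.

(** In [Dbl] the radius b repeats the arrows of a, and no arrow joins a to b. In [Cyc] with two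
    radii the triangles contribute both a -> b and b -> a, which cancel in the matrix. *)
Definition cb X j k : int :=
  match X with
  | Dbl a b l r =>
      tri (Some a) (troot l) (troot r) j k
        + arr (Some b) (troot l) j k + arr (troot r) (Some b) j k
        + tb l j k + tb r j k
  | Cyc s => if s is p :: _ then chain s p.1 j k else 0
  end.

Lemma chain_antisymm s e : antisymm (chain s e).
Proof.
elim: s => [|p s IH] j k /=; first by rewrite oppr0.
by rewrite IH tb_antisymm tri_antisymm; ring.
Qed.

Lemma cb_antisymm X : antisymm (cb X).
Proof.
case: X => [a b l r|[|p s]] j k; rewrite /cb ?oppr0 //; last exact: chain_antisymm.
by rewrite tri_antisymm (tb_antisymm l) (tb_antisymm r) /arr; ring.
Qed.

Lemma chain_cat s1 s2 e j k :
  chain (s1 ++ s2) e j k = chain s1 (head e (unzip1 s2)) j k + chain s2 e j k.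
Proof.
elim: s1 => [|p s1 IH] /=; first by rewrite add0r.
by rewrite IH !addrA; case: s1 {IH} => [|q s1] //=.
Qed.

Lemma cb_rot s1 s2 j k : cb (Cyc (s1 ++ s2)) j k = cb (Cyc (s2 ++ s1)) j k.
Proof.
case: s1 s2 => [|p s1] [|q s2]; rewrite ?cats0 // /cb !cat_cons.
by rewrite -!cat_cons !chain_cat addrC.
Qed.

Lemma slabels_cat s1 s2 : slabels (s1 ++ s2) = slabels s1 ++ slabels s2.
Proof. by rewrite /slabels map_cat flatten_cat. Qed.

Lemma slabels_cons p s : slabels (p :: s) = p.1 :: labels p.2 ++ slabels s.
Proof. by []. Qed.

Lemma slabels_split s i : i \in slabels s ->
  exists s1 p s2, s = s1 ++ p :: s2 /\ i \in p.1 :: labels p.2.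
Proof.
elim: s => // p s IH; rewrite slabels_cons -cat_cons mem_cat => /orP[ip|].
  by exists [::], p, s.
by case/IH=> s1 [q [s2 [-> iq]]]; exists (p :: s1), q, s2.
Qed.

Lemma chain_out s e j k : j \notin slabels s -> e != j -> chain s e j k = 0.
Proof.
move=> + ej; elim: s => //= p s IH.
rewrite slabels_cons inE mem_cat !negb_or => /and3P[jp jt js].
rewrite IH // tb_out // tri_out ?troot_neq ?(inj_eq Some_inj) //.
  by rewrite eq_sym.
by case: s js {IH} => [|q s] //; rewrite slabels_cons inE negb_or eq_sym => /andP[].
Qed.

Definition dmut X i X' : Prop :=
  [/\ perm_eq (dlabels X') (dlabels X), good X' & mut (cb X) i =2 cb X'].

Lemma dmut_rot s1 s2 i X' :
  dmut (Cyc (s2 ++ s1)) i X' -> dmut (Cyc (s1 ++ s2)) i X'.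
Proof.
case=> pX gX mX; split=> //.
  by apply: perm_trans pX _; rewrite /= !slabels_cat perm_catC.
by move=> j k; rewrite -mX; apply: eq_mut => {}j {}k; exact: cb_rot.
Qed.


Lemma Some_neq (v w : V) : (Some v != Some w) = (v != w).
Proof. by rewrite (inj_eq Some_inj). Qed.

Lemma count_notin (T : eqType) (x : T) (s : seq T) :
  count_mem x s = 0%N -> x \notin s.
Proof. by move/count_memPn. Qed.

Lemma count_in (T : eqType) (x : T) (s : seq T) :
  x \in s -> (0 < count_mem x s)%N.
Proof. by rewrite -has_pred1 has_count. Qed.

Lemma count_cons (T : Type) (p : pred T) x (q : seq T) :
  count p (x :: q) = (p x + count p q)%N.
Proof. by []. Qed.

Lemma labels_node (v : V) l r : labels (N v l r) = v :: labels l ++ labels r.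
Proof. by []. Qed.

(** Distinctness of the labels is used in the form that each count is at most one; the side
    conditions of a flip then become linear arithmetic. *)
Ltac count_simpl :=
  rewrite /dlabels ?(slabels_cons, slabels_cat); cbn [fst snd];
  rewrite ?(labels_node, count_cat, count_cons) /= ?eqxx.

Ltac count_uniq U w := have := U w; count_simpl; lia.

Lemma uniq_count (T : eqType) (s : seq T) : uniq s ->
  forall x, (count_mem x s <= 1)%N.
Proof. by move=> us x; rewrite count_uniq_mem ?leq_b1. Qed.

Lemma neq_count (T : eqType) (x y : T) : ((x == y) : nat) = 0%N -> x != y.
Proof. by case: eqP. Qed.

Ltac solve_uniq U :=
  match goal with
  | |- is_true (?x \notin _) => apply: count_notin; count_uniq U x
  | |- is_true (troot _ != Some ?x) =>
      apply: troot_neq; apply: count_notin; count_uniq U x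
  | |- is_true (Some ?x != Some ?y) =>
      rewrite Some_neq; apply: neq_count; count_uniq U y
  | |- is_true (?x != ?y) => apply: neq_count; count_uniq U y
  | |- is_true (sep (Some ?x) (Some ?y)) => 
      rewrite /sep Some_neq /=; apply: neq_count; count_uniq U y
  | |- is_true (sep (troot _) (Some ?x)) =>
      apply: sepC; apply: sep_node; apply: count_notin; count_uniq U x
  | |- is_true (sep (Some ?x) (troot _)) =>
      apply: sep_node; apply: count_notin; count_uniq U x
  | |- is_true (sep (troot _) (troot _)) =>
      let j := fresh "j" in let h := fresh "h" in
      apply: sep_troot => j /count_in h; apply: count_notin;
      move: h; count_uniq U j
  end.

Ltac solve_perm :=
  let c := fresh "c" in apply/permP => c; count_simpl; lia.

(** Flipping one of two tagged radii moves its outer end to the other corner of the digon. In the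
    matrix, the path from the root of r through a to the root of l cancels the arrow between these
    roots. *)
Lemma dmut_dbl_cyc a b l r : uniq (dlabels (Dbl a b l r)) ->
  dmut (Dbl a b l r) a (Cyc [:: (a, l); (b, r)]).
Proof.
move/uniq_count => U; split=> //; first by solve_perm.
have al : a \notin labels l by solve_uniq U.
have ar : a \notin labels r by solve_uniq U.
have slr : sep (troot l) (troot r) by solve_uniq U.
have ba : Some b != Some a by solve_uniq U.
pose d0 := (delta_neq (troot_neq al), delta_neq (troot_neq ar), delta_neq ba).
apply: (@mut_split _ _ _ (delta (troot l)) (delta (troot r))).
- exact: cb_antisymm.
- by move=> j; rewrite /= !tb_out // /tri /arr delta_id !d0; ring.
- exact: delta_ge0.
- exact: delta_ge0.
- by move=> j; exact: sep_delta.
- exact: cb_antisymm.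
- by move=> j; rewrite /= !tb_out // /tri /arr delta_id !d0; ring.
- move=> j k ja ka; rewrite /= /tri /arr.
  by rewrite !(@delta_neq _ (Some a)) ?Some_neq 1?eq_sym //; ring.
Qed.

Lemma dmut_sym X X' i : good X -> dmut X i X' -> dmut X' i X.
Proof.
move=> gX [pX _ mX]; split=> //; first by rewrite perm_sym.
move=> j k; rewrite -(@mut_mut _ (cb X) i (@cb_antisymm _)).
by apply: eq_mut => {}j {}k; rewrite mX.
Qed.

Lemma dmut_cyc_dbl a b l r : uniq (dlabels (Cyc [:: (a, l); (b, r)])) ->
  dmut (Cyc [:: (a, l); (b, r)]) a (Dbl a b l r).
Proof.
move=> u; apply: dmut_sym => //; apply: dmut_dbl_cyc.
rewrite (@perm_uniq _ _ (dlabels (Cyc [:: (a, l); (b, r)]))) //.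
by solve_perm.
Qed.

(** The arc c is a side of the digon enclosing both radii and receives an arrow from each, so it is
    not the diagonal of an ordinary quadrilateral and [mut_split] is applied directly. The flip
    carries c and its subtree B to the other side of the digon. *)
Lemma dmut_dbl_root a b c A B r :
  uniq (dlabels (Dbl a b (N c A B) r)) ->
  dmut (Dbl a b (N c A B) r) c (Dbl a b A (N c B r)).
Proof.
move/uniq_count => U; split=> //; first by solve_perm.
have cA : c \notin labels A by solve_uniq U.
have cB : c \notin labels B by solve_uniq U.
have cr : c \notin labels r by solve_uniq U.
have ac : Some a != Some c by solve_uniq U.
have bc : Some b != Some c by solve_uniq U.
pose d0 := (delta_neq (troot_neq cA), delta_neq (troot_neq cB),
            delta_neq (troot_neq cr), delta_neq ac, delta_neq bc).
apply: (@mut_split _ _ _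
  (fun j => delta (troot r) j + delta (troot A) j)
  (fun j => delta (Some a) j + delta (Some b) j + delta (troot B) j)).
- exact: cb_antisymm.
- by move=> j; rewrite /= !tb_out // /tri /arr delta_id !d0; ring.
- by move=> j; rewrite !addr_ge0 ?delta_ge0.
- by move=> j; rewrite !addr_ge0 ?delta_ge0.
- by move=> j; rewrite mulrDl !mulrDr !sep_delta //; solve_uniq U.
- exact: cb_antisymm.
- by move=> j; rewrite /= !tb_out // /tri /arr delta_id !d0; ring.
- move=> j k jc kc; rewrite /= /tri /arr.
  by rewrite !(@delta_neq _ (Some c)) ?Some_neq 1?eq_sym //; ring.
Qed.

Lemma dmut_dbl_left a b l l' r i : uniq (dlabels (Dbl a b l r)) ->
  tree_rot i l l' -> dmut (Dbl a b l r) i (Dbl a b l' r).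
Proof.
move=> u rl; have := u; rewrite /= !inE !mem_cat !negb_or cat_uniq.
case/and5P=> /and3P[ab al ar] /andP[bl br] ul /hasPn lr ur.
have [il nil] := tree_rot_nonroot rl ul.
have ir : i \notin labels r by apply: contraL il => ir; exact: lr.
split=> //; first by rewrite /= !perm_cons perm_cat2r (tree_rot_perm rl).
have ai : Some a != Some i by apply: contraNneq al => -[->].
have bi : Some b != Some i by apply: contraNneq bl => -[->].
have nir := troot_neq ir.
move=> j k; rewrite (@tree_rot_mut _ _ _ _ rl ul _ (fun j k =>
  tri (Some a) (troot l) (troot r) j k + arr (Some b) (troot l) j k
    + arr (troot r) (Some b) j k + tb r j k)).
- by rewrite /= (tree_rot_root rl); ring.
- by move=> j' k'; rewrite /=; ring.
- by move=> j' k'; rewrite (tb_antisymm r) /tri /arr; ring.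
- move=> j'; rewrite (tb_out _ ir) tri_out // /arr.
  by rewrite (delta_neq bi) (delta_neq nil) (delta_neq nir); ring.
Qed.

Lemma dmut_dbl_right a b l r r' i : uniq (dlabels (Dbl a b l r)) ->
  tree_rot i r r' -> dmut (Dbl a b l r) i (Dbl a b l r').
Proof.
move=> u rr; have := u; rewrite /= !inE !mem_cat !negb_or cat_uniq.
case/and5P=> /and3P[ab al ar] /andP[bl br] ul /hasPn lr ur.
have [ir nir] := tree_rot_nonroot rr ur.
have il : i \notin labels l by apply: lr.
split=> //; first by rewrite /= !perm_cons perm_cat2l (tree_rot_perm rr).
have ai : Some a != Some i by apply: contraNneq ar => -[->].
have bi : Some b != Some i by apply: contraNneq br => -[->].
have nil := troot_neq il.
move=> j k; rewrite (@tree_rot_mut _ _ _ _ rr ur _ (fun j k =>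
  tri (Some a) (troot l) (troot r) j k + arr (Some b) (troot l) j k
    + arr (troot r) (Some b) j k + tb l j k)).
- by rewrite /= (tree_rot_root rr); ring.
- by move=> j' k'; rewrite /=; ring.
- by move=> j' k'; rewrite (tb_antisymm l) /tri /arr; ring.
- move=> j'; rewrite (tb_out _ il) tri_out // /arr.
  by rewrite (delta_neq bi) (delta_neq nil) (delta_neq nir); ring.
Qed.

(* A spike r -> h -> c -> r and the triangle below c share the vertex c, whose *)
(* mutation is a flip turning c into a vertex of the central cycle.           *)
Lemma dmut_cyc_grow p c A B q s :
  uniq (dlabels (Cyc [:: (p, N c A B), q & s])) ->
  dmut (Cyc [:: (p, N c A B), q & s]) c (Cyc [:: (p, B), (c, A), q & s]).
Proof.
case: q => h u /uniq_count U; split=> //; first by solve_perm.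
move=> j k; rewrite (@mut_flip _ _ (fun j k => tb A j k + tb B j k
   + chain ((h, u) :: s) p j k) c
   (Some p) (Some h) (troot A) (troot B)).
- by rewrite /= /tri; ring.
- by move=> j' k'; rewrite /= /tri; ring.
- move=> j' k'; rewrite chain_antisymm (tb_antisymm A) (tb_antisymm B); ring.
- by move=> j'; rewrite chain_out ?(@tb_out _ A) ?(@tb_out _ B) ?addr0 //;
    solve_uniq U.
all: solve_uniq U.
Qed.

Lemma dmut_cyc_shrink p c A B q s :
  uniq (dlabels (Cyc [:: (p, B), (c, A), q & s])) ->
  dmut (Cyc [:: (p, B), (c, A), q & s]) c (Cyc [:: (p, N c A B), q & s]).
Proof.
move=> u; apply: dmut_sym => //; apply: dmut_cyc_grow.
rewrite (@perm_uniq _ _ (dlabels (Cyc [:: (p, B), (c, A), q & s]))) //.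
by solve_perm.
Qed.

Lemma dmut_cyc_rot p t t' q s i :
  uniq (dlabels (Cyc [:: (p, t), q & s])) -> tree_rot i t t' ->
  dmut (Cyc [:: (p, t), q & s]) i (Cyc [:: (p, t'), q & s]).
Proof.
case: q => h w u rt; have U := uniq_count u; have := u.
rewrite /dlabels slabels_cons cons_uniq cat_uniq => /and3P[_ ut _].
have [it nit] := tree_rot_nonroot rt ut; have c_it := count_in it.
split=> //.
  by rewrite /= !slabels_cons perm_cons perm_cat2r (tree_rot_perm rt).
have pi : Some p != Some i by solve_uniq U.
have hi : Some h != Some i by solve_uniq U.
move=> j k; rewrite (@tree_rot_mut _ _ _ _ rt ut _ (fun j k =>
  tri (Some p) (Some h) (troot t) j k + chain ((h, w) :: s) p j k)).
- by rewrite /= (tree_rot_root rt); ring.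
- by move=> j' k'; rewrite /=; ring.
- by move=> j' k'; rewrite chain_antisymm tri_antisymm; ring.
- move=> j'; rewrite tri_out // chain_out ?addr0 //.
  by solve_uniq U.
Qed.

Lemma dmut_swap a b l r i X :
  dmut (Dbl b a l r) i X -> dmut (Dbl a b l r) i X.
Proof.
case=> pX gX mX; split=> //; first by apply: perm_trans pX _; solve_perm.
move=> j k; rewrite -mX; apply: eq_mut => {}j {}k.
by rewrite /= /tri /arr; ring.
Qed.

Lemma dmut_exists X i : uniq (dlabels X) -> good X -> i \in dlabels X ->
  exists X', dmut X i X'.
Proof.
case: X => [a b l r|s] u gX.
  rewrite /= !inE mem_cat; case/or4P=> [/eqP->|/eqP->|il|ir].
  - by eexists; exact: dmut_dbl_cyc.
  - eexists; apply: dmut_swap; apply: dmut_dbl_cyc.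
    by rewrite (@perm_uniq _ _ (dlabels (Dbl a b l r))) //; solve_perm.
  - case: (troot l =P Some i) => [el|/eqP nl].
      by case: l el u {gX il} => // _ A B [->] u; eexists; exact: dmut_dbl_root.
    by have [l' rl] := tree_rot_exists il nl; eexists; exact: dmut_dbl_left rl.
  - case: (troot r =P Some i) => [er|/eqP nr].
      case: r er u {gX ir} => // _ A B [->] u.
      exists (Dbl a b (N i l A) B); apply: dmut_sym => //; apply: dmut_dbl_root.
      by rewrite (@perm_uniq _ _ (dlabels (Dbl a b l (N i A B)))) //; solve_perm.
    by have [r' rr] := tree_rot_exists ir nr; eexists; exact: dmut_dbl_right rr.
move=> /slabels_split[s1 [p [s2 [es ip]]]]; subst s.
suff [X' dX'] : exists X', dmut (Cyc ((p :: s2) ++ s1)) i X'.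
  by exists X'; exact: dmut_rot.
have: uniq (dlabels (Cyc ((p :: s2) ++ s1))).
  by rewrite (@perm_uniq _ _ (dlabels (Cyc (s1 ++ p :: s2)))) //; solve_perm.
have: good (Cyc ((p :: s2) ++ s1)).
  by move: gX; rewrite /= !size_cat /= addnC.
rewrite cat_cons; case: (s2 ++ s1) => // q s {}gX {}u.
case: p ip u {gX} => r t; rewrite inE; case/predU1P=> [->|it] u.
  (* Flipping a radius merges its sector with the preceding one. As i stands first, the preceding
     radius is the last entry, which is rotated to the front; if there are only two radii, a tagged
     pair results. *)
  case/lastP: s u => [|s z] u.
    by case: q u => [h w] u; eexists; exact: dmut_cyc_dbl.
  rewrite -cats1 in u *; case: z u => z w u.
  eexists; apply: (@dmut_rot [:: (r, t), q & s] [:: (z, w)]).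
  apply: dmut_cyc_shrink.
  rewrite (@perm_uniq _ _ (dlabels (Cyc [:: (r, t), q & s ++ [:: (z, w)]]))) //.
  by solve_perm.
case: (troot t =P Some i) => [et|/eqP nt].
  by case: t et u {it} => // _ A B [->] u; eexists; exact: dmut_cyc_grow.
by have [t' rt] := tree_rot_exists it nt; eexists; exact: dmut_cyc_rot rt.
Qed.

End DTriangulations.

(** * Realizable quivers *)

Definition bmat (Q : quiver) (i j : vertex Q) : int :=
  ((narrows i j)%:Z - (narrows j i)%:Z)%R.

Lemma bmat_antisymm (Q : quiver) : antisymm (@bmat Q).
Proof. by move=> i j; rewrite /bmat; ring. Qed.

(** In the absence of 2-cycles the matrix loses nothing: arrow counts are its positive parts. *)
Lemma bmat_pos (Q : quiver) (i j : vertex Q) : pos (bmat i j) = Posz (narrows i j).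
Proof. rewrite /pos /bmat; set c := (0 <= _)%R.
by case: (boolP c); rewrite /c; case: (narrows_anti i j) => ->; lia. Qed.

Lemma narrows_mult (V : finType) (m : V -> V -> nat)
  (m_anti : forall i j, m i j = 0 \/ m j i = 0) (i j : V) :
  @narrows (quiver_of_mult m_anti) i j = m i j.
Proof.
pose f (x : 'I_(m i j)) : arrow (quiver_of_mult m_anti) :=
  @Tagged _ (i, j) (fun p => 'I_(m p.1 p.2)) x.
have f_inj : injective f by move=> x y /eqP; rewrite eq_Tagged => /eqP.
rewrite /narrows -[RHS]card_ord -(card_imset _ f_inj); apply: eq_card => x.
rewrite !inE; apply/idP/imsetP => [|[y _ ->]]; last by rewrite !eqxx.
case: x => -[a b] x /= /andP[/eqP ea /eqP eb]; subst a b; by exists x.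
Qed.

Lemma bmat_mult (V : finType) (m : V -> V -> nat)
  (m_anti : forall i j, m i j = 0 \/ m j i = 0) (i j : V) :
  @bmat (quiver_of_mult m_anti) i j = ((m i j)%:Z - (m j i)%:Z)%R.
Proof. by rewrite /bmat !narrows_mult. Qed.

(** The truncated differences u - w and w - u, subtracted from each other, give the integer u -
    w. *)
Lemma bmat_mutation (Q : quiver) (i : vertex Q) :
  @bmat (mutation i) =2 mut (@bmat Q) i.
Proof.
move=> j k; rewrite bmat_mult /mut /mut_mult orbC.
case: ifP => _; first by rewrite /bmat; ring.
rewrite !bmat_pos /bmat; lia.
Qed.

Definition realize (Q : quiver) (X : dtri (vertex Q)) : Prop :=
  [/\ uniq (dlabels X), good X, forall v, v \in dlabels X & @bmat Q =2 cb X].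

Lemma realize_dmut (Q : quiver) (X X' : dtri (vertex Q)) i :
  realize X -> dmut X i X' -> @realize (mutation i) X'.
Proof.
case=> uX _ cX bX [pX gX mX]; split=> //.
- by rewrite (perm_uniq pX).
- by move=> v; rewrite (perm_mem pX).
- by move=> j k; rewrite bmat_mutation -mX; exact: eq_mut.
Qed.

Lemma realize_mutation (Q : quiver) (X : dtri (vertex Q)) (i : vertex Q) :
  realize X -> exists X', @realize (mutation i) X'.
Proof.
move=> rX; have [uX gX cX _] := rX.
have [X' dX] := dmut_exists uX gX (cX i).
by exists X'; exact: realize_dmut dX.
Qed.

(** Mutating a second time gives a quiver on the same vertices with the matrix of [Q], and [realize]
    depends on nothing else. *)
Lemma realize_mutation_inv (Q : quiver) (i : vertex Q)
    (X : dtri (vertex (mutation i))) :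
  @realize (mutation i) X -> exists X', @realize Q X'.
Proof.
move=> rX; have [X' [uX gX cX bX]] := @realize_mutation (mutation i) X i rX.
exists X'; split=> // j k.
rewrite -bX bmat_mutation -(mut_mut i (@bmat_antisymm Q)).
by apply: eq_mut => {}j {}k; rewrite bmat_mutation.
Qed.

Definition map_dtri (V W : Type) (f : V -> W) (X : dtri V) : dtri W :=
  match X with
  | Dbl a b l r => Dbl (f a) (f b) (map_tree f l) (map_tree f r)
  | Cyc s => Cyc [seq (f p.1, map_tree f p.2) | p <- s]
  end.

Section MapDTri.

Variables (V W : eqType) (f : V -> W).

Lemma dlabels_map (X : dtri V) : dlabels (map_dtri f X) = map f (dlabels X).
Proof.
case: X => [a b l r|s] /=; first by rewrite map_cat !labels_map.
elim: s => //= p s IH; rewrite !slabels_cons IH /= map_cat labels_map //.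
Qed.

Lemma good_map (X : dtri V) : good (map_dtri f X) = good X.
Proof. by case: X => //= s; rewrite size_map. Qed.

Hypothesis f_inj : injective f.

Lemma cb_map (X : dtri V) j k : cb (map_dtri f X) (f j) (f k) = cb X j k.
Proof.
have arrS := arr_map f_inj.
case: X => [a b l r|s] /=.
  rewrite !tb_map // /tri !troot_map -!(arrS _ _ j k) //.
have eq_chain e : chain [seq (f p.1, map_tree f p.2) | p <- s] (f e) (f j) (f k)
    = chain s e j k.
  elim: s => //= p s ->; rewrite tb_map // /tri troot_map -!(arrS _ _ j k) /=.
  by rewrite /unzip1 -map_comp; case: s.
by case: s eq_chain => //= p s; exact.
Qed.

End MapDTri.

(** * Isomorphisms as vertex bijections preserving arrow counts *)

Lemma isomorphic_narrows (Q Q' : quiver) : isomorphic Q Q' ->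
  exists2 f : vertex Q -> vertex Q', bijective f &
    forall i j, narrows (f i) (f j) = narrows i j.
Proof.
case=> f [g [bf bg et eh]]; exists f => // i j.
rewrite /narrows -(card_imset _ (bij_inj bg)); apply: eq_card => x.
case: bg => g' gK g'K; rewrite -(g'K x) (mem_imset _ _ (can_inj gK)) !inE.
by rewrite et eh !(inj_eq (bij_inj bf)).
Qed.

(** Supplies the arrow bijection of an isomorphism: within each fibre, an element is sent to the one
    of the same rank in the enumeration of the other fibre. *)
Lemma fiber_bijection (S T K : finType) (p : S -> K) (q : T -> K) :
  (forall k, #|[set x | p x == k]| = #|[set y | q y == k]|) ->
  exists2 g : S -> T, bijective g & forall x, q (g x) = p x.
Proof.
move=> eN.
have ex x : exists y, (q y == p x) && (index x (enum [set z | p z == p x])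
              == index y (enum [set z | q z == p x])).
  set s := enum _; set t := enum _.
  have xs : x \in s by rewrite mem_enum inE.
  have lt : index x s < size t.
    by rewrite -cardE -eN cardE index_mem.
  have [y0 _] : exists y, y \in t.
    by case: t lt => // y t _; exists y; rewrite inE eqxx.
  exists (nth y0 t (index x s)); rewrite index_uniq ?enum_uniq // eqxx andbT.
  by have := mem_nth y0 lt; rewrite mem_enum inE.
pose g x := xchoose (ex x).
have gP x : (q (g x) == p x) && (index x (enum [set z | p z == p x])
  == index (g x) (enum [set z | q z == p x])) := xchooseP (ex x).
have g_inj : injective g.
  move=> x y exy; case/andP: (gP x) => /eqP qx /eqP ix.
  case/andP: (gP y) => /eqP; rewrite -exy qx => <- /eqP; rewrite -ix.
  set s := enum _ => ey; have xs : x \in s by rewrite mem_enum inE.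
  have ys : y \in s by rewrite -index_mem ey index_mem.
  by rewrite -(nth_index x xs) -(nth_index x ys) ey.
exists g; last by move=> x; case/andP: (gP x) => /eqP.
apply: inj_card_bij => //; rewrite -!sum1_card.
rewrite (partition_big p xpredT) //= [X in X <= _](partition_big q xpredT) //=.
apply: leq_sum => k _; rewrite !sum1_card; have := eN k.
by rewrite !cardsE => <-.
Qed.

Lemma isomorphic_of_narrows (Q Q' : quiver) (f : vertex Q -> vertex Q') :
  bijective f -> (forall i j, narrows (f i) (f j) = narrows i j) ->
  isomorphic Q Q'.
Proof.
move=> bf ef.
have [x|g bg gP] := @fiber_bijection (arrow Q) (arrow Q') _
    (fun x => (f (qtail x), f (qhead x))) (fun y => (qtail y, qhead y)).
  case: x => u v; case: bf (bf) => f' fK f'K bf.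
  rewrite -(f'K u) -(f'K v); have := ef (f' u) (f' v); rewrite /narrows.
  move=> e; transitivity (narrows (f' u) (f' v)); [|rewrite /narrows -e];
  by apply: eq_card => x; rewrite !inE /eq_op /= ?(inj_eq (bij_inj bf)).
by exists f, g; split=> // x; have [] := gP x.
Qed.

Lemma isomorphic_sym (Q Q' : quiver) : isomorphic Q Q' -> isomorphic Q' Q.
Proof.
case/isomorphic_narrows=> f [f' fK f'K] ef.
apply: (@isomorphic_of_narrows _ _ f'); first by exists f.
by move=> i j; rewrite -ef !f'K.
Qed.

Lemma isomorphic_bmat (Q Q' : quiver) (f : vertex Q -> vertex Q') :
  bijective f -> (forall i j, bmat (f i) (f j) = bmat i j) -> isomorphic Q Q'.
Proof.
move=> bf ef; apply: isomorphic_of_narrows bf _ => i j.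
by have := bmat_pos (f i) (f j); rewrite ef bmat_pos => -[].
Qed.

Lemma realize_iso (Q Q' : quiver) (X : dtri (vertex Q)) :
  isomorphic Q Q' -> realize X -> exists X', @realize Q' X'.
Proof.
case/isomorphic_narrows=> f [f' fK f'K] ef [uX gX cX bX].
have f_inj := can_inj fK.
exists (map_dtri f X); split.
- by rewrite dlabels_map map_inj_uniq.
- by rewrite good_map.
- by move=> v; rewrite dlabels_map -(f'K v) map_f.
- by move=> i j; rewrite -(f'K i) -(f'K j) cb_map // -bX /bmat !ef.
Qed.

Lemma card_iso (Q Q' : quiver) : isomorphic Q Q' -> #|vertex Q| = #|vertex Q'|.
Proof. by case=> f [g [bf _ _ _]]; exact: bij_eq_card bf. Qed.

Lemma mutates_realize (Q Q' : quiver) (X : dtri (vertex Q)) :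
  mutates_to Q Q' -> realize X ->
  #|vertex Q| = #|vertex Q'| /\ exists X', @realize Q' X'.
Proof.
move=> m; elim: m X => {Q Q'} [Q Q' iQ X rX|Q Q' i _ IH X].
  by split; [exact: card_iso | exact: realize_iso rX].
by move=> rX; have [X' /IH] := realize_mutation i rX.
Qed.

Lemma mutates_realize_inv (Q Q' : quiver) (X : dtri (vertex Q')) :
  mutates_to Q Q' -> realize X ->
  #|vertex Q| = #|vertex Q'| /\ exists X', @realize Q X'.
Proof.
move=> m; elim: m X => {Q Q'} [Q Q' iQ X rX|Q Q' i _ IH X rX].
  by split; [exact: card_iso | exact: realize_iso (isomorphic_sym iQ) rX].
by have [cQ [X' rX']] := IH X rX; split=> //; exact: realize_mutation_inv rX'.
Qed.

(** * Reduction to the D_n quiver *)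

(** The vertices k - 1, ..., 0 in decreasing order: arrows of a comb run from child to parent, so
    this order yields i -> i + 1. *)
Fixpoint below (m k : nat) : seq 'I_m.+1 :=
  if k is k'.+1 then inord k' :: below m k' else [::].

Lemma mem_below m k (i : 'I_m.+1) : k <= m.+1 -> (i \in below m k) = (i < k).
Proof.
elim: k => //= k IH km; rewrite inE IH ?(ltnW km) // ltnS leq_eqVlt.
by rewrite -val_eqE /= inordK //; lia.
Qed.

Lemma below_uniq m k : k <= m.+1 -> uniq (below m k).
Proof.
elim: k => //= k IH km; rewrite IH ?(ltnW km) // mem_below ?(ltnW km) //.
by rewrite inordK // ltnn.
Qed.

Lemma delta_inord m k (j : 'I_m.+1) : k <= m ->
  delta (Some (inord k)) j = Posz (k == j).
Proof.
move=> km; rewrite /delta (inj_eq Some_inj) -val_eqE /= inordK //.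
by case: eqP.
Qed.

Lemma tb_below m k (i j : 'I_m.+1) : k <= m.+1 ->
  tb (comb (below m k)) i j =
  (Posz ((i.+1 == j) && (j < k)%N) - Posz ((j.+1 == i) && (i < k)%N))%R.
Proof.
elim: k => [|k IH] km /=; first by rewrite ltn0 !andbF.
rewrite IH ?(ltnW km) // /tri /arr !delta_inord //.
case: k km {IH} => [|k] km /=.
  by rewrite !delta_None; lia.
by rewrite !delta_None !delta_inord; lia.
Qed.

(** Here n = m + 2. The tagged radii are the two prongs of the fork, the comb is the long arm with
    the branching vertex m - 1 as root, and the other side of the digon is a boundary side. *)
Lemma D_quiver_realize m : 2 <= m ->
  @realize (D_quiver m.+2) (Dbl (inord m) (inord m.+1) E (comb (below m.+1 m))).
Proof.
move=> m2; split=> //.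
- rewrite /= labels_comb below_uniq ?leqW // andbT inE !mem_below ?leqW //.
  by rewrite -val_eqE /= !inordK // !ltnn; lia.
- move=> v; rewrite /= labels_comb !inE mem_below ?leqW // -!val_eqE /= !inordK //.
  by have := ltn_ord v; lia.
move=> i j; rewrite bmat_mult /D_mult /D_edge /cb tb_below; last by lia.
case: m m2 i j => // m _ i j; rewrite /= /tri /arr !delta_None !delta_inord; [|lia ..].
move: (nat_of_ord i) (nat_of_ord j) (ltn_ord i) (ltn_ord j) => a b am bm.
rewrite !subSS !subn0 !eqSS /= !(mul0r, mulr0, subr0, add0r, addr0).
by case: (m =P a) => [<-|ma]; case: (m =P b) => [<-|mb];
     rewrite ?(mul1r, mul0r); lia.
Qed.

Lemma size_dlabels (Q : quiver) (X : dtri (vertex Q)) :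
  realize X -> size (dlabels X) = #|vertex Q|.
Proof.
case=> uX _ cX _; rewrite -(card_uniqP uX); apply: eq_card => v.
by rewrite cX.
Qed.

Lemma nth_index_map (T U : eqType) (s : seq T) (s' : seq U) (y : U) :
  uniq s -> size s = size s' -> [seq nth y s' (index x s) | x <- s] = s'.
Proof.
move=> us ss; apply: (@eq_from_nth _ y); first by rewrite size_map.
move=> k; rewrite size_map => ks; case: s us ss ks => // x s us ss ks.
by rewrite (nth_map x) // index_uniq.
Qed.

(** Both quivers have data of the same shape, so matching the two lists of labels position by
    position is an isomorphism. *)
Lemma dbl_comb_iso (Q : quiver) (a b : vertex Q) s n : 4 <= n ->
  #|vertex Q| = n -> realize (Dbl a b E (comb s)) -> isomorphic Q (D_quiver n).
Proof.
case: n => [|[|m]] // m2 cQ rX; rewrite !ltnS in m2.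
have [uX _ cX bX] := rX; have [uX' _ _ bX'] := D_quiver_realize m2.
have sX := size_dlabels rX; have sX' := size_dlabels (D_quiver_realize m2).
move: uX' sX' bX'; set X' := Dbl _ _ _ _ => uX' sX' bX'.
set X := Dbl a b E (comb s) in uX cX bX sX.
have eS : size (dlabels X) = size (dlabels X') by rewrite sX sX' cQ card_ord.
(* The default [inord m] is never reached, since every vertex occurs among the labels. *)
pose f v := nth (inord m) (dlabels X') (index v (dlabels X)).
have f_inj : injective f.
  move=> v w /eqP; rewrite /f nth_uniq ?index_mem -?eS ?index_mem ?cX // => /eqP e.
  by rewrite -(nth_index v (cX v)) e nth_index.
have fX : map_dtri f X = X'.
  have := nth_index_map (inord m) uX eS; rewrite -/f /= !labels_comb.
  by move=> [fa fb fs]; rewrite map_comb fa fb fs.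
apply: (@isomorphic_bmat Q (D_quiver m.+2) f).
  by apply: inj_card_bij => //; rewrite cQ card_ord.
by move=> i j; rewrite bX' -fX cb_map // bX.
Qed.

Lemma mutates_dmut (Q Q' : quiver) (X X' : dtri (vertex Q)) i :
  realize X -> dmut X i X' ->
  (@realize (mutation i) X' -> mutates_to (mutation i) Q') -> mutates_to Q Q'.
Proof.
by move=> rX dX H; apply: (@mutates_step _ _ i); apply: H; exact: realize_dmut dX.
Qed.

Section Reduction.

Variables (n : nat) (n_ge4 : 4 <= n).

Lemma mutates_dbl_right (Q : quiver) (a b : vertex Q) r :
  #|vertex Q| = n -> realize (Dbl a b E r) -> mutates_to Q (D_quiver n).
Proof.
have [k le_k] := ubnP (leftness r).
elim: k => // k IH in Q a b r le_k *; move=> cQ rX.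
case: (tree_rot_comb r) => [er|[i [r' [rr lt]]]].
  by rewrite er in rX; apply: mutates_iso; exact: dbl_comb_iso rX.
have [uX _ _ _] := rX.
apply: (mutates_dmut rX (dmut_dbl_right uX rr)) => rX'.
by apply: (IH (mutation i) a b r') => //; exact: leq_trans lt _.
Qed.

(** Each flip at the root of l moves that root and its right subtree to the other tree, until l is
    empty. *)
Lemma mutates_dbl (Q : quiver) (a b : vertex Q) l r :
  #|vertex Q| = n -> realize (Dbl a b l r) -> mutates_to Q (D_quiver n).
Proof.
have [k le_k] := ubnP (size (labels l)).
elim: k => // k IH in Q a b l r le_k *; move=> cQ rX; have [uX _ _ _] := rX.
case: l => [|c A B] in le_k rX uX *; first exact: mutates_dbl_right rX.
apply: (mutates_dmut rX (dmut_dbl_root uX)) => rX'.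
apply: (IH (mutation c) a b A (N c B r)) => //.
by move: le_k; rewrite /= size_cat; lia.
Qed.

(** Flipping radii lowers their number to two; one more flip gives a tagged pair. *)
Lemma mutates_realized (Q : quiver) (X : dtri (vertex Q)) :
  #|vertex Q| = n -> realize X -> mutates_to Q (D_quiver n).
Proof.
case: X => [a b l r|s]; first exact: mutates_dbl.
have [k le_k] := ubnP (size s).
elim: k => // k IH in Q s le_k *; move=> cQ rX; have [uX gX _ _] := rX.
case: s => [|[a l] [|[b r] [|q s]]] // in le_k rX uX gX *.
  apply: (mutates_dmut rX (dmut_cyc_dbl uX)) => rX'.
  exact: (@mutates_dbl (mutation a) a b l r).
apply: (mutates_dmut rX (dmut_cyc_shrink uX)) => rX'.
exact: (IH (mutation b) [:: (a, N b r l), q & s]).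
Qed.

End Reduction.

(** * From M^A to trees *)

Section Graph.

Variable Q : quiver.
Local Notation V := (vertex Q).
Local Notation adj := (@adjacent Q).
Implicit Types (S : {set V}) (v w x y z p q : V).

Definition arrowrel : rel V := [rel x y | 0 < narrows x y].

(** The cycle condition of M^A in terms of vertices instead of arrows; the exclusion of cycles of
    length two becomes the bound on arrow counts. *)
Definition oriented_triangles : Prop :=
  (forall x y, narrows x y <= 1) /\
  (forall s : seq V, 3 <= size s -> uniq s -> cycle adj s ->
     size s = 3 /\ (cycle arrowrel s \/ cycle [rel x y | arrowrel y x] s)).

(** Together with [oriented_triangles] this captures the conditions on valencies ([MA_claw_free],
    [MA_of_graph]); [simplicial] does the same for connecting vertices. *)
Definition claw_free : Prop :=
  forall v x y z, adj v x -> adj v y -> adj v z ->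
    x != y -> y != z -> x != z -> [|| adj x y, adj y z | adj x z].

Definition simplicial v : Prop :=
  forall x y, adj v x -> adj v y -> x != y -> adj x y.

Lemma adjC x y : adj x y = adj y x.
Proof. by rewrite /adjacent /= orbC. Qed.

Lemma narrows_loop x : narrows x x = 0.
Proof. by case: (narrows_anti x x). Qed.

Lemma adj_irr x : adj x x = false.
Proof. by rewrite /adjacent /= narrows_loop. Qed.

Lemma adj_neq x y : adj x y -> x != y.
Proof. by apply: contraTneq => ->; rewrite adj_irr. Qed.

Lemma bmat_nonadj x y : ~~ adj x y -> bmat x y = 0%R.
Proof. by rewrite /adjacent /bmat /= negb_or; lia. Qed.

Lemma bmat_adj x y : adj x y = (bmat x y != 0%R).
Proof. by rewrite /adjacent /bmat /=; case: (narrows_anti x y); lia. Qed.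

Definition radj S : rel V := [rel x y | [&& x \in S, y \in S & adj x y]].

Lemma radjE S x y : radj S x y = [&& x \in S, y \in S & adj x y].
Proof. by []. Qed.

Lemma radj_path S x s : path (radj S) x s -> path adj x s /\ {subset s <= S}.
Proof.
elim: s x => //= y s IH x /andP[/and3P[_ yS ->] /IH[-> sS]]; split=> // z.
by rewrite inE => /predU1P[->|/sS].
Qed.

Lemma radj_path_sub S x s : path adj x s -> x \in S -> {subset s <= S} ->
  path (radj S) x s.
Proof.
elim: s x => //= y s IH x /andP[xy ys] xS sS.
have yS : y \in S by apply: sS; rewrite inE eqxx.
rewrite radjE xS yS xy.
by apply: IH => // z zs; apply: sS; rewrite inE zs orbT.
Qed.

Lemma connect_radj_in S x y : connect (radj S) x y -> x \in S -> y \in S.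
Proof.
case/connectP=> s /radj_path[_ sS] -> xS.
by have := mem_last x s; rewrite inE => /predU1P[->|/sS].
Qed.

Lemma radj_sym S : symmetric (radj S).
Proof. by move=> x y; rewrite /radj /= adjC andbCA. Qed.

Lemma connect_radjC S : connect_sym (radj S).
Proof. exact: sym_connect_sym (@radj_sym S). Qed.

Hypotheses (Qtri : oriented_triangles) (Qclaw : claw_free).

(* A path from x to a neighbour of y avoiding v and y would close up to a     *)
(* cycle of length at least four through the triangle v, x, y.                *)
Lemma triangle_cut S v x y z : adj v x -> adj v y -> adj x y ->
  x \in S -> v \notin S -> y \notin S ->
  connect (radj S) x z -> adj z y -> z = x.
Proof.
move=> vx vy xy xS vS yS /connectP[s0 + ->].
case/shortenP=> s /radj_path[ps sS] us _; case: s => // w s in ps sS us * => zy.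
have xsS u : u \in x :: w :: s -> u \in S.
  by rewrite inE => /predU1P[->|/sS].
have [] := Qtri.2 (v :: rcons (x :: w :: s) y); last by rewrite /= size_rcons.
- by rewrite /= size_rcons.
- rewrite cons_uniq rcons_uniq us mem_rcons inE negb_or adj_neq //=.
  by rewrite andbT; apply/andP; split; [apply/negP|apply/negP] => /xsS;
     [rewrite (negPf vS) | rewrite (negPf yS)].
- rewrite -[cycle _ _]/(path _ _ (rcons (rcons _ _) _)) !rcons_path last_rcons.
  by rewrite (adjC y) vy andbT [path _ _ _]/= vx; move: ps zy => /= -> ->.
Qed.

(** A simple path from v to z starts through x or through y. If it later meets the other corner, its
    tail from there avoids v and the first corner; otherwise the whole path after v avoids the other
    corner. *)
Lemma triangle_split S v x y : x != v -> y != v -> x != y ->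
  (forall z, z \in S -> connect (radj S) v z) ->
  (forall z, z \in S -> adj v z -> z = x \/ z = y) ->
  forall z, z \in S -> z != v ->
    connect (radj (S :\ v :\ y)) x z \/ connect (radj (S :\ v :\ x)) y z.
Proof.
move=> xv yv xy Sconn vnbr z zS zv.
case/connectP: (Sconn z zS) zv => s0 + ->.
case/shortenP=> s /radj_path[ps sS] us _; case: s ps sS us => [|w s] /=.
  by rewrite eqxx.
case/andP=> vw ps sS /andP[vs us] _.
have wS : w \in S by apply: sS; rewrite inE eqxx.
have sub u : u \in w :: s -> u \in S :\ v.
  move=> us'; rewrite !inE sS // andbT; apply: contraNneq vs => <-.
  by [].
have gen a b : a != v -> b != v -> a != b -> a = w ->
    connect (radj (S :\ v :\ b)) a (last w s) \/
    connect (radj (S :\ v :\ a)) b (last w s).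
  move=> av bv ab aw; subst a.
  have [bs|bs] := boolP (b \in s); [right|left].
    case/splitPr: bs us ps sub {sS vs} => s1 s2 us ps sub.
    rewrite last_cat /=; apply/connectP; exists s2 => //.
    move: ps; rewrite cat_path /= => /and3P[_ _ p2].
    have ws2 u : u \in b :: s2 -> u \in S :\ v :\ w.
      move=> us2; rewrite in_setD1 sub ?andbT.
        by move: us => /andP[+ _]; apply: contraNneq => <-;
           rewrite mem_cat us2 orbT.
      by rewrite inE mem_cat us2 !orbT.
    apply: radj_path_sub => //; first by apply: ws2; rewrite inE eqxx.
    by move=> u us2; apply: ws2; rewrite inE us2 orbT.
  apply/connectP; exists s => //; apply: radj_path_sub => //.
    by rewrite in_setD1 ab sub // inE eqxx.
  move=> u us'; rewrite in_setD1 sub ?andbT.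
    by apply: contraNneq bs => <-.
  by rewrite inE us' orbT.
case: (vnbr w wS vw) => e; first by apply: gen.
have yx : y != x by rewrite eq_sym.
by case: (gen y x yv xv yx (esym e)); [right|left].
Qed.

Lemma connect_radj_first S v z : connect (radj S) v z -> z != v ->
  exists w, [/\ w \in S, adj v w & connect (radj (S :\ v)) w z].
Proof.
case/connectP=> s0 + ->; case/shortenP=> s /radj_path[ps sS] us _.
case: s ps sS us => [|w s] /=; first by rewrite eqxx.
case/andP=> vw ps sS /andP[vs us] _.
have sub u : u \in w :: s -> u \in S :\ v.
  by move=> us'; rewrite !inE sS // andbT; apply: contraNneq vs => <-.
have ws : w \in w :: s by rewrite inE eqxx.
exists w; split=> //; first exact: sS.
apply/connectP; exists s => //; apply: radj_path_sub => //; first exact: sub.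
by move=> u us'; apply: sub; rewrite inE us' orbT.
Qed.

Definition tree_on S v (t : tree V) : Prop :=
  [/\ troot t = Some v, uniq (labels t), forall x, (x \in labels t) = (x \in S)
    & {in S &, forall x y, bmat x y = tb t x y}].

(** The invariant of the induction in [tree_exists]: S is attached to the rest of the quiver at v
    alone, and v is simplicial within S. *)
Definition rooted S v : Prop :=
  [/\ v \in S, {in S, forall x, connect (radj S) v x},
      forall w x, w \in S -> w != v -> adj w x -> x \in S
    & {in S &, forall x y, adj v x -> adj v y -> x != y -> adj x y}].

Lemma narrows_1 x y : 0 < narrows x y -> narrows x y = 1 /\ narrows y x = 0.
Proof.
by have := Qtri.1 x y; case: (narrows_anti x y) => -> //; lia.
Qed.

Lemma tree_on_single S v : rooted S v ->
  (forall x, x \in S -> ~~ adj v x) -> tree_on S v (N v E E).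
Proof.
case=> vS conn _ _ vN.
have Sv x : x \in S -> x = v.
  move=> xS; apply: contraTeq isT => xv.
  by have [w [wS + _]] := connect_radj_first (conn x xS) xv; rewrite (negPf (vN w wS)).
split=> // [x|x y /Sv-> /Sv->]; last first.
  by rewrite bmat_nonadj ?adj_irr // /= /tri /arr !delta_None; ring.
by rewrite inE; apply/eqP/idP => [->|/Sv].
Qed.

Lemma tree_on_edge S v x (t : tree V) : rooted S v -> x \in S -> adj v x ->
    (forall y, y \in S -> adj v y -> y = x) -> tree_on (S :\ v) x t ->
  exists t', tree_on S v t'.
Proof.
case=> vS conn _ _ xS vx vnbr [rt ut lt bt].
have xv : x != v by rewrite eq_sym adj_neq.
(* A left child receives an arrow from v and a right child sends one to v, so the direction decides
   the side; the other child is a boundary side. *)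
pose t' := if 0 < narrows v x then N v t E else N v E t.
exists t'.
have lt' y : (y \in labels t') = (y \in S).
  rewrite /t'; case: ifP => _; rewrite /= ?cats0 inE lt !inE;
  by case: (y =P v) => [->|].
split=> //.
- by rewrite /t'; case: ifP.
- have vt : v \notin labels t by rewrite lt !inE eqxx.
  by rewrite /t'; case: ifP => _; rewrite /= ?cats0 vt.
have bv y : y \in S -> bmat v y = tb t' v y.
  move=> yS; have e0 : tb t v y = 0%R by rewrite tb_out // lt !inE eqxx.
  have [e|nvy] := boolP (adj v y).
    rewrite (vnbr _ yS e); rewrite (vnbr _ yS e) in e0; rewrite /t' /bmat.
    have : adj v x by []. rewrite /adjacent /=; case: ifP => [h|_] /=.
      move=> _; case: (narrows_1 h) => -> ->; rewrite rt e0 /tri /arr.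
      by rewrite !delta_None !delta_some !eqxx (negPf xv) (eq_sym v x) (negPf xv).
    move=> h'; case: (narrows_1 h') => -> ->; rewrite rt e0 /tri /arr.
    by rewrite !delta_None !delta_some !eqxx (negPf xv) (eq_sym v x) (negPf xv).
  rewrite bmat_nonadj // /t'; have xy : x != y.
    by apply: contraNneq nvy => <-.
  case: ifP => _; rewrite /= rt e0 /tri /arr !delta_None !delta_some (negPf xy);
  by rewrite (negPf xv) eqxx /=; ring.
move=> y z yS zS; case: (y =P v) => [->|/eqP yv]; first exact: bv.
case: (z =P v) => [->|/eqP zv]; first by rewrite tb_antisymm -bv // bmat_antisymm.
have -> : bmat y z = tb t y z by apply: bt; rewrite !inE ?yv ?zv.
rewrite /t' !(eq_sym _ v) in yv zv *.
by case: ifP => _; rewrite /= rt /tri /arr !delta_None !delta_some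
   (negPf yv) (negPf zv) /=; ring.
Qed.

(** The gluing step: v, Sx and Sy are joined only by the triangle v -> x -> y -> v, so the matrix is
    the sum of that triangle and two blocks. *)
Lemma tree_on_triangle S v x y (tx ty : tree V) (Sx Sy : {set V}) :
    v \notin Sx -> v \notin Sy -> [disjoint Sx & Sy] ->
    x \in Sx -> y \in Sy -> S = v |: (Sx :|: Sy) ->
    0 < narrows v x -> 0 < narrows x y -> 0 < narrows y v ->
    (forall z, z \in S -> adj v z -> z = x \/ z = y) ->
    (forall z w, z \in Sx -> w \in Sy -> adj z w -> z = x /\ w = y) ->
    tree_on Sx x tx -> tree_on Sy y ty ->
  tree_on S v (N v tx ty).
Proof.
move=> vSx vSy /disjoint_setI0/setP dxy xS yS eS vx xy yv vnbr cross.
case=> [rx ux lx bx] [ry uy ly by_].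
have dis z : z \in Sx -> z \notin Sy.
  by move=> zx; have := dxy z; rewrite !inE zx /= => ->.
have lt z : (z \in labels (N v tx ty)) = (z \in S).
  by rewrite eS /= !inE mem_cat lx ly.
have nvx : v != x by apply: contraNneq vSx => ->.
have nvy : v != y by apply: contraNneq vSy => ->.
have nxy : x != y by apply: contraNneq (dis _ xS) => ->.
have [evx exv] := narrows_1 vx; have [exy eyx] := narrows_1 xy.
have [eyv evy] := narrows_1 yv.
split=> //.
  rewrite /= mem_cat lx ly negb_or vSx vSy cat_uniq ux uy !andbT /=.
  by apply/hasPn => z; rewrite ly lx; apply: contraL; exact: dis.
have bv z : z \in S -> bmat v z = tb (N v tx ty) v z.
  move=> zS; rewrite /= rx ry !tb_out ?lx ?ly // /tri /arr !delta_some eqxx.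
  rewrite (eq_sym x v) (eq_sym y v) (negPf nvx) (negPf nvy).
  have [vz|nvz] := boolP (adj v z).
    case: (vnbr z zS vz) => ->; rewrite /bmat ?evx ?exv ?eyv ?evy !eqxx.
      by rewrite (eq_sym y x) (negPf nxy) /=; ring.
    by rewrite (negPf nxy) /=; ring.
  rewrite bmat_nonadj //.
  have -> : (x == z) = false.
    by apply: contraNF nvz => /eqP<-; rewrite /adjacent /= vx.
  have -> : (y == z) = false.
    by apply: contraNF nvz => /eqP<-; rewrite /adjacent /= yv orbT.
  by rewrite /=; ring.
have bS z w : z \in Sx -> w \in Sy -> bmat z w = tb (N v tx ty) z w.
  move=> zx wy; have wx : w \notin Sx by apply/negP => /dis; rewrite wy.
  rewrite /= rx ry (tb_out2 _ (t:=tx)) ?lx // (tb_out _ (t:=ty)) ?ly ?dis //.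
  rewrite /tri /arr !delta_some.
  have -> : (v == z) = false by apply: contraNF vSx => /eqP->.
  have -> : (v == w) = false by apply: contraNF vSy => /eqP->.
  have -> : (y == z) = false by apply: contraTF zx => /eqP<-; apply/negP=> /dis;
    rewrite yS.
  have -> : (x == w) = false by apply: contraTF wy => /eqP<-; exact: dis.
  have [zw|nzw] := boolP (adj z w).
    by have [-> ->] := cross z w zx wy zw; rewrite /bmat exy eyx !eqxx /=; ring.
  rewrite bmat_nonadj //.
  case: (x =P z) => [ez|_]; last by rewrite /=; ring.
  case: (y =P w) => [ew|_]; last by rewrite /=; ring.
  by move: nzw; rewrite -ez -ew /adjacent /= xy.
have sk := tb_antisymm (N v tx ty).
have in3 z : z \in S -> [\/ z = v, z \in Sx | z \in Sy].
  by rewrite eS !inE => /or3P[/eqP->|?|?]; [constructor 1|constructor 2|constructor 3].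
have vt z : (z \in Sx) || (z \in Sy) -> (v == z) = false.
  by case/orP=> zS; [apply: contraNF vSx => /eqP-> | apply: contraNF vSy => /eqP->].
move=> z w zS wS.
case: (in3 z zS) => [->|zx|zy]; first exact: bv.
- case: (in3 w wS) => [->|wx|wy]; first by rewrite sk -bv // bmat_antisymm.
    rewrite bx //= rx ry (tb_out _ (t:=ty)) ?ly ?dis // /tri /arr !delta_some.
    rewrite !vt ?zx ?wx //.
    have ny u : u \in Sx -> (y == u) = false.
      by move=> uS; apply: contraTF uS => /eqP<-; apply/negP=> /dis; rewrite yS.
    by rewrite !ny //=; ring.
  exact: bS.
- case: (in3 w wS) => [->|wx|wy]; first by rewrite sk -bv // bmat_antisymm.
    by rewrite sk -bS // bmat_antisymm.
  have zNx u : u \in Sy -> u \notin Sx by move=> uy'; apply/negP => /dis; rewrite uy'.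
  rewrite by_ //= rx ry (tb_out _ (t:=tx)) ?lx ?zNx // /tri /arr !delta_some.
  rewrite !vt ?zy ?wy ?orbT //.
  have nx u : u \in Sy -> (x == u) = false.
    by move=> uS; apply: contraTF uS => /eqP<-; exact: dis.
  by rewrite !nx //=; ring.
Qed.

Lemma connect_radj_comp S x z : connect (radj S) x z ->
  connect (radj [set u | connect (radj S) x u]) x z.
Proof.
case/connectP=> s ps ->; elim/last_ind: s ps => [|s w IH] //=.
rewrite rcons_path last_rcons => /andP[ps sw].
have cs : connect (radj S) x (last x s) by apply/connectP; exists s.
apply: connect_trans (IH ps) (connect1 _); rewrite radjE !inE cs.
by rewrite (connect_trans cs (connect1 sw)); case/and3P: sw.
Qed.

Lemma connect_radj_sub S S' x z : S \subset S' ->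
  connect (radj S) x z -> connect (radj S') x z.
Proof.
move=> /subsetP sS; apply: connect_sub => {x z} x y /and3P[xS yS xy].
by apply: connect1; rewrite radjE !sS.
Qed.

(** The new root x is simplicial because two nonadjacent neighbours of x would form a claw with
    v. *)
Lemma rooted_edge S v x : rooted S v -> x \in S -> adj v x ->
  (forall y, y \in S -> adj v y -> y = x) -> rooted (S :\ v) x.
Proof.
case=> vS conn cl _ xS vx vnbr; split.
- by rewrite !inE xS eq_sym adj_neq.
- move=> z; rewrite !inE => /andP[zv zS].
  by have [w [wS vw]] := connect_radj_first (conn z zS) zv; rewrite (vnbr w wS vw).
- move=> w u; rewrite !inE => /andP[wv wS] wx wu; rewrite (cl w u) // andbT.
  by apply: contraNneq wx => uv; rewrite (vnbr w wS) // adjC -uv.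
- move=> y z; rewrite !inE => /andP[yv yS] /andP[zv zS] xy xz yz.
  have xv : adj x v by rewrite adjC.
  rewrite (eq_sym _ v) in yv; rewrite (eq_sym _ v) in zv.
  case/or3P: (Qclaw xv xy xz yv yz zv) => [vy|//|vz].
    by rewrite (vnbr y yS vy) adj_irr in xy.
  by rewrite (vnbr z zS vz) adj_irr in xz.
Qed.

Section Triangle.

Variables (S : {set V}) (v x y : V).
Hypotheses (rS : rooted S v) (xS : x \in S) (yS : y \in S).
Hypotheses (vx : adj v x) (vy : adj v y) (xy : x != y).

Lemma triangle_third : adj x y.
Proof. by case: rS => _ _ _; apply. Qed.

(** A third neighbour z would close the 4-cycle v, x, z, y. *)
Lemma triangle_nbrs z : z \in S -> adj v z -> z = x \/ z = y.
Proof.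
move=> zS vz; case: (z =P x) => [|/eqP zx]; first by left.
case: (z =P y) => [|/eqP zy]; first by right.
have [vS _ _ simp] := rS.
have xz : adj x z by apply: simp; rewrite // eq_sym.
have zy' : adj z y by apply: simp.
have [] // := Qtri.2 [:: v; x; z; y].
  rewrite /= !inE !negb_or (adj_neq vx) (adj_neq vz) (adj_neq vy).
  by rewrite (adj_neq xz) xy (adj_neq zy').
by rewrite /cycle /= vx xz zy' adjC vy.
Qed.

Definition branch x y := [set z | connect (radj (S :\ v :\ y)) x z].

Lemma branch_in z : z \in branch x y -> [/\ z \in S, z != v & z != y].
Proof.
rewrite inE => /connect_radj_in; rewrite !inE xS xy eq_sym (adj_neq vx) /=.
by case/(_ isT)/and3P.
Qed.

Lemma branch_cut z : z \in branch x y -> adj z y -> z = x.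
Proof.
rewrite inE => xz zy; apply: (triangle_cut vx vy triangle_third _ _ _ xz zy).
- by rewrite !inE xS xy eq_sym (adj_neq vx).
- by rewrite !inE eqxx andbF.
- by rewrite !inE eqxx.
Qed.

Lemma branch_root : x \in branch x y.
Proof. by rewrite inE connect0. Qed.

(** By [triangle_cut] and [triangle_nbrs], x is the only vertex of the branch adjacent to y or to v,
    so nothing leaves the branch elsewhere; claw-freeness, applied with v as third neighbour, makes
    x simplicial. *)
Lemma rooted_branch : rooted (branch x y) x.
Proof.
have [vS conn cl _] := rS; split.
- exact: branch_root.
- by move=> z; rewrite inE; exact: connect_radj_comp.
- move=> w u wB wx wu; have [wS wv wy] := branch_in wB.
  have uS : u \in S by exact: cl wu.
  have := wB; rewrite !inE => /connect_trans; apply; apply: connect1.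
  rewrite radjE !inE wy wv wS uS wu !andbT /=.
  apply/andP; split; apply: contraNneq wx => e; rewrite e in wu.
    by rewrite (branch_cut _ wu) // inE.
  rewrite adjC in wu; case: (triangle_nbrs wS wu) => [->//|e'].
  by rewrite e' eqxx in wy.
- move=> p q pB qB xp xq pq.
  have [pS pv py] := branch_in pB; have [qS qv qy] := branch_in qB.
  have xv : adj x v by rewrite adjC.
  rewrite (eq_sym _ v) in pv; rewrite (eq_sym _ v) in qv.
  case/or3P: (Qclaw xv xp xq pv pq qv) => [vp|//|vq].
    case: (triangle_nbrs pS vp) => e; last by rewrite e eqxx in py.
    by rewrite e adj_irr in xp.
  case: (triangle_nbrs qS vq) => e; last by rewrite e eqxx in qy.
  by rewrite e adj_irr in xq.
Qed.

Lemma branch_proper : #|branch x y| < #|S|.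
Proof.
apply: proper_card; apply/properP; split.
  by apply/subsetP => z /branch_in[].
by exists y => //; apply/negP => /branch_in[_ _]; rewrite eqxx.
Qed.

End Triangle.

(** A common vertex would put a neighbour of y other than x into the branch of x, against
    [triangle_cut]. *)
Lemma branch_disjoint S v x y : rooted S v -> x \in S -> y \in S ->
  adj v x -> adj v y -> x != y -> [disjoint branch S v x y & branch S v y x].
Proof.
move=> rS xS yS vx vy xy; have yx : y != x by rewrite eq_sym.
apply/pred0P => z /=; apply/negP => /andP[zx zy].
have [zS zv zy'] := branch_in xS vx xy zx.
have [w [wS yw wz]] : exists w, [/\ w \in S :\ v :\ x, adj y w &
    connect (radj (S :\ v :\ x :\ y)) w z].
  by apply: connect_radj_first => //; rewrite inE in zy.
have wx : w \in branch S v x y.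
  rewrite inE in zx; rewrite inE; apply: connect_trans zx _.
  rewrite connect_radjC; apply: connect_radj_sub wz.
  by apply/subsetP => u; rewrite !inE => /and4P[-> _ -> ->].
have := branch_cut rS xS yS vx vy xy wx; rewrite adjC => /(_ yw) e.
by rewrite e !inE eqxx in wS.
Qed.

Lemma tree_exists S v : rooted S v -> exists t, tree_on S v t.
Proof.
have [n le_n] := ubnP #|S|; elim: n => // n IH in S v le_n *; move=> rS.
have [vS conn cl simp] := rS.
case: (pickP [pred x in S | adj v x]) => [x /andP[/= xS vx]|no]; last first.
  exists (N v E E); apply: tree_on_single => // x xS.
  by have := no x; rewrite /= xS /= => ->.
case: (pickP [pred y in S | adj v y && (y != x)]) => [y|no]; last first.
  have nbr y : y \in S -> adj v y -> y = x.
    by move=> yS vy; have := no y; rewrite /= yS vy => /negbFE/eqP.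
  have lt_n : #|S :\ v| < n by move: le_n; rewrite (cardsD1 v) vS.
  have [t ht] := IH _ x lt_n (rooted_edge rS xS vx nbr).
  exact: tree_on_edge ht.
case/and3P=> /= yS vy yx.
(* The triangle is oriented one way or the other; x is taken to be the corner that v points to. *)
wlog [nvx [nxy nyv]] : x y xS yS vx vy yx /
    0 < narrows v x /\ 0 < narrows x y /\ 0 < narrows y v.
  move=> W; have xy : adj x y by apply: simp; rewrite // eq_sym.
  have [|||_] := Qtri.2 [:: v; x; y]; first by [].
  - by rewrite /= !inE negb_or !adj_neq.
  - by rewrite /cycle /= vx xy adjC vy.
  case=> /=; rewrite ?andbT => /and3P[h1 h2 h3]; first exact: (W x y).
  by apply: (W y x) => //; rewrite eq_sym.
have xy : x != y by rewrite eq_sym.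
have [tx htx] := IH _ _ (leq_trans (branch_proper xS yS vx xy) le_n)
  (rooted_branch rS xS yS vx vy xy).
have [ty hty] := IH _ _ (leq_trans (branch_proper yS xS vy yx) le_n)
  (rooted_branch rS yS xS vy vx yx).
have dis := branch_disjoint rS xS yS vx vy xy.
exists (N v tx ty); apply: (tree_on_triangle (x := x) (y := y) _ _ dis) => //.
- by apply/negP => /(branch_in xS vx xy)[_]; rewrite eqxx.
- by apply/negP => /(branch_in yS vy yx)[_]; rewrite eqxx.
- exact: branch_root.
- exact: branch_root.
- apply/setP => z; rewrite in_setU1 in_setU; apply/idP/or3P; last first.
    case=> [/eqP->//|/(branch_in xS vx xy)[]//|/(branch_in yS vy yx)[]//].
  move=> zS; case: (z =P v) => [->|/eqP zv]; first by constructor 1.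
  have xv : x != v by rewrite eq_sym adj_neq.
  have yv : y != v by rewrite eq_sym adj_neq.
  have vN := triangle_nbrs rS xS yS vx vy xy.
  case: (triangle_split xv yv xy conn vN zS zv) => zB.
  + by constructor 2; rewrite inE.
  + by constructor 3; rewrite inE.
- exact: triangle_nbrs rS xS yS vx vy xy.
move=> z w zx wy zw.
have [zS zv zy] := branch_in xS vx xy zx.
have [wS wv wx] := branch_in yS vy yx wy.
have ez : z = x.
  apply/eqP; apply/negPn/negP => nzx.
  case: (rooted_branch rS xS yS vx vy xy) => _ _ h _.
  by have := disjointFr dis (h z w zx nzx zw); rewrite wy.
split=> //; apply/eqP; apply/negPn/negP => nwy.
case: (rooted_branch rS yS xS vy vx yx) => _ _ h _.
rewrite adjC in zw.
by have := disjointFr dis zx; rewrite (h w z wy nwy zw).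
Qed.

Lemma tree_of_connected v : connected_quiver Q -> simplicial v ->
  exists t, tree_on setT v t.
Proof.
move=> conn simp; apply: tree_exists; split=> //.
  move=> x _; apply: connect_sub (conn v x) => {}x y xy.
  by apply: connect1; rewrite radjE !inE.
by move=> x y _ _; exact: simp.
Qed.

End Graph.

(** * From trees to M^A *)

Section CutVertex.

Variables (T : eqType) (e : rel T) (A : {pred T}) (c : T).
Hypotheses (e_sym : symmetric e) (cA : c \in A).
Hypothesis e_cut : forall x y, x \in A -> x != c -> e x y -> y \in A.

Lemma cut_exit x s : path e x s -> x \in A -> x != c -> last x s \notin A ->
  c \in s.
Proof.
elim: s x => [|y s IH] x /=; first by move=> _ ->.
case/andP=> xy ys xA xc lA; rewrite inE eq_sym.
case: eqP => //= /eqP yc; apply: IH ys _ yc lA; exact: e_cut xy.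
Qed.

Lemma cut_enter x s : path e x s -> x \notin A -> last x s \in A -> c \in s.
Proof.
elim: s x => [|y s IH] x /=; first by move=> _ /negbTE->.
case/andP=> xy ys xA lA; rewrite inE eq_sym.
case: eqP => //= /eqP yc; apply: IH ys _ lA.
by apply: contra xA => yA; apply: e_cut yA yc _; rewrite e_sym.
Qed.

(** A cycle containing both a vertex of A other than c and a vertex outside A passes through the
    gate c once on the way out and once on the way back, so it is not simple. *)
Lemma cycle_cut s : cycle e s -> uniq s ->
  {subset s <= A} \/ {in s, forall x, x \in A -> x = c}.
Proof.
move=> cs us; case: (boolP (has [pred x | (x \in A) && (x != c)] s)); last first.
  move/hasPn => h; right=> x xs xA; have := h x xs.
  by rewrite /= xA /= negbK => /eqP.
case/hasP=> z zs /andP[/= zA zc]; left=> y ys.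
apply/negPn/negP => yA.
have [i s' ei] := rot_to zs.
have {}cs : cycle e (z :: s') by rewrite -ei rot_cycle.
have {}us : uniq (z :: s') by rewrite -ei rot_uniq.
have {ys} : y \in z :: s' by rewrite -ei mem_rot.
rewrite inE; case/predU1P=> [e'|ys]; first by rewrite e' zA in yA.
case/splitPr: ys cs us {ei} => s1 s2.
rewrite /= rcons_cat cat_path /= => /and3P[p1 py p2] /andP[zs12].
have c1 : c \in s1.
  have : c \in rcons s1 y by apply: cut_exit zA zc _;
    rewrite ?rcons_path ?p1 ?last_rcons.
  rewrite mem_rcons inE => /predU1P[ec|//].
  by rewrite -ec cA in yA.
have c2 : c \in s2.
  have : c \in rcons s2 z by apply: cut_enter p2 yA _; rewrite last_rcons.
  by rewrite mem_rcons inE eq_sym (negPf zc).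
rewrite cat_uniq => /and3P[_ /hasPn h _].
by have := h c; rewrite inE c2 orbT c1 => /(_ isT).
Qed.

End CutVertex.

Section TreeGraph.

Variable V : eqType.
Implicit Types (t l r : tree V) (v x y z : V).

Definition tadj t : rel V := fun x y => tb t x y != 0%R.

Lemma tadj_sym t : symmetric (tadj t).
Proof. by move=> x y; rewrite /tadj tb_antisymm oppr_eq0. Qed.

Lemma tadj_in t x y : tadj t x y -> x \in labels t.
Proof. by apply: contraR => xt; rewrite tb_out. Qed.

Lemma tadj_in2 t x y : tadj t x y -> y \in labels t.
Proof. by rewrite tadj_sym => /tadj_in. Qed.

Definition corner v l r x := [|| x == v, troot l == Some x | troot r == Some x].

Lemma troot_in t x : troot t == Some x -> x \in labels t.
Proof. by apply: contraTT; exact: troot_neq. Qed.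

Section Node.

Variables (v : V) (l r : tree V).
Hypothesis u : uniq (labels (N v l r)).

Let vl : v \notin labels l. Proof. by case: (uniq_node u). Qed.
Let vr : v \notin labels r. Proof. by case: (uniq_node u). Qed.
Let lr x : x \in labels l -> x \notin labels r.
Proof. by case: (uniq_node u) => _ _ _ _; apply. Qed.

Lemma tri_node_eq0 x y : tri (Some v) (troot l) (troot r) x y != 0%R ->
  [/\ corner v l r x, corner v l r y & x != y].
Proof.
have out z : ~~ corner v l r z -> [/\ Some v != Some z, troot l != Some z
    & troot r != Some z].
  by rewrite /corner !negb_or (inj_eq Some_inj) eq_sym => /and3P[].
move=> ne; split; apply: contraNT ne.
- by case/out=> *; rewrite tri_out.
- by case/out=> *; rewrite tri_antisymm tri_out ?oppr0.
- rewrite negbK => /eqP->; rewrite /tri /arr; apply/eqP; ring.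
Qed.

Lemma corner_left x : x \in labels l -> corner v l r x = (troot l == Some x).
Proof.
move=> xl; rewrite /corner (_ : (x == v) = false) /=; last first.
  by apply: contraNF vl => /eqP<-.
by rewrite (negPf (troot_neq (lr xl))) orbF.
Qed.

Lemma corner_right x : x \in labels r -> corner v l r x = (troot r == Some x).
Proof.
move=> xr; rewrite /corner (_ : (x == v) = false) /=; last first.
  by apply: contraNF vr => /eqP<-.
have xl : x \notin labels l by apply: contraL xr; exact: lr.
by rewrite (negPf (troot_neq xl)).
Qed.

Lemma tb_node_left x y : x \in labels l -> y \in labels l ->
  tb (N v l r) x y = tb l x y.
Proof.
move=> xl yl /=; rewrite (tb_out _ (lr xl)) addr0.
have [->|/tri_node_eq0[]] := eqVneq (tri (Some v) (troot l) (troot r) x y) 0%R.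
  by rewrite add0r.
by rewrite !corner_left // => /eqP -> /eqP[->]; rewrite eqxx.
Qed.

Lemma tb_node_right x y : x \in labels r -> y \in labels r ->
  tb (N v l r) x y = tb r x y.
Proof.
move=> xr yr /=; rewrite (@tb_out _ l) ?addr0; last by apply: contraL xr; exact: lr.
have [->|/tri_node_eq0[]] := eqVneq (tri (Some v) (troot l) (troot r) x y) 0%R.
  by rewrite add0r.
by rewrite !corner_right // => /eqP -> /eqP[->]; rewrite eqxx.
Qed.

Lemma tb_node_other x y : ~~ ((x \in labels l) && (y \in labels l)) ->
  ~~ ((x \in labels r) && (y \in labels r)) ->
  tb (N v l r) x y = tri (Some v) (troot l) (troot r) x y.
Proof.
rewrite !negb_and /= => hl hr.
have -> : tb l x y = 0%R by case/orP: hl => h; [rewrite tb_out | rewrite tb_out2].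
have -> : tb r x y = 0%R by case/orP: hr => h; [rewrite tb_out | rewrite tb_out2].
by rewrite !addr0.
Qed.

Lemma tadj_node_cut_left x y : x \in labels l -> troot l != Some x ->
  tadj (N v l r) x y -> tadj l x y.
Proof.
move=> xl nx; rewrite /tadj /= (tb_out _ (lr xl)) addr0.
have [->|/tri_node_eq0[]] := eqVneq (tri (Some v) (troot l) (troot r) x y) 0%R.
  by rewrite add0r.
by rewrite corner_left // (negPf nx).
Qed.

Lemma tadj_node_cut_right x y : x \in labels r -> troot r != Some x ->
  tadj (N v l r) x y -> tadj r x y.
Proof.
move=> xr nx; rewrite /tadj /= (@tb_out _ l) ?addr0; last first.
  by apply: contraL xr; exact: lr.
have [->|/tri_node_eq0[]] := eqVneq (tri (Some v) (troot l) (troot r) x y) 0%R.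
  by rewrite add0r.
by rewrite corner_right // (negPf nx).
Qed.

(** The orientation v -> l -> r -> v of the top triangle, restricted to the corners that are actual
    labels. *)
Definition succ x y : bool :=
  [|| (x == v) && (troot l == Some y),
      (troot l == Some x) && (troot r == Some y)
    | (troot r == Some x) && (y == v)].

Lemma corner_succ x y : corner v l r x -> corner v l r y -> x != y ->
  succ x y || succ y x.
Proof.
rewrite /corner /succ => + + xy; case/or3P=> /eqP ex; case/or3P=> /eqP ey.
- by rewrite ex ey eqxx in xy.
- by rewrite ex ey !eqxx.
- by rewrite ex ey !eqxx !orbT.
- by rewrite ex ey !eqxx !orbT.
- by move: ex xy; rewrite ey => -[->]; rewrite eqxx.
- by rewrite ex ey !eqxx !orbT.
- by rewrite ex ey !eqxx !orbT.
- by rewrite ex ey !eqxx !orbT.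
- by move: ex xy; rewrite ey => -[->]; rewrite eqxx.
Qed.

Lemma succ_tb x y : succ x y -> tb (N v l r) x y = 1%R.
Proof.
have vl' := troot_neq vl; have vr' := troot_neq vr.
case/or3P=> /andP[/eqP ex /eqP ey].
- have yl : y \in labels l by rewrite troot_in // ey.
  have yr := lr yl; have yr' := troot_neq yr; subst x.
  have vy : v != y by apply: contraNneq vl => ->.
  rewrite tb_node_other ?(negPf vl) ?(negPf vr) // ey /tri /arr.
  rewrite !delta_id (delta_neq vr') (delta_neq yr') [delta (Some v) y]delta_neq.
    by ring.
  by rewrite (inj_eq Some_inj).
- have xl : x \in labels l by rewrite troot_in // ex.
  have yr : y \in labels r by rewrite troot_in // ey.
  have xr := lr xl; have yl : y \notin labels l by apply: contraL yr; exact: lr.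
  have vx : Some v != Some x.
    by rewrite (inj_eq Some_inj); apply: contraNneq vl => ->.
  have vy : Some v != Some y.
    by rewrite (inj_eq Some_inj); apply: contraNneq vr => ->.
  have xy : Some x != Some y.
    by rewrite (inj_eq Some_inj); apply: contraNneq xr => ->.
  rewrite tb_node_other ?(negPf xr) ?(negPf yl) ?andbF // ex ey /tri /arr.
  rewrite !delta_id (delta_neq vx) (delta_neq vy) (delta_neq xy).
  by ring.
- have xr : x \in labels r by rewrite troot_in // ex.
  have xl : x \notin labels l by apply: contraL xr; exact: lr.
  have xl' := troot_neq xl; subst y.
  have vx : v != x by apply: contraNneq vr => ->.
  rewrite tb_node_other ?(negPf vl) ?(negPf vr) ?andbF // ex /tri /arr.
  rewrite !delta_id (delta_neq vl') (delta_neq xl') [delta (Some v) x]delta_neq.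
    by ring.
  by rewrite (inj_eq Some_inj).
Qed.

Lemma tadj_node x y : tadj (N v l r) x y ->
  [\/ tadj l x y, tadj r x y | succ x y || succ y x].
Proof.
have [/andP[xl yl]|nl] := boolP ((x \in labels l) && (y \in labels l)).
  by rewrite /tadj tb_node_left //; constructor 1.
have [/andP[xr yr]|nr] := boolP ((x \in labels r) && (y \in labels r)).
  by rewrite /tadj tb_node_right //; constructor 2.
rewrite /tadj tb_node_other // => /tri_node_eq0[cx cy xy].
by constructor 3; exact: corner_succ.
Qed.

Lemma succ_fun x y z : succ x y -> succ x z -> y = z.
Proof.
have vl' := troot_neq vl; have vr' := troot_neq vr.
have lr' w : troot l = Some w -> troot r != Some w.
  by move=> e; apply/troot_neq/lr/troot_in/eqP.
case/or3P=> /andP[/eqP e1 /eqP e2] /or3P[]/andP[/eqP e3 /eqP e4].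
- by move: e4; rewrite e2 => -[].
- by rewrite -e1 e3 eqxx in vl'.
- by rewrite -e1 e3 eqxx in vr'.
- by rewrite -e3 e1 eqxx in vl'.
- by move: e4; rewrite e2 => -[].
- by have := lr' _ e1; rewrite e3 eqxx.
- by rewrite -e3 e1 eqxx in vr'.
- by have := lr' _ e3; rewrite e1 eqxx.
- by rewrite e2 e4.
Qed.

Lemma succ_inj x y z : succ x z -> succ y z -> x = y.
Proof.
have vl' := troot_neq vl; have vr' := troot_neq vr.
have lr' w : troot l = Some w -> troot r != Some w.
  by move=> e; apply/troot_neq/lr/troot_in/eqP.
case/or3P=> /andP[/eqP e1 /eqP e2] /or3P[]/andP[/eqP e3 /eqP e4].
- by rewrite e1 e3.
- by have := lr' _ e2; rewrite e4 eqxx.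
- by rewrite -e4 e2 eqxx in vl'.
- by have := lr' _ e4; rewrite e2 eqxx.
- by move: e3; rewrite e1 => -[].
- by rewrite -e4 e2 eqxx in vr'.
- by rewrite -e2 e4 eqxx in vl'.
- by rewrite -e2 e4 eqxx in vr'.
- by move: e3; rewrite e1 => -[].
Qed.

Lemma succ_tadj x y : succ x y -> tadj (N v l r) x y.
Proof. by rewrite /tadj => /succ_tb->. Qed.

Lemma tadj_corners x y : corner v l r x -> corner v l r y -> x != y ->
  tadj (N v l r) x y.
Proof.
move=> cx cy xy; case/orP: (corner_succ cx cy xy) => /succ_tadj //.
by rewrite tadj_sym.
Qed.

Lemma tadj_left x y : tadj l x y -> tadj (N v l r) x y.
Proof.
by move=> h; rewrite /tadj tb_node_left //; [exact: tadj_in h|exact: tadj_in2 h].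
Qed.

Lemma tadj_right x y : tadj r x y -> tadj (N v l r) x y.
Proof.
by move=> h; rewrite /tadj tb_node_right //; [exact: tadj_in h|exact: tadj_in2 h].
Qed.

End Node.

Lemma tb_bound t x y : uniq (labels t) -> (- 1 <= tb t x y <= 1)%R.
Proof.
elim: t => [|v l IHl r IHr] // u.
have [_ _ ul ur _] := uniq_node u.
have [|/negPn/eqP] := boolP (tadj (N v l r) x y); last by rewrite /tadj => ->.
move=> a; case: (tadj_node u a) => [h|h|/orP[]/(succ_tb u) h].
- by rewrite tb_node_left ?IHl //; [exact: tadj_in h|exact: tadj_in2 h].
- by rewrite tb_node_right ?IHr //; [exact: tadj_in h|exact: tadj_in2 h].
- by rewrite h.
- by rewrite tb_antisymm h.
Qed.

Definition torient t : rel V := fun x y => (0 < tb t x y)%R.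

Lemma cycle_sub (e e' : rel V) (s : seq V) :
  {in s &, forall x y, e x y -> e' x y} -> cycle e s -> cycle e' s.
Proof.
by move=> h; apply: sub_in_cycle; [exact: h | apply/allP].
Qed.

(** A subtree meets the rest of the graph only through its root. By [cycle_cut] a simple cycle
    either stays in one subtree, where induction applies, or uses only corners of the top triangle,
    of which there are at most three. *)
Lemma tree_triangles t (s : seq V) : uniq (labels t) ->
    3 <= size s -> uniq s -> cycle (tadj t) s ->
  size s = 3 /\ (cycle (torient t) s \/ cycle (fun x y => torient t y x) s).
Proof.
elim: t => [|v l IHl r IHr] u s3 us cs.
  by case: s s3 cs {us} => [|x [|y s]] //=.
have [vl vr ul ur lr] := uniq_node u.
have side (t : tree V) :
    (forall x y, x \in labels t -> troot t != Some x -> tadj (N v l r) x y ->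
       tadj t x y) ->
    {subset s <= labels t} \/ {in s, forall x, x \in labels t -> troot t = Some x}.
  case: t => [|a t1 t2] ht; first by right.
  case: (@cycle_cut _ (tadj (N v l r)) (mem (labels (N a t1 t2))) a _ _ _ s) => //.
  - exact: tadj_sym.
  - by rewrite /= inE eqxx.
  - move=> x y xt xa /(ht _ _ xt); rewrite (inj_eq Some_inj) eq_sym xa.
    by move=> /(_ isT)/tadj_in2.
  - by left.
  - by move=> h; right=> x xs /(h x xs)->.
have restrict (t : tree V) :
    {in labels t &, forall x y, tb (N v l r) x y = tb t x y} ->
    (uniq (labels t) -> 3 <= size s -> uniq s -> cycle (tadj t) s ->
       size s = 3 /\ (cycle (torient t) s \/ cycle (fun x y => torient t y x) s)) ->
    uniq (labels t) -> {subset s <= labels t} ->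
  size s = 3 /\ (cycle (torient (N v l r)) s
                 \/ cycle (fun x y => torient (N v l r) y x) s).
  move=> et IH ut st; case: (IH ut s3 us).
    by apply: cycle_sub cs => x y xs ys; rewrite /tadj et ?st.
  move=> -> [h|h]; split=> //; [left|right]; apply: cycle_sub h => x y xs ys;
  by rewrite /torient et ?st.
case: (side l) => [|sl|sl].
- by move=> x y; exact: tadj_node_cut_left.
- by apply: (restrict l) => // x y; exact: tb_node_left.
case: (side r) => [|sr|sr].
- by move=> x y; exact: tadj_node_cut_right.
- by apply: (restrict r) => // x y; exact: tb_node_right.
have sc x : x \in s -> corner v l r x.
  move=> xs; have := tadj_in (next_cycle cs xs).
  rewrite /= inE mem_cat /corner => /or3P[->//|xl|xr].
    by rewrite (sl x xs xl) eqxx orbT.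
  by rewrite (sr x xs xr) eqxx !orbT.
have le3 : size s <= 3.
  pose o (t : tree V) := if troot t is Some a then [:: a] else [::].
  have so : size (v :: o l ++ o r) <= 3.
    by rewrite /o; case: (troot l); case: (troot r).
  apply: leq_trans so; apply: uniq_leq_size => // x /sc.
  rewrite /corner inE mem_cat /o => /or3P[->//|/eqP->|/eqP->];
  by rewrite inE eqxx !orbT.
have {le3} s3' : size s = 3 by apply/eqP; rewrite eqn_leq le3.
split=> //; case: s s3' us sc {s3 cs side restrict sl sr IHl IHr} =>
  [|x [|y [|z []]]] //= _.
rewrite !inE negb_or => /and3P[/andP[xy xz] yz _] sc.
have cx : corner v l r x by apply: sc; rewrite inE eqxx.
have cy : corner v l r y by apply: sc; rewrite !inE eqxx orbT.
have cz : corner v l r z by apply: sc; rewrite !inE eqxx !orbT.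
have o a b : succ v l r a b -> (0 < tb (N v l r) a b)%R by move/(succ_tb u)->.
(* As [succ] is functional and injective, the direction of one side forces that of the other two. *)
rewrite /torient !andbT; case/orP: (corner_succ cx cy xy) => s1.
- left; case/orP: (corner_succ cy cz yz) => s2; last first.
    by rewrite (succ_inj u s1 s2) eqxx in xz.
  case/orP: (corner_succ cx cz xz) => s3.
    by rewrite (succ_fun u s1 s3) eqxx in yz.
  by rewrite !o.
- right; case/orP: (corner_succ cy cz yz) => s2.
    by rewrite (succ_fun u s1 s2) eqxx in xz.
  case/orP: (corner_succ cx cz xz) => s3; last first.
    by rewrite (succ_inj u s1 s3) eqxx in yz.
  by rewrite !o.
Qed.

Lemma tree_root_nbrs t v x y : uniq (labels t) -> troot t = Some v ->
  tadj t v x -> tadj t v y -> x != y -> tadj t x y.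
Proof.
case: t => [|a l r] // u [ea]; subst a => vx vy xy.
have [vl vr _ _ _] := uniq_node u.
have c z : tadj (N v l r) v z -> corner v l r z.
  rewrite /tadj tb_node_other ?(negPf vl) ?(negPf vr) //.
  by case/tri_node_eq0.
by apply: tadj_corners => //; exact: c.
Qed.

(** The neighbours of a vertex are covered by at most two cliques, coming from the triangle above it
    and the triangle below it; two of any three neighbours share a clique. *)
Lemma tree_claw_free t v x y z : uniq (labels t) ->
  tadj t v x -> tadj t v y -> tadj t v z -> x != y -> y != z -> x != z ->
  [|| tadj t x y, tadj t y z | tadj t x z].
Proof.
elim: t => [|a l IHl r IHr]; first by rewrite /tadj eqxx.
move=> u vx vy vz xy yz xz; have [al ar ul ur lr] := uniq_node u.
have root_side (t : tree V) : uniq (labels t) -> troot t = Some v ->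
    (forall p q, tadj t p q -> tadj (N a l r) p q) ->
    (forall p, tadj (N a l r) v p -> tadj t v p \/ corner a l r p) ->
    [|| tadj (N a l r) x y, tadj (N a l r) y z | tadj (N a l r) x z].
  move=> ut rt lift h.
  have tt p q : tadj t v p -> tadj t v q -> p != q -> tadj (N a l r) p q.
    by move=> vp vq pq; apply: lift; exact: tree_root_nbrs rt vp vq pq.
  have cc p q := @tadj_corners _ _ _ u p q.
  case: (h x vx) (h y vy) (h z vz) => hx [] hy [] hz; apply/or3P;
    first [constructor 1; solve [exact: tt | exact: cc]
          |constructor 2; solve [exact: tt | exact: cc]
          |constructor 3; solve [exact: tt | exact: cc]].
have sc p q : succ a l r p q || succ a l r q p -> corner a l r q.
  by rewrite /succ /corner; case/orP=> /or3P[]/andP[h1 h2];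
     rewrite ?h1 ?h2 ?orbT.
have := tadj_in vx; rewrite /= inE mem_cat => /or3P[/eqP va|vl|vr].
- by rewrite (@tree_root_nbrs _ v x y) // va.
- case: (troot l =P Some v) => [rl|/eqP nl].
    apply: (root_side l) => // p; first exact: tadj_left.
    move=> vp; case: (tadj_node u vp) => [|/tadj_in vr|/sc]; [by left| |by right].
    by have := lr v vl; rewrite vr.
  have cut p : tadj (N a l r) v p -> tadj l v p.
    exact: (tadj_node_cut_left u vl nl).
  by case/or3P: (IHl ul (cut _ vx) (cut _ vy) (cut _ vz) xy yz xz) => h;
     rewrite (tadj_left u h) ?orbT.
- case: (troot r =P Some v) => [rr|/eqP nr].
    apply: (root_side r) => // p; first exact: tadj_right.
    move=> vp; case: (tadj_node u vp) => [/tadj_in vl||/sc]; [|by left|by right].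
    by have := lr v vl; rewrite vr.
  have cut p : tadj (N a l r) v p -> tadj r v p.
    exact: (tadj_node_cut_right u vr nr).
  by case/or3P: (IHr ur (cut _ vx) (cut _ vy) (cut _ vz) xy yz xz) => h;
     rewrite (tadj_right u h) ?orbT.
Qed.

End TreeGraph.

Lemma tree_connected (V : finType) (t : tree V) v x : uniq (labels t) ->
  troot t = Some v -> x \in labels t -> connect (tadj t) v x.
Proof.
elim: t v => [|a l IHl r IHr] // v u [<-]; have [_ _ ul ur _] := uniq_node u.
rewrite /= inE mem_cat => /or3P[/eqP->|xl|xr]; first exact: connect0.
- case el: (troot l) => [b|]; last by case: (l) el xl.
  have ab : tadj (N a l r) a b.
    by apply: succ_tadj => //; rewrite /succ el !eqxx.
  apply: connect_trans (connect1 ab) _.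
  by apply: connect_sub (IHl b ul el xl) => p q /(tadj_left u)/connect1.
- case er: (troot r) => [b|]; last by case: (r) er xr.
  have ab : tadj (N a l r) a b.
    by rewrite tadj_sym; apply: succ_tadj => //; rewrite /succ er !eqxx !orbT.
  apply: connect_trans (connect1 ab) _.
  by apply: connect_sub (IHr b ur er xr) => p q /(tadj_right u)/connect1.
Qed.

(** * Graph properties of a quiver given by a tree *)

Section TreeOn.

Variables (Q : quiver) (v : vertex Q) (t : tree (vertex Q)).
Hypothesis ht : tree_on setT v t.

Lemma tree_on_adj : @adjacent Q =2 tadj t.
Proof.
by case: ht => _ _ _ bt x y; rewrite bmat_adj bt ?inE.
Qed.

Lemma tree_on_connected : connected_quiver Q.
Proof.
have [rt ut lt _] := ht.
have h x : connect (@adjacent Q) v x.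
  rewrite (eq_connect tree_on_adj); apply: tree_connected => //.
  by rewrite lt inE.
move=> x y; apply: connect_trans (h y).
by rewrite (sym_connect_sym (@adjC Q)).
Qed.

Lemma tree_on_triangles : oriented_triangles Q.
Proof.
have [rt ut lt bt] := ht; split=> [x y|s s3 us cs].
  have /andP[_] := tb_bound x y ut; rewrite -bt ?inE // /bmat.
  by case: (narrows_anti x y); lia.
have [|-> h] := tree_triangles ut s3 us.
  by rewrite -(eq_cycle tree_on_adj).
split=> //; have eq x y : torient t x y = (0 < narrows x y).
  rewrite /torient -bt ?inE // /bmat.
  by case: (narrows_anti x y); lia.
by case: h => h; [left|right]; apply: sub_cycle h => x y; rewrite eq.
Qed.

Lemma tree_on_claw_free : claw_free Q.
Proof.
have [_ ut _ _] := ht => w x y z; rewrite !tree_on_adj.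
exact: tree_claw_free.
Qed.

Lemma tree_on_simplicial : simplicial v.
Proof.
have [rt ut _ _] := ht => x y; rewrite !tree_on_adj.
exact: tree_root_nbrs.
Qed.

End TreeOn.

(** * The definition of M^A against its graph form *)

Section MAGraph.

Variable Q : quiver.
Local Notation V := (vertex Q).
Local Notation adj := (@adjacent Q).
Implicit Types (x y : arrow Q) (u v w : V).

Definition link x u w : bool :=
  (qtail x == u) && (qhead x == w) || (qtail x == w) && (qhead x == u).

Lemma narrows_gt0P u w :
  reflect (exists x, qtail x = u /\ qhead x = w) (0 < narrows u w).
Proof.
apply: (iffP card_gt0P) => [[x]|[x [<- <-]]]; last by exists x; rewrite inE !eqxx.
by rewrite inE => /andP[/eqP ? /eqP ?]; exists x.
Qed.

Lemma adjP u w : reflect (exists x, link x u w) (adj u w).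
Proof.
rewrite /adjacent /=; apply: (iffP orP) => [[]/narrows_gt0P[x [<- <-]]|[x]].
- by exists x; rewrite /link !eqxx.
- by exists x; rewrite /link !eqxx orbT.
by case/orP=> /andP[/eqP<- /eqP<-]; [left|right]; apply/narrows_gt0P; exists x.
Qed.

Lemma link_adj x u w : link x u w -> adj u w.
Proof. by move=> h; apply/adjP; exists x. Qed.

Lemma link_sym x u w : link x u w = link x w u.
Proof. by rewrite /link orbC. Qed.

Lemma link_ends x : link x (qtail x) (qhead x).
Proof. by rewrite /link !eqxx. Qed.

Lemma link_step (p : arrow Q * bool) : link p.1 (step_src p) (step_dst p).
Proof.
by case: p => x []; rewrite /step_src /step_dst /=; [|rewrite link_sym];
   exact: link_ends.
Qed.

Lemma link_cases x u w u' w' : link x u w -> link x u' w' ->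
  (u = u' /\ w = w') \/ (u = w' /\ w = u').
Proof.
by case/orP=> /andP[/eqP<- /eqP<-] /orP[]/andP[/eqP<- /eqP<-]; auto.
Qed.

Lemma link_incident x v : (x \in incident v) = [exists w, link x v w].
Proof.
rewrite inE; apply/orP/existsP => [[]/eqP<-|[w /orP[]/andP[/eqP-> /eqP->]]].
- by exists (qhead x); exact: link_ends.
- by exists (qtail x); rewrite link_sym link_ends.
- by rewrite eqxx; left.
- by rewrite eqxx; right.
Qed.

Lemma adj_step u w : adj u w ->
  exists p : arrow Q * bool, step_src p = u /\ step_dst p = w.
Proof.
case/adjP=> x /orP[]/andP[/eqP<- /eqP<-]; first by exists (x, true).
by exists (x, false).
Qed.

Lemma next_next (T : eqType) (s : seq T) (u : T) : uniq s -> 2 < size s -> u \in s ->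
  next s (next s u) != u.
Proof.
move=> us s3 xs; have [i s' e] := rot_to xs.
have us' : uniq (u :: s') by rewrite -e rot_uniq.
have s3' : 2 < size (u :: s') by rewrite -e size_rot.
rewrite -!(next_rot i us) e.
case: s' us' s3' {e} => [|w [|z s']] //= => /and4P[].
rewrite !inE !negb_or => /and3P[uw uz us'] /andP[wz _] _ _ _.
by rewrite eqxx /= (eq_sym w u) (negPf uw) /= eqxx eq_sym.
Qed.

Section FromMA.

Hypothesis cyc : forall s : seq (arrow Q * bool),
  simple_cycle s -> oriented_cycle s /\ size s = 3.

(** Two parallel arrows, one traversed forwards and one backwards, would be a cycle of length
    two. *)
Lemma cycles_narrows u w : narrows u w <= 1.
Proof.
rewrite leqNgt; apply/negP => /card_gt1P[x [y []]].
rewrite !inE => /andP[/eqP tx /eqP hx] /andP[/eqP ty /eqP hy] xy.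
have [|//] := cyc (s := [:: (x, true); (y, false)]); split=> //=.
- by rewrite /step_dst /step_src /= hx hy tx ty !eqxx.
- by rewrite inE xy.
- rewrite /step_src /= tx hy inE andbT; apply/eqP => e.
  by apply: (@no_loop Q x); rewrite tx hx.
Qed.

(** One arrow is chosen for each side of a vertex cycle. These arrows are distinct because in a
    cycle of length at least three no side is another one reversed ([next_next]). *)
Lemma cycles_triangles : oriented_triangles Q.
Proof.
split=> [u w|s s3 us cs]; first exact: cycles_narrows.
have h u : u \in s ->
    exists p : arrow Q * bool, (step_src p == u) && (step_dst p == next s u).
  by move=> /(next_cycle cs)/adj_step[p [e1 e2]]; exists p; rewrite e1 e2 !eqxx.
have [p0 _] : exists p : arrow Q * bool, true.
  by case: s s3 h {us cs} => // u s _ /(_ u (mem_head _ _))[p _]; exists p.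
pose st u := odflt p0 [pick p | (step_src p == u) && (step_dst p == next s u)].
have stP u : u \in s -> step_src (st u) = u /\ step_dst (st u) = next s u.
  move=> /h[p hp]; rewrite /st; case: pickP => [q /andP[/eqP sq /eqP dq]|/(_ p)];
    first by [].
  by rewrite hp.
have [|ori sz] := cyc (s := map st s).
  split.
  - by case: (s) s3.
  - rewrite cycle_map; apply: cycle_sub (cycle_next us) => u w us' ws /eqP <-.
    by rewrite /= (stP u us').2 (stP _ _).1 // mem_next.
  - rewrite -map_comp map_inj_in_uniq // => u w us' ws /= e.
    have [lu lw] := (link_step (st u), link_step (st w)).
    rewrite e (stP u us').1 (stP u us').2 in lu.
    rewrite (stP w ws).1 (stP w ws).2 in lw.
    case: (link_cases lu lw) => [[]//|[e1 e2]].
    by have := next_next us s3 us'; rewrite e2 -e1 eqxx.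
  - by rewrite -map_comp map_id_in // => u /stP[].
rewrite size_map in sz; split=> //.
have cn := cycle_next us.
have : exists b, forall u, u \in s -> (st u).2 = b.
  move: ori; rewrite /oriented_cycle -map_comp.
  case: (s) => [|a s'] /= => [_|/allP al]; first by exists true.
  exists (st a).2 => u; rewrite inE => /predU1P[->//|us'].
  by apply/eqP/al/map_f.
case=> -[] hb; [left|right]; apply: cycle_sub cn => u w us' ws /eqP<- /=;
  apply/narrows_gt0P;
  exists (st u).1; have [h1 h2] := stP u us';
  by rewrite /step_src /step_dst hb // in h1 h2.
Qed.

End FromMA.

Lemma three_cycle_vertices (C : {set arrow Q}) : three_cycle C ->
  exists a b c, [/\ adj a b, adj b c & adj c a] /\
    forall x u w, x \in C -> link x u w -> (u \in [:: a; b; c]) && (w \in [:: a; b; c]).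
Proof.
case=> s [[_ cs _ _] s3 ->]; case: s s3 cs => [|p [|q [|r []]]] // _ cs.
move: cs; rewrite /cycle /= andbT => /and3P[/eqP pq /eqP qr /eqP rp].
have lp := link_step p; have lq := link_step q; have lr := link_step r.
rewrite pq in lp; rewrite qr in lq; rewrite rp in lr.
exists (step_src p), (step_src q), (step_src r); split.
  by split; [exact: link_adj lp | exact: link_adj lq | exact: link_adj lr].
move=> x u w; rewrite !inE => /or3P[]/eqP-> h.
- by case: (link_cases h lp) => -[-> ->]; rewrite !eqxx ?orbT.
- by case: (link_cases h lq) => -[-> ->]; rewrite !eqxx ?orbT.
- by case: (link_cases h lr) => -[-> ->]; rewrite !eqxx ?orbT.
Qed.

Lemma clique3 a b c u w : adj a b -> adj b c -> adj c a ->
  u \in [:: a; b; c] -> w \in [:: a; b; c] -> u != w ->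
  adj u w /\ exists z, adj u z /\ adj w z.
Proof.
move=> ab bc ca; have ba := ab; have cb := bc; have ac := ca.
rewrite adjC in ba; rewrite adjC in cb; rewrite adjC in ac.
rewrite !inE => /or3P[]/eqP-> /or3P[]/eqP->; rewrite ?eqxx // => _;
  by split=> //; solve [exists a; by split|exists b; by split|exists c; by split].
Qed.

Lemma three_cycle_adj (C : {set arrow Q}) x y v u w : three_cycle C ->
  x \in C -> y \in C -> link x v u -> link y v w -> u != w -> adj u w.
Proof.
case/three_cycle_vertices=> a [b [c [[ab bc ca] h]]] xC yC xu yw uw.
have /andP[_ ua] := h _ _ _ xC xu; have /andP[_ wa] := h _ _ _ yC yw.
by have [] := clique3 ab bc ca ua wa uw.
Qed.

Definition nbrs v := [set w | adj v w].

Lemma valencyE v : valency v = #|nbrs v|.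
Proof.
apply: eq_card => w; rewrite !inE; apply: andb_idl => /adj_neq.
by rewrite eq_sym.
Qed.

Lemma link_neq x y v u w : link x v u -> link y v w -> u != w -> x != y.
Proof.
move=> xu yw; apply: contraNneq => e; rewrite -e in yw.
by case: (link_cases xu yw) => -[e1 e2]; rewrite e2 // -e1.
Qed.

(** At valency four the arrows lie in two 3-cycles, so two of any three share one; at valency three
    only one arrow lies outside the 3-cycle. Two arrows at v in a common 3-cycle have adjacent
    ends. *)
Lemma MA_claw_free k : MA_k k Q -> claw_free Q.
Proof.
case=> _ [_ _ le4 val4 val3] v a b c va vb vc ab bc ac.
have sub : [set a; b; c] \subset nbrs v.
  by apply/subsetP => w; rewrite !inE => /orP[/orP[]|]/eqP->.
have c3 : #|[set a; b; c]| = 3.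
  rewrite setUC cardsU1 cards2 ab !inE negb_or ![c == _]eq_sym.
  by rewrite ac bc.
have := le4 v; have := subset_leq_card sub; rewrite c3 -valencyE.
case/adjP: va => x xa; case/adjP: vb => y yb; case/adjP: vc => z zc.
have xi : x \in incident v by rewrite link_incident; apply/existsP; exists a.
have yi : y \in incident v by rewrite link_incident; apply/existsP; exists b.
have zi : z \in incident v by rewrite link_incident; apply/existsP; exists c.
have xy := link_neq xa yb ab; have yz := link_neq yb zc bc.
have xz := link_neq xa zc ac.
rewrite leq_eqVlt => /predU1P[e _|]; last first.
  move=> h3 h4; have /val4 : valency v = 4 by apply/eqP; rewrite eqn_leq h4.
  case=> C1 [C2 [I1 [I2 [[tC1 tC2 _] [e _ _ /subsetP s1 /subsetP s2]]]]].
  rewrite -e !inE in xi yi zi.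
  have h1 p q u w : p \in I1 -> q \in I1 -> link p v u -> link q v w -> u != w ->
      adj u w by move=> /s1 pC /s1 qC; exact: three_cycle_adj tC1 pC qC.
  have h2 p q u w : p \in I2 -> q \in I2 -> link p v u -> link q v w -> u != w ->
      adj u w by move=> /s2 pC /s2 qC; exact: three_cycle_adj tC2 pC qC.
  by case/orP: xi => xI; case/orP: yi => yI; case/orP: zi => zI; apply/or3P;
   first [constructor 1; solve [exact: h1 xI yI xa yb ab|exact: h2 xI yI xa yb ab]
         |constructor 2; solve [exact: h1 yI zI yb zc bc|exact: h2 yI zI yb zc bc]
         |constructor 3; solve [exact: h1 xI zI xa zc ac|exact: h2 xI zI xa zc ac]].
have [C [I [t [ei _ _ [tC /subsetP sI] _]]]] := val3 v (esym e).
have h p q u w : p \in I -> q \in I -> link p v u -> link q v w -> u != w ->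
    adj u w by move=> /sI pC /sI qC; exact: three_cycle_adj tC pC qC.
rewrite -ei !inE in xi yi zi.
case/predU1P: xi => [xt|xI].
  rewrite -xt !(eq_sym _ x) (negPf xy) (negPf xz) /= in yi zi.
  by rewrite (h _ _ _ _ yi zi yb zc bc) orbT.
case/predU1P: yi => [yt|yI]; last by rewrite (h _ _ _ _ xI yI xa yb ab).
rewrite -yt (eq_sym z) (negPf yz) /= in zi.
by rewrite (h _ _ _ _ xI zi xa zc ac) !orbT.
Qed.

(** Two distinct neighbours force valency two; then v is on a 3-cycle, whose other vertices must be
    these two neighbours. *)
Lemma connecting_simplicial v : connecting_vertex v -> simplicial v.
Proof.
case=> le2 val2 u w vu vw uw.
have sub : [set u; w] \subset nbrs v.
  by apply/subsetP => z; rewrite !inE => /orP[]/eqP->.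
have e2 : valency v = 2.
  apply/eqP; rewrite eqn_leq le2 valencyE.
  by have := subset_leq_card sub; rewrite cards2 uw.
have eN : [set u; w] = nbrs v.
  by apply/eqP; rewrite eqEcard sub cards2 uw -valencyE e2.
have [C [x [/three_cycle_vertices[a [b [c [[ab bc ca] h]]]] xC]]] := val2 e2.
rewrite link_incident => /existsP[z xz].
have /andP[va za] := h _ _ _ xC xz.
have vz := link_adj xz.
have [_ [t [vt zt]]] := clique3 ab bc ca va za (adj_neq vz).
have : z \in nbrs v by rewrite inE.
have : t \in nbrs v by rewrite inE.
rewrite -eN !inE => /orP[]/eqP et /orP[]/eqP ez; subst t z => //;
  by rewrite ?adj_irr // in zt *; rewrite adjC.
Qed.

Section ToMA.

Hypotheses (Qtri : oriented_triangles Q) (Qclaw : claw_free Q).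

Lemma link_uniq x y u w : link x u w -> link y u w -> x = y.
Proof.
have le1 a b : qtail x = a -> qhead x = b -> qtail y = a -> qhead y = b -> x = y.
  move=> tx hx ty hy; have /card_le1_eqP := Qtri.1 a b; apply;
  by rewrite inE ?tx ?hx ?ty ?hy !eqxx.
case/orP=> /andP[/eqP tx /eqP hx] /orP[]/andP[/eqP ty /eqP hy].
- exact: le1 ty hy.
- by case: (@no_2cycle Q x y); rewrite tx hx ty hy.
- by case: (@no_2cycle Q x y); rewrite tx hx ty hy.
- exact: le1 ty hy.
Qed.

Lemma step_true (p : arrow Q * bool) : arrowrel (step_src p) (step_dst p) -> p.2.
Proof.
case: p => x [] //; rewrite /arrowrel /step_src /step_dst /=.
case/narrows_gt0P=> y [ty hy].
by case: (@no_2cycle Q x y); rewrite ty hy.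
Qed.

Lemma step_false (p : arrow Q * bool) :
  arrowrel (step_dst p) (step_src p) -> ~~ p.2.
Proof.
case: p => x [] //; rewrite /arrowrel /step_src /step_dst /=.
case/narrows_gt0P=> y [ty hy].
by case: (@no_2cycle Q x y); rewrite ty hy.
Qed.

Lemma triangles_cycles (s : seq (arrow Q * bool)) : simple_cycle s ->
  oriented_cycle s /\ size s = 3.
Proof.
case=> nil cs ua us.
have s3 : 3 <= size s.
  case: s nil cs ua us => [|p [|q []]] //= _.
    rewrite andbT => /eqP e _ _; have := link_adj (link_step p).
    by rewrite e adj_irr.
  rewrite !inE !andbT => /andP[/eqP pq /eqP qp] pq' _.
  have lp := link_step p; have lq := link_step q.
  rewrite pq in lp; rewrite qp link_sym in lq.
  by rewrite (link_uniq lp lq) eqxx in pq'.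
have cv : cycle adj (map (@step_src Q) s).
  rewrite cycle_map; apply: sub_cycle cs => p q /= /eqP <-.
  exact: link_adj (link_step p).
have [|sz ori] := Qtri.2 _ _ us cv; first by rewrite size_map.
rewrite size_map in sz; split=> //.
case: s sz ori cs {s3 ua us cv nil} => [|p [|q [|r []]]] // _ ori.
rewrite /cycle /= andbT => /and3P[/eqP pq /eqP qr /eqP rp].
move: ori; rewrite /oriented_cycle /= !andbT.
case=> /and3P[h1 h2 h3].
  by rewrite !step_true // ?pq ?qr ?rp.
have := @step_false p; have := @step_false q; have := @step_false r.
rewrite pq qr rp => /(_ h3)/negPf-> /(_ h2)/negPf-> /(_ h1)/negPf->.
by rewrite eqxx.
Qed.

(** Otherwise v, w, u, z is a 4-cycle. Thus adjacency among the neighbours of v is a partial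
    matching. *)
Lemma nbr_matching v u w z : adj v u -> adj v w -> adj v z ->
  adj u w -> adj u z -> w = z.
Proof.
move=> vu vw vz uw uz; apply/eqP/negPn/negP => wz.
have [|||//] := Qtri.2 [:: v; w; u; z] => //.
  rewrite /= !inE !negb_or (adj_neq vu) (adj_neq vw) (adj_neq vz) wz.
  by rewrite (adj_neq uz) eq_sym (adj_neq uw).
by rewrite /cycle /= vw adjC uw uz adjC vz.
Qed.

Lemma nonadj_nbrs v u w z : adj v u -> adj v w -> adj v z -> u != w -> u != z ->
  w != z -> ~~ adj u w -> ~~ adj u z -> adj w z.
Proof.
move=> vu vw vz uw uz wz nuw nuz.
by have := Qclaw vu vw vz uw wz uz; rewrite (negPf nuw) (negPf nuz) orbF.
Qed.

Lemma nbrs_split v u : adj v u ->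
  exists A B : {set V}, [/\ nbrs v = u |: (A :|: B),
    [/\ u \notin A, u \notin B & [disjoint A & B]],
    #|A| <= 1 /\ #|B| <= 2, {in A, forall w, adj u w}
    & {in B &, forall w z, w != z -> adj w z}].
Proof.
move=> vu.
exists [set w in nbrs v | adj u w], [set w in nbrs v | (w != u) && ~~ adj u w].
have B2 : {in [set w in nbrs v | (w != u) && ~~ adj u w] &,
    forall w z, w != z -> adj w z}.
  move=> w z; rewrite !inE => /and3P[vw wu nuw] /and3P[vz zu nuz] wz.
  by apply: (@nonadj_nbrs v u); rewrite // eq_sym.
split=> //.
- apply/setP => w; rewrite !inE; case: (w =P u) => [->//|_] /=.
  by case: (adj u w); rewrite ?andbT ?andbF ?orbF.
- split; rewrite ?inE ?eqxx ?adj_irr ?andbF //.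
  by apply/pred0P => w; rewrite /= !inE; case: (adj u w); rewrite ?andbF.
- split.
    apply/card_le1_eqP => w z; rewrite !inE => /andP[vw uw] /andP[vz uz].
    exact: nbr_matching vu vz vw uz uw.
  rewrite leqNgt; apply/negP => /card_gt2P[a [b [c [[aB bB cB] [ab bc ca]]]]].
  have adab := B2 a b aB bB ab.
  have adac : adj a c by apply: B2; rewrite // eq_sym.
  move: aB bB cB; rewrite !inE => /andP[va _] /andP[vb _] /andP[vc _].
  by rewrite (nbr_matching va vb vc adab adac) eqxx in bc.
- by move=> w; rewrite !inE => /andP[].
Qed.

Lemma triangle_arrows v u w : adj v u -> adj v w -> adj u w ->
  exists (C : {set arrow Q}) x y, [/\ three_cycle C, x \in C, y \in C &
    [/\ link x v u, link y v w & forall z a b, z \in C -> link z a b ->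
        a \in [:: v; u; w]]].
Proof.
move=> vu vw uw; have wv := vw; rewrite adjC in wv.
have [p [sp dp]] := adj_step vu; have [q [sq dq]] := adj_step uw.
have [r [sr dr]] := adj_step wv.
have lp := link_step p; have lq := link_step q; have lr := link_step r.
rewrite sp dp in lp; rewrite sq dq in lq; rewrite sr dr in lr.
exists [set:: [seq p.1 | p <- [:: p; q; r]]], p.1, r.1; split.
- exists [:: p; q; r]; split=> //; split=> //.
  + by rewrite /cycle /= dp dq dr sp sq sr !eqxx.
  + have pq : p.1 != q.1.
      apply: (link_neq (v := u) (u := v) (w := w)) => //; rewrite 1?link_sym //.
      exact: adj_neq.
    have pr : p.1 != r.1.
      apply: (link_neq (v := v) (u := u) (w := w)) => //; rewrite 1?link_sym //.
      exact: adj_neq.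
    have qr : q.1 != r.1.
      apply: (link_neq (v := w) (u := u) (w := v)) => //; rewrite 1?link_sym //.
      by rewrite eq_sym adj_neq.
    by rewrite /= !inE negb_or pq pr qr.
  + by rewrite /= sp sq sr !inE negb_or (adj_neq vu) (adj_neq vw) (adj_neq uw).
- by rewrite !inE eqxx.
- by rewrite !inE eqxx !orbT.
- split=> //; first by rewrite link_sym.
  move=> z a b; rewrite !inE => /or3P[]/eqP-> h.
  + by case: (link_cases h lp) => -[-> _]; rewrite !eqxx ?orbT.
  + by case: (link_cases h lq) => -[-> _]; rewrite !eqxx ?orbT.
  + by case: (link_cases h lr) => -[-> _]; rewrite !eqxx ?orbT.
Qed.

Lemma valency_le4 v : valency v <= 4.
Proof.
rewrite valencyE; case: (set_0Vmem (nbrs v)) => [->|[u]]; first by rewrite cards0.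
rewrite inE => /nbrs_split[A [B [-> _ [cA cB] _ _]]].
by rewrite cardsU1; have := (leq_card_setU A B).1; case: (_ \notin _); lia.
Qed.

Lemma nbrs4 v : valency v = 4 -> exists u w a b,
  [/\ nbrs v = [set u; w; a; b], adj u w, adj a b, uniq [:: u; w; a; b]
    & [/\ adj v u, adj v w, adj v a & adj v b]].
Proof.
rewrite valencyE => c4; case: (set_0Vmem (nbrs v)) => [e|[u]].
  by rewrite e cards0 in c4.
rewrite inE => vu; have [A [B [e [uA uB dis] [cA cB] hA hB]]] := nbrs_split vu.
have := c4; rewrite e cardsU1 cardsU (disjoint_setI0 dis) cards0 inE (negPf uA).
rewrite (negPf uB) subn0 /= => c.
have /cards1P[w eA] : #|A| == 1 by move: c; lia.
have /cards2P[a [b [ab eB]]] : #|B| == 2 by move: c; lia.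
have inN z : z \in nbrs v -> adj v z by rewrite inE.
move: uA uB dis hA hB; rewrite eA eB => uA uB dis hA hB.
exists u, w, a, b; split.
- by rewrite ?eA ?eB !setUA.
- by apply: hA; rewrite inE.
- by apply: hB; rewrite ?set21 ?set22.
- have wB : w \notin [set a; b] by rewrite (disjointFr dis) ?set11.
  move: uA uB wB; rewrite !inE !negb_or => uw /andP[ua ub] /andP[wa wb].
  by rewrite /= uw ua ub wa wb ab.
by split; apply: inN; rewrite e eA eB ?inE ?eqxx ?orbT.
Qed.

Lemma nbrs3 v : valency v = 3 -> exists u w a,
  [/\ nbrs v = [set u; w; a], adj u w, uniq [:: u; w; a]
    & [/\ adj v u, adj v w & adj v a]].
Proof.
rewrite valencyE => c3; case: (set_0Vmem (nbrs v)) => [e|[u]].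
  by rewrite e cards0 in c3.
rewrite inE => vu; have [A [B [e [uA uB dis] [cA cB] hA hB]]] := nbrs_split vu.
have := c3; rewrite e cardsU1 cardsU (disjoint_setI0 dis) cards0 inE (negPf uA).
rewrite (negPf uB) subn0 /= => c.
have inN z : z \in nbrs v -> adj v z by rewrite inE.
have [c1|c0] : #|A| = 1 /\ #|B| = 1 \/ #|A| = 0 /\ #|B| = 2 by move: c; lia.
  have /cards1P[w eA] : #|A| == 1 by rewrite c1.1.
  have /cards1P[a eB] : #|B| == 1 by rewrite c1.2.
  move: uA uB dis hA hB; rewrite eA eB => uA uB dis hA hB.
  exists u, w, a; split.
  - by rewrite ?eA ?eB !setUA.
  - by apply: hA; rewrite inE.
  - have wB : w \notin [set a] by rewrite (disjointFr dis) ?set11.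
    move: uA uB wB; rewrite !inE => uw ua wa.
    by rewrite /= ?inE ?negb_or uw ua wa.
  by split; apply: inN; rewrite e eA eB ?inE ?eqxx ?orbT.
have eA : A = set0 by apply/eqP; rewrite -cards_eq0 c0.1.
have /cards2P[a [b [ab eB]]] : #|B| == 2 by rewrite c0.2.
rewrite eB in uB hB.
exists a, b, u; split.
- by rewrite eA eB set0U setUC.
- by apply: hB; rewrite ?set21 ?set22.
- move: uB; rewrite !inE negb_or !(eq_sym u) => /andP[ua ub].
  by rewrite /= ?inE ?negb_or ab ua ub.
by split; apply: inN; rewrite e eA eB ?inE ?eqxx ?orbT.
Qed.

Lemma incident_cases v x : x \in incident v ->
  exists2 u, u \in nbrs v & link x v u.
Proof.
rewrite link_incident => /existsP[u xu]; exists u => //.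
by rewrite inE (link_adj xu).
Qed.

Lemma link_in_incident x v u : link x v u -> x \in incident v.
Proof. by move=> h; rewrite link_incident; apply/existsP; exists u. Qed.

Lemma MA_of_graph : connected_quiver Q -> MA_k #|V| Q.
Proof.
move=> conn; split=> //; split=> //.
- exact: triangles_cycles.
- exact: valency_le4.
- move=> v /nbrs4[u [w [a [b [eN uw ab un [vu vw va vb]]]]]].
  have [C1 [x [y [tC xC yC [xu yw hC]]]]] := triangle_arrows vu vw uw.
  have [C2 [x' [y' [tC' xC' yC' [xa yb hC']]]]] := triangle_arrows va vb ab.
  move: un; rewrite /= !inE !negb_or.
  case/and4P=> /and3P[nuw nua nub] /andP[nwa nwb] nab _.
  exists C1, C2, [set x; y], [set x'; y']; split; split=> //.
  + move=> e; rewrite e in xC; rewrite link_sym in xu.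
    have := hC' _ _ _ xC xu; rewrite !inE (negPf nua) (negPf nub) orbF.
    by rewrite eq_sym (negPf (adj_neq vu)).
  + apply/setP => z; rewrite !inE; apply/idP/idP => [|zi].
      have h t p : link t v p -> z == t -> (qtail z == v) || (qhead z == v).
        by move=> /link_in_incident + /eqP->; rewrite inE.
      by case/orP=> /orP[]; [exact: h xu|exact: h yw|exact: h xa|exact: h yb].
    have /incident_cases[p] : z \in incident v by rewrite inE.
    rewrite eN !inE => /orP[/orP[/orP[]|]|]/eqP-> h.
    * by rewrite (link_uniq h xu) eqxx.
    * by rewrite (link_uniq h yw) eqxx ?orbT.
    * by rewrite (link_uniq h xa) eqxx ?orbT.
    * by rewrite (link_uniq h yb) eqxx ?orbT.
  + have n1 := link_neq xu xa nua; have n2 := link_neq xu yb nub.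
    have n3 := link_neq yw xa nwa; have n4 := link_neq yw yb nwb.
    apply/pred0P => z; rewrite /= !inE; apply/negP => /andP[].
    by case/orP=> /eqP-> /orP[]/eqP e; rewrite e eqxx in n1 n2 n3 n4.
  + by rewrite !cards2 (link_neq xu yw nuw) (link_neq xa yb nab).
  + by apply/subsetP => z; rewrite !inE => /orP[]/eqP->.
  + by apply/subsetP => z; rewrite !inE => /orP[]/eqP->.
- move=> v /nbrs3[u [w [a [eN uw un [vu vw va]]]]].
  have [C1 [x [y [tC xC yC [xu yw hC]]]]] := triangle_arrows vu vw uw.
  have [t ta] := adjP _ _ va.
  move: un; rewrite /= !inE !negb_or => /and3P[/andP[nuw nua] nwa _].
  have n1 := link_neq xu ta nua; have n2 := link_neq yw ta nwa.
  exists C1, [set x; y], t; split.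
  + apply/setP => z; rewrite !inE; apply/idP/idP => [|zi].
      have h s p : link s v p -> z == s -> (qtail z == v) || (qhead z == v).
        by move=> /link_in_incident + /eqP->; rewrite inE.
      by case/or3P; [exact: h ta|exact: h xu|exact: h yw].
    have /incident_cases[p] : z \in incident v by rewrite inE.
    rewrite eN !inE => /orP[/orP[]|]/eqP-> h.
    * by rewrite (link_uniq h xu) eqxx ?orbT.
    * by rewrite (link_uniq h yw) eqxx ?orbT.
    * by rewrite (link_uniq h ta) eqxx ?orbT.
  + by rewrite !inE negb_or ![t == _]eq_sym n1 n2.
  + by rewrite cards2 (link_neq xu yw nuw).
  + by split=> //; apply/subsetP => z; rewrite !inE => /orP[]/eqP->.
  (* A 3-cycle through the third arrow would give its end a partner among the neighbours of v, but u
     and w are already matched to each other. *)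
  + move=> C' /three_cycle_vertices[p [q [r [[pq qr rp] h]]]]; apply/negP => tC'.
    have /andP[vin ain] := h _ _ _ tC' ta.
    have [_ [z [vz az]]] := clique3 pq qr rp vin ain (adj_neq va).
    have : z \in nbrs v by rewrite inE.
    rewrite adjC in az; rewrite eN !inE => /orP[/orP[]|]/eqP ez; subst z.
    * by rewrite (nbr_matching vu vw va uw az) eqxx in nwa.
    * rewrite adjC in uw.
      by rewrite (nbr_matching vw vu va uw az) eqxx in nua.
    * by rewrite adj_irr in az.
Qed.

Lemma simplicial_connecting v : simplicial v -> connecting_vertex v.
Proof.
move=> simp; split.
  rewrite valencyE leqNgt; apply/negP => /card_gt2P[a [b [c [[]]]]].
  rewrite !inE => va vb vc [ab bc ca].
  have adac : adj a c by apply: simp; rewrite // eq_sym.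
  by rewrite (nbr_matching va vb vc (simp _ _ va vb ab) adac) eqxx in bc.
rewrite valencyE => /eqP/cards2P[a [b [ab eN]]].
have inN z : z \in nbrs v -> adj v z by rewrite inE.
have va : adj v a by apply: inN; rewrite eN !inE eqxx.
have vb : adj v b by apply: inN; rewrite eN !inE eqxx orbT.
have [C [x [y [tC xC _ [xa _ _]]]]] := triangle_arrows va vb (simp _ _ va vb ab).
by exists C, x; split=> //; exact: link_in_incident xa.
Qed.

End ToMA.
End MAGraph.

Theorem MA_tree (Q : quiver) (v : vertex Q) k :
  (MA_k k Q /\ connecting_vertex v) <->
  (#|vertex Q| = k /\ exists t, tree_on setT v t).
Proof.
split=> [[mQ cv]|[<- [t ht]]].
  have [conn [cQ cyc _ _ _]] := mQ; split=> //.
  apply: tree_of_connected conn (connecting_simplicial cv).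
    exact: cycles_triangles.
  exact: MA_claw_free mQ.
have tri := tree_on_triangles ht; have claw := tree_on_claw_free ht.
split; first by apply: MA_of_graph => //; exact: tree_on_connected ht.
by apply: simplicial_connecting => //; exact: tree_on_simplicial ht.
Qed.

(** * Subquivers and components *)

Section Sub.

Variables (Q : quiver) (A : {set vertex Q}) (B : {set arrow Q}).
Local Notation R := (subquiver A B).
Local Notation incl := (@sub_incl Q A B).
Implicit Types (x y : vertex R) (t : tree (vertex Q)).

Lemma sub_incl_inj : injective incl.
Proof. exact: val_inj. Qed.

Lemma sub_incl_in x : incl x \in A.
Proof. exact: valP x. Qed.

Lemma sub_incl_surj (v : vertex Q) : v \in A -> exists x, incl x = v.
Proof. by move=> vA; exists (exist _ v vA). Qed.

Lemma narrows_sub x y : narrows x y =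
  #|[set a in B | (qtail a == incl x) && (qhead a == incl y)]|.
Proof.
rewrite /narrows -(card_imset _ (val_inj : injective (@sval _ _ : arrow R -> _))).
apply: eq_card => a; rewrite inE; apply/imsetP/andP.
  case=> b; rewrite !inE => /andP[/eqP/(congr1 incl) <- /eqP/(congr1 incl) <-] ->.
  by case/and3P: (valP b) => -> _ _; rewrite !eqxx.
case=> aB /andP[ta ha].
have hA : [&& a \in B, qtail a \in A & qhead a \in A].
  by rewrite aB (eqP ta) (eqP ha) !sub_incl_in.
exists (exist _ a hA : arrow R) => //.
by rewrite inE -!(inj_eq sub_incl_inj) ta ha.
Qed.

Lemma lift_tree t : {subset labels t <= A} ->
  exists t' : tree (vertex R), map_tree incl t' = t.
Proof.
elim: t => [|v l IHl r IHr] s; first by exists E.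
have [x ex] : exists x, incl x = v.
  by apply: sub_incl_surj; apply: s; rewrite /= inE eqxx.
have [l' el] : exists l', map_tree incl l' = l.
  by apply: IHl => y yl; apply: s; rewrite /= inE mem_cat yl orbT.
have [r' er] : exists r', map_tree incl r' = r.
  by apply: IHr => y yr; apply: s; rewrite /= inE mem_cat yr !orbT.
by exists (N x l' r'); rewrite /= ex el er.
Qed.

End Sub.

Lemma narrows_full (Q : quiver) (A : {set vertex Q})
    (x y : vertex (full_subquiver A)) :
  narrows x y = narrows (sub_incl x) (sub_incl y).
Proof. by rewrite narrows_sub; apply: eq_card => a; rewrite !inE. Qed.

Lemma bmat_full (Q : quiver) (A : {set vertex Q})
    (x y : vertex (full_subquiver A)) :
  bmat x y = bmat (sub_incl x) (sub_incl y).
Proof. by rewrite /bmat !narrows_full. Qed.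

Lemma tree_on_full (Q : quiver) (A : {set vertex Q}) (v : vertex (full_subquiver A)) :
  (exists t, tree_on setT v t) <-> (exists t, tree_on A (sub_incl v) t).
Proof.
have inj := @sub_incl_inj Q A [set: arrow Q]; split=> [] [t [rt ut lt bt]].
  exists (map_tree (@sub_incl Q A _) t); split.
  - by rewrite troot_map rt.
  - by rewrite labels_map map_inj_uniq.
  - move=> x; rewrite labels_map; apply/mapP/idP => [[y _ ->]|xA].
      exact: sub_incl_in.
    have [y ey] := sub_incl_surj [set: arrow Q] xA.
    by exists y => //; rewrite lt inE.
  - move=> x y xA yA; have [x' <-] := sub_incl_surj [set: arrow Q] xA.
    have [y' <-] := sub_incl_surj [set: arrow Q] yA.
    by rewrite tb_map // -bmat_full bt ?inE.
have [|t' et] := @lift_tree Q A [set: arrow Q] t; first by move=> x; rewrite lt.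
exists t'; rewrite -et in rt ut lt bt; split.
- by move: rt; rewrite troot_map; case: (troot t') => //= w [/inj->].
- by move: ut; rewrite labels_map map_inj_uniq.
- move=> x; rewrite inE -(mem_map inj) -labels_map lt; exact: sub_incl_in.
- move=> x y _ _; rewrite bmat_full bt ?tb_map //; exact: sub_incl_in.
Qed.

Lemma MA_component_tree (Q : quiver) (v : vertex Q) :
  MA_component v <-> exists t, tree_on (component v) v t.
Proof.
have H := @tree_on_full Q (component v) (component_base v).
split.
  case=> [[k _ mk] cv]; apply/H.
  by have [] : _ /\ exists t, tree_on setT (component_base v) t := (MA_tree _ k).1
    (conj mk cv).
move/H=> ht;
  have [mk cv] := (MA_tree (component_base v) #|vertex (component_quiver v)|).2
  (conj erefl ht).
split=> //; exists #|vertex (component_quiver v)| => //.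
by apply/card_gt0P; exists (component_base v).
Qed.

(** Since y ranges over all vertices, no arrow leaves the labels; they are closed under adjacency
    and connected along the tree, hence a whole component. *)
Lemma tree_component (Q : quiver) (v : vertex Q) (t : tree (vertex Q)) :
    troot t = Some v -> uniq (labels t) ->
    (forall x y, x \in labels t -> bmat x y = tb t x y) ->
  tree_on (component v) v t.
Proof.
move=> rt ut bt.
have cl x y : x \in labels t -> adjacent x y -> y \in labels t.
  by move=> xt; rewrite bmat_adj bt //; exact: tadj_in2.
have lt x : (x \in labels t) = (x \in component v).
  rewrite inE; apply/idP/idP => [xt|/connectP[s ps ->]].
    apply: connect_sub (tree_connected ut rt xt) => {xt}x y xy; apply: connect1.
    by rewrite bmat_adj bt //; exact: tadj_in xy.
  have: v \in labels t by apply: troot_in; rewrite rt.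
  elim: s v ps {rt} => //= y s IH v /andP[vy ys] vt.
  by apply: IH ys _; exact: cl vt vy.
by split=> // x y xS _; rewrite bt // lt.
Qed.

Section SubComponent.

Variables (Q : quiver) (A : {set vertex Q}) (B : {set arrow Q}).
Local Notation R := (subquiver A B).
Local Notation incl := (@sub_incl Q A B).

(** The tree is labelled by vertices of [Q] rather than of the subquiver, so that the trees of
    several components and the deleted vertices can be put into one [dtri]. *)
Definition component_tree (v : vertex R) (t : tree (vertex Q)) : Prop :=
  [/\ troot t = Some (incl v), uniq (labels t), {subset labels t <= A} &
      forall x y : vertex R, incl x \in labels t ->
        bmat x y = tb t (incl x) (incl y)].

Lemma component_tree_labels v t : component_tree v t ->
  forall x : vertex R, (incl x \in labels t) = (x \in component v).
Proof.
case=> rt ut st bt x; have inj := @sub_incl_inj Q A B.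
have [t' et] := lift_tree B st; rewrite -et in rt ut bt *.
rewrite labels_map mem_map //.
have [|||_ _ -> //] := @tree_component R v t'.
- by move: rt; rewrite troot_map; case: (troot t') => //= w [/inj->].
- by move: ut; rewrite labels_map map_inj_uniq.
by move=> y z yt; rewrite bt ?tb_map // labels_map map_f.
Qed.

Lemma component_treeP v : MA_component v <-> exists t, component_tree v t.
Proof.
have inj := @sub_incl_inj Q A B; split.
  case/MA_component_tree=> t [rt ut lt bt].
  exists (map_tree incl t); split.
  - by rewrite troot_map rt.
  - by rewrite labels_map map_inj_uniq.
  - by move=> x; rewrite labels_map => /mapP[y _ ->]; exact: sub_incl_in.
  - move=> x y; rewrite labels_map mem_map // tb_map // => xt.
    have [yt|yt] := boolP (y \in labels t); first by rewrite bt -?lt.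
    rewrite tb_out2 // bmat_nonadj //; apply: contra yt => xy.
    rewrite lt inE; rewrite lt inE in xt.
    exact: connect_trans xt (connect1 xy).
case=> t [rt ut st bt]; apply/MA_component_tree.
have [t' et] := lift_tree B st; rewrite -et in rt ut bt *.
exists t'; apply: tree_component.
- by move: rt; rewrite troot_map; case: (troot t') => //= w [/inj->].
- by move: ut; rewrite labels_map map_inj_uniq.
by move=> y z yt; rewrite bt ?tb_map // labels_map map_f.
Qed.

End SubComponent.

(** * Types I, II and III *)

Section Rows.

Variable V : eqType.
Implicit Types (a b x y : V) (l r : tree V).
Local Open Scope ring_scope.

Lemma row_dbl a b l r y : a != b -> a \notin labels l -> a \notin labels r ->
  cb (Dbl a b l r) a y = delta (troot l) y - delta (troot r) y.
Proof.
move=> ab al ar; rewrite /= !tb_out // /tri /arr delta_id.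
rewrite (delta_neq (troot_neq al)) (delta_neq (troot_neq ar)).
by rewrite (@delta_neq _ (Some b) a) ?(inj_eq Some_inj) 1?eq_sym //; ring.
Qed.

Lemma row_dbl2 a b l r y : a != b -> b \notin labels l -> b \notin labels r ->
  cb (Dbl a b l r) b y = delta (troot l) y - delta (troot r) y.
Proof.
move=> ab bl br; rewrite /= !tb_out // /tri /arr delta_id.
rewrite (delta_neq (troot_neq bl)) (delta_neq (troot_neq br)).
by rewrite (@delta_neq _ (Some a) b) ?(inj_eq Some_inj) //; ring.
Qed.

Lemma off_dbl a b l r x y : x != a -> x != b -> y != a -> y != b ->
  cb (Dbl a b l r) x y = arr (troot l) (troot r) x y + tb l x y + tb r x y.
Proof.
move=> xa xb ya yb; rewrite /= /tri /arr !delta_some ![a == _]eq_sym ![b == _]eq_sym.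
by rewrite (negPf xa) (negPf xb) (negPf ya) (negPf yb) /=; ring.
Qed.

Lemma row_cyc2 a b l r y : a != b -> a \notin labels l -> a \notin labels r ->
  cb (Cyc [:: (a, l); (b, r)]) a y = delta (troot r) y - delta (troot l) y.
Proof.
move=> ab al ar; rewrite /= !tb_out // /tri /arr delta_id.
rewrite (delta_neq (troot_neq al)) (delta_neq (troot_neq ar)).
by rewrite (@delta_neq _ (Some b) a) ?(inj_eq Some_inj) 1?eq_sym //; ring.
Qed.

Lemma row_cyc2' a b l r y : a != b -> b \notin labels l -> b \notin labels r ->
  cb (Cyc [:: (a, l); (b, r)]) b y = delta (troot l) y - delta (troot r) y.
Proof.
move=> ab bl br; rewrite /= !tb_out // /tri /arr delta_id.
rewrite (delta_neq (troot_neq bl)) (delta_neq (troot_neq br)).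
by rewrite (@delta_neq _ (Some a) b) ?(inj_eq Some_inj) //; ring.
Qed.

Lemma off_cyc2 a b l r x y : x != a -> x != b -> y != a -> y != b ->
  cb (Cyc [:: (a, l); (b, r)]) x y = tb l x y + tb r x y.
Proof.
move=> xa xb ya yb; rewrite /= /tri /arr !delta_some ![a == _]eq_sym ![b == _]eq_sym.
by rewrite (negPf xa) (negPf xb) (negPf ya) (negPf yb) /=; ring.
Qed.

End Rows.

Section TwoVertices.

Variable Q : quiver.
Local Notation V := (vertex Q).
Implicit Types (a b x y : V) (l r t : tree V).

Definition labels2 a b l r : Prop :=
  [/\ a != b, uniq (labels l), uniq (labels r),
      (forall x, (x \in labels l) || (x \in labels r) = (x != a) && (x != b))
    & forall x, x \in labels l -> x \notin labels r].

Lemma labels2_notin a b l r : labels2 a b l r ->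
  [/\ a \notin labels l, a \notin labels r, b \notin labels l & b \notin labels r].
Proof.
case=> _ _ _ cov _; have := cov a; have := cov b; rewrite !eqxx /= andbF.
by move=> /negbT + /negbT; rewrite !negb_or => /andP[bl br] /andP[al ar]; split.
Qed.

Lemma labels2P a b l r :
  (uniq [:: a, b & labels l ++ labels r] /\
     forall v, v \in [:: a, b & labels l ++ labels r]) <-> labels2 a b l r.
Proof.
split.
  case=> /= /and3P[]; rewrite inE !mem_cat !negb_or => /and3P[ab al ar] /andP[bl br].
  rewrite cat_uniq => /and3P[ul /hasPn lr ur] cov; split=> //.
    move=> x; have := cov x; rewrite !inE mem_cat.
    case: (x =P a) => [->|_] /=; first by rewrite (negPf al) (negPf ar).
    by case: (x =P b) => [->|_] /=; first by rewrite (negPf bl) (negPf br).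
  by move=> x xl; apply: contraL xl; exact: lr.
move=> h; have [al ar bl br] := labels2_notin h; case: h => ab ul ur cov lr.
split=> [|v]; last first.
  rewrite !inE mem_cat cov; case: (v == a) => //; by case: (v == b).
rewrite /= inE !mem_cat !negb_or ab al ar bl br cat_uniq ul ur !andbT /=.
by apply/hasPn => x xr; apply: contraL xr; exact: lr.
Qed.

Lemma bmat_two a b (X : dtri V) :
  (forall y, bmat a y = cb X a y) -> (forall y, bmat b y = cb X b y) ->
  (forall x y, x != a -> x != b -> y != a -> y != b -> bmat x y = cb X x y) ->
  @bmat Q =2 cb X.
Proof.
move=> ha hb h x y.
case: (x =P a) => [->//|/eqP xa]; case: (x =P b) => [->//|/eqP xb].
case: (y =P a) => [->|/eqP ya]; first by rewrite bmat_antisymm ha cb_antisymm opprK.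
case: (y =P b) => [->|/eqP yb]; first by rewrite bmat_antisymm hb cb_antisymm opprK.
exact: h.
Qed.

(** Separates the rows of a and b from the rest of the matrix, as the types do by deleting a and
    b. *)
Lemma realize_dbl a b l r : realize (Dbl a b l r) <->
  [/\ labels2 a b l r,
      forall y, bmat a y = (delta (troot l) y - delta (troot r) y)%R,
      forall y, bmat b y = (delta (troot l) y - delta (troot r) y)%R
    & forall x y, x != a -> x != b -> y != a -> y != b ->
      bmat x y = (arr (troot l) (troot r) x y + tb l x y + tb r x y)%R].
Proof.
split.
  case=> u _ cov bX; have L : labels2 a b l r by apply/labels2P.
  have [al ar bl br] := labels2_notin L; have [ab _ _ _ _] := L.
  by split=> // *; rewrite bX ?row_dbl ?row_dbl2 ?off_dbl.
case=> L ha hb h; have [u cov] := (labels2P _ _ _ _).2 L.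
have [al ar bl br] := labels2_notin L; have [ab _ _ _ _] := L.
split=> //; apply: (@bmat_two a b) => *.
- by rewrite ha row_dbl.
- by rewrite hb row_dbl2.
- by rewrite h ?off_dbl.
Qed.

Lemma realize_cyc2 a b l r : realize (Cyc [:: (a, l); (b, r)]) <->
  [/\ labels2 a b l r,
      forall y, bmat a y = (delta (troot r) y - delta (troot l) y)%R,
      forall y, bmat b y = (delta (troot l) y - delta (troot r) y)%R
    & forall x y, x != a -> x != b -> y != a -> y != b ->
      bmat x y = (tb l x y + tb r x y)%R].
Proof.
have pm : perm_eq (dlabels (Cyc [:: (a, l); (b, r)])) [:: a, b & labels l ++ labels r].
  apply/permP => p; rewrite /dlabels !slabels_cons /= !count_cat /= !count_cat.
  by rewrite /slabels /=; lia.
split.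
  case=> u _ cov bX; have L : labels2 a b l r.
    by apply/labels2P; rewrite -(perm_uniq pm); split=> // v; rewrite -(perm_mem pm).
  have [al ar bl br] := labels2_notin L; have [ab _ _ _ _] := L.
  by split=> // *; rewrite bX ?row_cyc2 ?row_cyc2' ?off_cyc2.
case=> L ha hb h; have [u cov] := (labels2P _ _ _ _).2 L.
have [al ar bl br] := labels2_notin L; have [ab _ _ _ _] := L.
split.
- by rewrite (perm_uniq pm).
- by [].
- by move=> v; rewrite (perm_mem pm).
apply: (@bmat_two a b) => *.
- by rewrite ha row_cyc2.
- by rewrite hb row_cyc2'.
- by rewrite h ?off_cyc2.
Qed.

Definition sign (e : int) : Prop := e = 1%R \/ e = (- 1)%R.

(** Type I in matrix form. The signs record the directions of the arrows at the leaves, 1 for an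
    arrow towards c. *)
Definition forked a b c t (ea eb : int) : Prop :=
  [/\ a != b, tree_on (~: [set a; b]) c t, sign ea, sign eb
    & forall y, bmat a y = (ea * delta (Some c) y)%R /\
                bmat b y = (eb * delta (Some c) y)%R].

Lemma nbrs_bmat a y : (y \in nbrs a) = (bmat a y != 0%R).
Proof. by rewrite inE bmat_adj. Qed.

Lemma leaf_row a c : valency a = 1 -> narrows a c + narrows c a = 1 ->
  exists2 e, sign e & forall y, bmat a y = (e * delta (Some c) y)%R.
Proof.
rewrite valencyE => /eqP/cards1P[w ew] h.
have : c \in nbrs a by rewrite nbrs_bmat /bmat; case: (narrows_anti a c); lia.
rewrite ew inE => /eqP ecw; subst w; exists (bmat a c).
  by rewrite /sign /bmat; case: (narrows_anti a c); lia.
move=> y; rewrite delta_some; case: (c =P y) => [->|/eqP cy]; first by rewrite mulr1.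
rewrite mulr0; apply/eqP/negPn; rewrite -nbrs_bmat ew inE eq_sym //.
Qed.

Lemma row_leaf a c e : sign e ->
  (forall y, bmat a y = (e * delta (Some c) y)%R) ->
  valency a = 1 /\ narrows a c + narrows c a = 1.
Proof.
move=> se h; split.
  rewrite valencyE; apply/eqP/cards1P; exists c; apply/setP => y.
  rewrite nbrs_bmat h inE delta_some (eq_sym y).
  by case: se => ->; case: (c == y).
have := h c; rewrite delta_id mulr1 /bmat; case: se => ->;
by case: (narrows_anti a c); lia.
Qed.

Lemma type_IP : type_I #|V| Q <->
  exists a b c t ea eb, forked a b c t ea eb.
Proof.
split.
  case=> a [b [c [/eqP ab [va vb] [na nb] mk cv]]].
  have [_ ht] := (MA_tree c _).1 (conj mk cv).
  have [t ht'] := (tree_on_full c).1 ht.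
  have [ea sa ra] := leaf_row va na; have [eb sb rb] := leaf_row vb nb.
  by exists a, b, (sub_incl c), t, ea, eb; split.
case=> a [b [c [t [ea [eb [ab ht sa sb rows]]]]]].
have cA : c \in ~: [set a; b].
  by case: ht => rt _ <- _; rewrite troot_in // rt.
have [c' ec] := sub_incl_surj [set: arrow Q] cA; subst c.
exists a, b, c'.
have [va na] := row_leaf sa (fun y => (rows y).1).
have [vb nb] := row_leaf sb (fun y => (rows y).2).
have cR : #|vertex (delete_vertices [set a; b])| = #|V| - 2.
  have := cardsCs (~: [set a; b]); rewrite setCK cards2 ab /= => <-.
  by rewrite card_sig; apply: eq_card => x; rewrite inE.
have [mk cv] := (MA_tree c' _).2 (conj cR
  ((tree_on_full c').2 (ex_intro _ t ht))).
by split=> //; exact/eqP.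
Qed.

Lemma labels2_leaf_left a b c t : a != b -> tree_on (~: [set a; b]) c t ->
  labels2 a b t E.
Proof.
move=> ab [rt ut lt _]; split=> // x; by rewrite orbF lt !inE negb_or.
Qed.

Lemma labels2_leaf_right a b c t : a != b -> tree_on (~: [set a; b]) c t ->
  labels2 a b E t.
Proof.
by move=> ab [rt ut lt _]; split=> // x; rewrite /= lt !inE negb_or.
Qed.

(** Leaves with equal directions come from a tagged pair, leaves with opposite directions from two
    radii. In both cases one tree is empty, and [ea] decides which. *)
Lemma forked_realize a b c t ea eb : forked a b c t ea eb ->
  exists X : dtri V, realize X.
Proof.
case=> ab ht sa sb rows; have [rt ut lt bt] := ht.
have off x y : x != a -> x != b -> y != a -> y != b -> bmat x y = tb t x y.
  by move=> xa xb ya yb; rewrite bt // !inE !negb_or ?xa ?xb ?ya ?yb.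
case: sa sb rows => -> [] -> rows.
- exists (Dbl a b t E); apply/realize_dbl; split.
  + exact: labels2_leaf_left ht.
  + by move=> y; rewrite (rows y).1 rt delta_None; ring.
  + by move=> y; rewrite (rows y).2 rt delta_None; ring.
  + by move=> x y xa xb ya yb; rewrite off // /arr /= !delta_None; ring.
- exists (Cyc [:: (a, E); (b, t)]); apply/realize_cyc2; split.
  + exact: labels2_leaf_right ht.
  + by move=> y; rewrite (rows y).1 rt delta_None; ring.
  + by move=> y; rewrite (rows y).2 rt delta_None; ring.
  + by move=> x y xa xb ya yb; rewrite off //=; ring.
- exists (Cyc [:: (a, t); (b, E)]); apply/realize_cyc2; split.
  + exact: labels2_leaf_left ht.
  + by move=> y; rewrite (rows y).1 rt delta_None; ring.
  + by move=> y; rewrite (rows y).2 rt delta_None; ring.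
  + by move=> x y xa xb ya yb; rewrite off //=; ring.
- exists (Dbl a b E t); apply/realize_dbl; split.
  + exact: labels2_leaf_right ht.
  + by move=> y; rewrite (rows y).1 rt delta_None; ring.
  + by move=> y; rewrite (rows y).2 rt delta_None; ring.
  + by move=> x y xa xb ya yb; rewrite off // /arr /= !delta_None; ring.
Qed.

(** With at least four vertices the trees are not both empty, so the other one has a root, which is
    c. *)
Lemma realize_dbl_leaf a b l r : 4 <= #|V| -> realize (Dbl a b l r) ->
  (l = E \/ r = E) -> exists a b c t ea eb, forked a b c t ea eb.
Proof.
move=> n4 rX; have /realize_dbl[[ab ul ur cov lr] ra rb off] := rX.
case=> e; subst.
  have [c rt] : exists c, troot r = Some c.
    have := size_dlabels rX; case: (r) => [e|c r1 r2 _]; last by exists c.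
    by rewrite -e in n4.
  exists a, b, c, r, (-1)%R, (-1)%R; split=> //; try (by right).
    split=> // [x|x y]; first by rewrite !inE negb_or -cov.
    rewrite !inE !negb_or => /andP[xa xb] /andP[ya yb];
      rewrite off // /arr /= !delta_None; ring.
  by move=> y; rewrite ra rb rt delta_None; split; ring.
have [c rt] : exists c, troot l = Some c.
  have := size_dlabels rX; case: (l) => [e|c r1 r2 _]; last by exists c.
  by rewrite -e in n4.
exists a, b, c, l, 1%R, 1%R; split=> //; try (by left).
  split=> // [x|x y]; first by rewrite !inE negb_or -cov orbF.
  rewrite !inE !negb_or => /andP[xa xb] /andP[ya yb];
    rewrite off // /arr /= !delta_None; ring.
by move=> y; rewrite ra rb rt delta_None; split; ring.
Qed.

Lemma realize_cyc2_leaf a b l r : 4 <= #|V| -> realize (Cyc [:: (a, l); (b, r)]) ->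
  (l = E \/ r = E) -> exists a b c t ea eb, forked a b c t ea eb.
Proof.
move=> n4 rX; have /realize_cyc2[[ab ul ur cov lr] ra rb off] := rX.
have sX := size_dlabels rX.
case=> e; subst.
  have [c rt] : exists c, troot r = Some c.
    by move: sX n4; case: (r) => [<-|c r1 r2 _ _] //; exists c.
  exists a, b, c, r, 1%R, (-1)%R; split=> //; [|by left|by right|].
    split=> // [x|x y]; first by rewrite !inE negb_or -cov.
    rewrite !inE !negb_or => /andP[xa xb] /andP[ya yb]; rewrite off //=; ring.
  by move=> y; rewrite ra rb rt delta_None; split; ring.
have [c rt] : exists c, troot l = Some c.
  by move: sX n4; case: (l) => [<-|c r1 r2 _ _] //; exists c.
exists a, b, c, l, (-1)%R, 1%R; split=> //; [|by right|by left|].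
  split=> // [x|x y]; first by rewrite !inE negb_or -cov orbF.
  rewrite !inE !negb_or => /andP[xa xb] /andP[ya yb]; rewrite off //=; ring.
by move=> y; rewrite ra rb rt delta_None; split; ring.
Qed.

End TwoVertices.

Lemma component_eq (Q : quiver) (u v x : vertex Q) :
  x \in component u -> x \in component v -> component u = component v.
Proof.
rewrite !inE => ux vx; apply/setP => y; rewrite !inE.
have sc := sym_connect_sym (@adjC Q).
by rewrite (same_connect sc ux) (same_connect sc vx).
Qed.

Section TwoComponents.

Variables (Q : quiver) (A : {set vertex Q}) (B : {set arrow Q}).
Local Notation R := (subquiver A B).
Local Notation incl := (@sub_incl Q A B).

Lemma two_componentsP (c d : vertex R) : two_MA_components c d <->
  exists tc td, [/\ component_tree c tc, component_tree d td,
    forall x, (x \in labels tc) || (x \in labels td) = (x \in A),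
    forall x, x \in labels tc -> x \notin labels td
    & forall x y : vertex R,
      bmat x y = (tb tc (incl x) (incl y) + tb td (incl x) (incl y))%R].
Proof.
split.
  case=> ncd cov /component_treeP[tc hc] /component_treeP[td hd].
  exists tc, td.
  have lc := component_tree_labels hc; have ld := component_tree_labels hd.
  have [_ _ sc bc] := hc; have [_ _ sd bd] := hd.
  have dis x : x \in labels tc -> x \notin labels td.
    move=> xc; apply/negP => xd; case: ncd.
    have [x' ex] := sub_incl_surj B (sc _ xc); subst x.
    by apply: (@component_eq _ _ _ x'); rewrite -?lc -?ld.
  have cov' x : (x \in labels tc) || (x \in labels td) = (x \in A).
    apply/orP/idP => [[/sc|/sd]//|xA]; have [x' ex] := sub_incl_surj B xA.
    by apply/orP; rewrite -ex lc ld -in_setU cov inE.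
  split=> // x y; have := sub_incl_in x; rewrite -cov' => /orP[xc|xd].
    by rewrite bc // (tb_out _ (dis _ xc)) addr0.
  rewrite bd // (@tb_out _ tc) ?add0r //.
  by apply/negP => /dis; rewrite xd.
case=> tc [td [hc hd cov dis _]].
have lc := component_tree_labels hc; have ld := component_tree_labels hd.
split; last 2 first.
- by apply/component_treeP; exists tc.
- by apply/component_treeP; exists td.
- move=> e; have cc := component_refl c.
  have := cc; rewrite -lc => /dis; rewrite ld -e cc //.
- by apply/setP => x; rewrite in_setU -lc -ld cov sub_incl_in inE.
Qed.

Lemma two_components_intro (c d : vertex R) tc td :
    troot tc = Some (incl c) -> troot td = Some (incl d) ->
    uniq (labels tc) -> uniq (labels td) ->
    (forall x, (x \in labels tc) || (x \in labels td) = (x \in A)) ->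
    (forall x, x \in labels tc -> x \notin labels td) ->
    (forall x y : vertex R,
      bmat x y = (tb tc (incl x) (incl y) + tb td (incl x) (incl y))%R) ->
  two_MA_components c d.
Proof.
move=> rc rd uc ud cov dis br; apply/two_componentsP; exists tc, td; split=> //.
- split=> // [x xc|x y xc]; first by rewrite -cov xc.
  by rewrite br (tb_out _ (dis _ xc)) addr0.
- split=> // [x xd|x y xd]; first by rewrite -cov xd orbT.
  by rewrite br (@tb_out _ tc) ?add0r //; apply/negP => /dis; rewrite xd.
Qed.

End TwoComponents.

(** In Type II the arrow d -> c is the side of the enclosing triangle joining the roots of the two
    trees. It belongs to neither tree, so it is taken out before the components are formed. *)
Lemma bmat_cut (Q : quiver) (A : {set vertex Q}) (c d : vertex Q)
    (dc := [set z : arrow Q | (qtail z == d) && (qhead z == c)])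
    (x y : vertex (subquiver A (~: dc))) :
  c != d -> narrows d c = 1 ->
  bmat x y = (bmat (sub_incl x) (sub_incl y)
    - arr (Some d) (Some c) (sub_incl x) (sub_incl y))%R.
Proof.
move=> cd n_dc; rewrite /bmat !narrows_sub.
move: (sub_incl x) (sub_incl y) => u v.
have nE (p q : vertex Q) : #|[set z in ~: dc | (qtail z == p) && (qhead z == q)]| =
    if (p == d) && (q == c) then 0 else narrows p q.
  case: ifP => [/andP[/eqP-> /eqP->]|h].
    by apply/eqP; rewrite cards_eq0; apply/eqP/setP => z; rewrite !inE andNb.
  apply: eq_card => z; rewrite !inE.
  case: (qtail z =P p) => [->|_]; last by rewrite andbF.
  by case: (qhead z =P q) => [->|_]; rewrite ?h ?eqxx ?andbF.
rewrite !nE /arr !delta_some !(eq_sym d) !(eq_sym c).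
have dc' : (d == c) = false by rewrite eq_sym (negPf cd).
case: (u =P d) => [->|_] /=; case: (v =P d) => [->|_] /=; rewrite ?dc' /=.
- by rewrite narrows_loop; ring.
- by case: (v =P c) => [->|_]; rewrite ?n_dc; lia.
- by case: (u =P c) => [->|_]; rewrite ?n_dc; lia.
- by rewrite !mul0r; ring.
Qed.

Lemma uniq4 (T : eqType) (a b c d : T) : uniq [:: a; b; c; d] ->
  ((a == b) = false) * ((a == c) = false) * ((a == d) = false) *
  ((b == c) = false) * ((b == d) = false) * ((c == d) = false) *
  ((b == a) = false) * ((c == a) = false) * ((d == a) = false) *
  ((c == b) = false) * ((d == b) = false) * ((d == c) = false).
Proof.
rewrite /= !inE !negb_or andbT => /and3P[/and3P[/negPf ab /negPf ac /negPf ad]].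
move=> /andP[/negPf bc /negPf bd] /negPf cd.
rewrite [b == a]eq_sym [c == a]eq_sym [d == a]eq_sym [c == b]eq_sym.
by rewrite [d == b]eq_sym [d == c]eq_sym ab ac ad bc bd cd.
Qed.

Section TwoVertices.

Variable Q : quiver.
Local Notation V := (vertex Q).
Implicit Types (a b c d x y : V) (l r t : tree V).
Local Notation adj := (@adjacent Q).

Lemma full_on_row a c d (v : V) : valency a = 2 -> c != d ->
  adj a c -> adj a d -> (adj a v) = (v == c) || (v == d).
Proof.
move=> va cd ac ad; have sub : [set c; d] \subset nbrs a.
  by apply/subsetP => x; rewrite !inE => /orP[]/eqP->.
have e : [set c; d] = nbrs a.
  by apply/eqP; rewrite eqEcard sub cards2 cd -valencyE va.
by rewrite -in_set2 e inE.
Qed.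

Lemma valency2_row a c d : c != d ->
  (forall y, bmat a y = (delta (Some d) y - delta (Some c) y)%R) -> valency a = 2.
Proof.
move=> cd h; rewrite valencyE; apply/eqP/cards2P; exists c, d; split=> //.
apply/setP => y; rewrite nbrs_bmat h !inE !delta_some !(eq_sym y).
case: (c =P y) => [<-|_]; first by rewrite [d == c]eq_sym (negPf cd).
by case: (d == y).
Qed.

Lemma row_of_valency2 a c d : valency a = 2 -> c != d ->
  narrows c a = 1 -> narrows a d = 1 ->
  forall y, bmat a y = (delta (Some d) y - delta (Some c) y)%R.
Proof.
move=> va cd ca ad y.
have adc : adj a c by rewrite /adjacent /= ca orbT.
have add : adj a d by rewrite /adjacent /= ad.
have ac : narrows a c = 0 by case: (narrows_anti c a) => //; rewrite ca.
have da : narrows d a = 0 by case: (narrows_anti a d) => //; rewrite ad.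
have := full_on_row y va cd adc add; rewrite !delta_some !(eq_sym _ y).
case: (y =P c) => [->|/eqP yc].
  by rewrite /bmat (negPf cd) ca ac.
case: (y =P d) => [->|/eqP yd] /=.
  by rewrite /bmat ad da.
by move=> /negbT/bmat_nonadj->.
Qed.

Lemma type_IIP : type_II Q <->
  exists a b l r, [/\ l <> E, r <> E & realize (Dbl a b l r)].
Proof.
split.
  case=> a [b [c [d [[un cnt] va vb [c' [d' [ec ed]]]]]]].
  case/two_componentsP=> tc [td [[rc uc sc bc] [rd ud sd bd] cov dis br]].
  rewrite ec in rc; rewrite ed in rd.
  (* The tree at d comes first because the arrow d -> c runs from the root of the left tree to that
     of the right one. *)
  exists a, b, td, tc; split; [by case: td rd {sd bd ud br cov dis}|
    by case: tc rc {sc bc uc br cov dis}|].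
  have n4 := uniq4 un.
  have cn x y : x \in [:: a; b; c; d] -> y \in [:: a; b; c; d] ->
    narrows x y = count_mem (x, y) [:: (d, c); (c, a); (c, b); (a, d); (b, d)]
    by exact: cnt.
  have cd : c != d by rewrite n4.
  have rowa : forall y, bmat a y = (delta (Some d) y - delta (Some c) y)%R.
    by apply: row_of_valency2; rewrite // cn ?inE ?eqxx ?orbT //= !xpair_eqE !eqxx !n4.
  have rowb : forall y, bmat b y = (delta (Some d) y - delta (Some c) y)%R.
    by apply: row_of_valency2; rewrite // cn ?inE ?eqxx ?orbT //= !xpair_eqE !eqxx !n4.
  apply/realize_dbl; rewrite rc rd; split=> //.
    split=> //; first by rewrite n4.
      by move=> x; rewrite orbC cov !inE negb_or.
    by move=> x xd; apply: contraL xd; exact: dis.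
  move=> x y xa xb ya yb.
  have xA : x \in ~: [set a; b] by rewrite !inE negb_or xa xb.
  have yA : y \in ~: [set a; b] by rewrite !inE negb_or ya yb.
  pose dc := [set z : arrow Q | (qtail z == d) && (qhead z == c)].
  have [x' ex] := sub_incl_surj (~: dc) xA.
  have [y' ey] := sub_incl_surj (~: dc) yA.
  have n_dc : narrows d c = 1.
    by rewrite cn ?inE ?eqxx ?orbT //= !xpair_eqE !eqxx !n4.
  have := br x' y'; rewrite bmat_cut // ex ey => e.
  by rewrite -addrA [(tb td x y + _)%R]addrC -e; ring.
case=> a [b [[|d l1 l2] [[|c r1 r2] [nl nr]]]] //.
case/realize_dbl; set l := N d l1 l2; set r := N c r1 r2.
rewrite -[troot l]/(Some d) -[troot r]/(Some c) => [[ab ul ur cov lr]] ra rb off.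
have dl : d \in labels l by rewrite /= inE eqxx.
have cr : c \in labels r by rewrite /= inE eqxx.
have [da db] : d != a /\ d != b by apply/andP; rewrite -cov dl.
have [ca cb] : c != a /\ c != b by apply/andP; rewrite -cov cr orbT.
have cd : c != d by apply: contraTneq cr => ->; exact: lr.
have un : uniq [:: a; b; c; d].
  by rewrite /= !inE !negb_or ab cd ![_ == c]eq_sym ca cb ![_ == d]eq_sym da db.
have n4 := uniq4 un.
have vab : (bmat a b = 0)%R by rewrite ra !delta_some !n4.
have [vca vcb vad vbd vdc] : [/\ bmat c a = 1, bmat c b = 1, bmat a d = 1,
    bmat b d = 1 & bmat d c = 1]%R.
  split.
  - by rewrite bmat_antisymm ra !delta_some !n4 eqxx.
  - by rewrite bmat_antisymm rb !delta_some !n4 eqxx.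
  - by rewrite ra !delta_some !n4 eqxx.
  - by rewrite rb !delta_some !n4 eqxx.
  - rewrite off ?n4 // (tb_out _ (lr d dl)) (@tb_out2 _ l) ?addr0; last first.
      by apply/negP => /lr; rewrite cr.
    by rewrite /arr !delta_some !n4 !eqxx.
exists a, b, c, d; split.
- split=> // x y; rewrite !inE => xs ys; apply/eqP.
  rewrite -eqz_nat -bmat_pos.
  case/or4P: xs => /eqP->; case/or4P: ys => /eqP->;
    rewrite /= !xpair_eqE ?eqxx ?n4 /=;
    rewrite ?vab ?vca ?vcb ?vad ?vbd ?vdc
      ?[bmat b a]bmat_antisymm ?[bmat a c]bmat_antisymm ?[bmat b c]bmat_antisymm
      ?[bmat d a]bmat_antisymm ?[bmat d b]bmat_antisymm ?[bmat c d]bmat_antisymm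
      ?vab ?vca ?vcb ?vad ?vbd ?vdc //;
    by rewrite /bmat narrows_loop.
- exact: valency2_row ra.
- exact: valency2_row rb.
have cA : c \in ~: [set a; b] by rewrite !inE negb_or ca cb.
have dA : d \in ~: [set a; b] by rewrite !inE negb_or da db.
move=> dc.
have [c' ec] := sub_incl_surj (~: dc) cA; have [d' ed] := sub_incl_surj (~: dc) dA.
have n_dc : narrows d c = 1.
  by have := bmat_pos d c; rewrite vdc => -[<-].
exists c', d'; split=> //.
apply: (@two_components_intro _ _ _ _ _ r l) => //.
- by rewrite ec.
- by rewrite ed.
- by move=> x; rewrite orbC cov !inE negb_or.
- by move=> x xr; apply: contraL xr; exact: lr.
move=> x y; rewrite bmat_cut //.
have /setCP := sub_incl_in x; have /setCP := sub_incl_in y.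
rewrite !inE => /negP; rewrite negb_or => /andP[ya yb].
move=> /negP; rewrite negb_or => /andP[xa xb].
by rewrite off //; ring.
Qed.

Lemma type_IIIP : type_III Q <->
  exists a b l r, [/\ l <> E, r <> E & realize (Cyc [:: (a, l); (b, r)])].
Proof.
split.
  case=> a [b [c [d [[un cnt] va vb [c' [d' [ec ed]]]]]]].
  case/two_componentsP=> tc [td [[rc uc sc bc] [rd ud sd bd] cov dis br]].
  rewrite ec in rc; rewrite ed in rd.
  exists a, b, tc, td; split; [by case: tc rc {sc bc uc br cov dis}|
    by case: td rd {sd bd ud br cov dis}|].
  have n4 := uniq4 un.
  have cn x y : x \in [:: a; b; c; d] -> y \in [:: a; b; c; d] ->
    narrows x y = count_mem (x, y) [:: (c, a); (a, d); (d, b); (b, c)]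
    by exact: cnt.
  have cd : c != d by rewrite n4.
  have dc : d != c by rewrite n4.
  have rowa : forall y, bmat a y = (delta (Some d) y - delta (Some c) y)%R.
    by apply: row_of_valency2; rewrite // cn ?inE ?eqxx ?orbT //= !xpair_eqE !eqxx !n4.
  have rowb : forall y, bmat b y = (delta (Some c) y - delta (Some d) y)%R.
    by apply: row_of_valency2; rewrite // cn ?inE ?eqxx ?orbT //= !xpair_eqE !eqxx !n4.
  apply/realize_cyc2; rewrite rc rd; split=> //.
    split=> //; first by rewrite n4.
    by move=> x; rewrite cov !inE negb_or.
  move=> x y xa xb ya yb.
  have xA : x \in ~: [set a; b] by rewrite !inE negb_or xa xb.
  have yA : y \in ~: [set a; b] by rewrite !inE negb_or ya yb.
  have [x' ex] := sub_incl_surj [set: arrow Q] xA.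
  have [y' ey] := sub_incl_surj [set: arrow Q] yA.
  by have := br x' y'; rewrite bmat_full ex ey.
case=> a [b [[|c l1 l2] [[|d r1 r2] [nl nr]]]] //.
case/realize_cyc2; set l := N c l1 l2; set r := N d r1 r2.
rewrite -[troot l]/(Some c) -[troot r]/(Some d) => [[ab ul ur cov lr]] ra rb off.
have cl : c \in labels l by rewrite /= inE eqxx.
have dr : d \in labels r by rewrite /= inE eqxx.
have [ca cb] : c != a /\ c != b by apply/andP; rewrite -cov cl.
have [da db] : d != a /\ d != b by apply/andP; rewrite -cov dr orbT.
have cd : c != d by apply: contraTneq dr => <-; exact: lr.
have dc : d != c by rewrite eq_sym.
have un : uniq [:: a; b; c; d].
  by rewrite /= !inE !negb_or ab cd ![_ == c]eq_sym ca cb ![_ == d]eq_sym da db.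
have n4 := uniq4 un.
have vab : (bmat a b = 0)%R by rewrite ra !delta_some !n4.
have [vca vad vdb vbc vcd] : [/\ bmat c a = 1, bmat a d = 1, bmat d b = 1,
    bmat b c = 1 & bmat c d = 0]%R.
  split.
  - by rewrite bmat_antisymm ra !delta_some !n4 eqxx.
  - by rewrite ra !delta_some !n4 eqxx.
  - by rewrite bmat_antisymm rb !delta_some !n4 eqxx.
  - by rewrite rb !delta_some !n4 eqxx.
  - rewrite off ?n4 // (@tb_out2 _ l) ?(@tb_out _ r) ?lr //.
    by apply/negP => /lr; rewrite dr.
exists a, b, c, d; split.
- split=> // x y; rewrite !inE => xs ys; apply/eqP.
  rewrite -eqz_nat -bmat_pos.
  case/or4P: xs => /eqP->; case/or4P: ys => /eqP->;
    rewrite /= !xpair_eqE ?eqxx ?n4 /=;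
    rewrite ?vab ?vca ?vad ?vdb ?vbc ?vcd
      ?[bmat b a]bmat_antisymm ?[bmat a c]bmat_antisymm ?[bmat d a]bmat_antisymm
      ?[bmat b d]bmat_antisymm ?[bmat c b]bmat_antisymm ?[bmat d c]bmat_antisymm
      ?vab ?vca ?vad ?vdb ?vbc ?vcd //;
    by rewrite /bmat narrows_loop.
- exact: valency2_row ra.
- exact: valency2_row rb.
have cA : c \in ~: [set a; b] by rewrite !inE negb_or ca cb.
have dA : d \in ~: [set a; b] by rewrite !inE negb_or da db.
have [c' ec] := sub_incl_surj [set: arrow Q] cA.
have [d' ed] := sub_incl_surj [set: arrow Q] dA.
exists c', d'; split=> //.
apply: (@two_components_intro _ _ _ _ _ l r) => //.
- by rewrite ec.
- by rewrite ed.
- by move=> x; rewrite cov !inE negb_or.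
move=> x y; rewrite bmat_full.
have /setCP := sub_incl_in x; have /setCP := sub_incl_in y.
rewrite !inE => /negP; rewrite negb_or => /andP[ya yb].
move=> /negP; rewrite negb_or => /andP[xa xb].
by rewrite off.
Qed.

End TwoVertices.

(** * Type IV *)

Section WheelMatrix.

Variable V : eqType.
Implicit Types (a b e x y : V) (p : seq V) (tr : V -> tree V).

(** The trees are given as a function of the radius, which suits the cyclic [next] and [prev]; its
    values outside p do not matter. *)
Definition spikes p tr : seq (V * tree V) := [seq (a, tr a) | a <- p].

Definition wheel_labels p tr : Prop :=
  [/\ uniq p, {in p, forall a, uniq (labels (tr a))},
      {in p &, forall a b, b \notin labels (tr a)}
    & {in p &, forall a b, a != b ->
         forall x, x \in labels (tr a) -> x \notin labels (tr b)}].

Lemma spikes_cons a p tr : spikes (a :: p) tr = (a, tr a) :: spikes p tr.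
Proof. by []. Qed.

Lemma mem_slabels p tr x : reflect (x \in p \/ exists2 a, a \in p & x \in labels (tr a))
  (x \in slabels (spikes p tr)).
Proof.
elim: p => [|a p IH]; first by constructor; case=> // -[].
rewrite spikes_cons slabels_cons [x \in _ :: _ ++ _]inE mem_cat /=.
apply: (iffP or3P).
  case=> [/eqP->|xa|/IH[xp|[b bp xb]]].
  - by left; rewrite inE eqxx.
  - by right; exists a; rewrite // inE eqxx.
  - by left; rewrite inE xp orbT.
  - by right; exists b; rewrite // inE bp orbT.
case=> [|[b]]; rewrite inE.
  case/predU1P=> [->|xp]; first by constructor 1.
  by constructor 3; apply/IH; left.
case/predU1P=> [->|bp] xb; first by constructor 2.
by constructor 3; apply/IH; right; exists b.
Qed.

Lemma uniq_slabels p tr : uniq (slabels (spikes p tr)) <-> wheel_labels p tr.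
Proof.
elim: p => [|a p IH]; first by split.
rewrite spikes_cons slabels_cons /= mem_cat negb_or cat_uniq; split.
  case/and3P=> [/andP[aa ap] ua /andP[/hasPn ap' /IH[up ut np dp]]].
  have nap : a \notin p by apply: contra ap => h; apply/mem_slabels; left.
  have ab b : b \in p -> b != a by move=> h; apply: contraNneq nap => <-.
  have dis b x : b \in p -> x \in labels (tr a) -> x \notin labels (tr b).
    move=> bp xa; apply/negP => xb; have := ap' x.
    rewrite /= xa; case/(_ _)/negP => //; apply/mem_slabels; right.
    by exists b.
  split.
  - by rewrite /= nap.
  - by move=> b; rewrite inE => /predU1P[->|/ut].
  - move=> b c; rewrite !inE => /predU1P[->|bp] /predU1P[->|cp] //.
    + apply/negP => ca; have := ap' c; rewrite /= ca; case/(_ _)/negP => //.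
      by apply/mem_slabels; left.
    + by apply: contra ap => h; apply/mem_slabels; right; exists b.
    + exact: np.
  - move=> b c; rewrite !inE => /predU1P[->|bp] /predU1P[->|cp]; rewrite ?eqxx //.
    + by move=> _ x; exact: dis.
    + by move=> _ x; apply: contraL; exact: dis.
    + exact: dp.
case=> /= /andP[ap up] ut np dp.
have sub b : b \in p -> b \in a :: p by move=> h; rewrite inE h orbT.
have aa : a \in a :: p by rewrite inE eqxx.
have ab b : b \in p -> a != b by move=> h; apply: contraNneq ap => ->.
rewrite (np a a aa aa) (ut a aa) /=; apply/and3P; split.
- apply/negP => /mem_slabels[|[b bp ab']]; first by rewrite (negPf ap).
  by have := np b a (sub b bp) aa; rewrite ab'.
- apply/hasPn => x /mem_slabels[xp|[b bp xb]].
    exact: np aa (sub x xp).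
  by apply/negP => xa; have := dp a b aa (sub b bp) (ab b bp) x xa; rewrite xb.
apply/IH; split=> //.
- by move=> b /sub; exact: ut.
- by move=> b c /sub bp /sub; exact: np.
- by move=> b c /sub bp /sub; exact: dp.
Qed.

Lemma chain_apart p tr e x y : x \notin p -> y \notin p -> x != e -> y != e ->
  {in p, forall a, x \notin labels (tr a)} -> chain (spikes p tr) e x y = 0%R.
Proof.
elim: p => //= a p IH; rewrite !inE !negb_or => /andP[xa xp] /andP[ya yp] xe ye h.
rewrite IH //; last by move=> b bp; apply: h; rewrite inE bp orbT.
rewrite tb_out ?h ?inE ?eqxx // /tri /arr !delta_some.
have d z : z != a -> z \notin p -> z != e ->
    (head e (unzip1 (spikes p tr)) == z) = false.
  move=> za zp ze; case: (p) zp => [_|b q] /=; first by rewrite eq_sym (negPf ze).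
  by rewrite inE negb_or eq_sym => /andP[/negPf].
by rewrite !d // !(eq_sym a) (negPf xa) (negPf ya) /=; ring.
Qed.

Lemma chain_off p tr e a x y : wheel_labels p tr -> a \in p -> x \notin p ->
  y \notin p -> x != e -> y != e -> x \in labels (tr a) ->
  chain (spikes p tr) e x y = tb (tr a) x y.
Proof.
elim: p => //= b p IH [/= /andP[nbp up] ut np dp].
rewrite !inE !negb_or => ap /andP[xb xp] /andP[yb yp] xe ye xa.
have sub c : c \in p -> c \in b :: p by move=> h; rewrite inE h orbT.
have bb : b \in b :: p by rewrite inE eqxx.
have t0 : tri (Some b) (Some (head e (unzip1 (spikes p tr)))) (troot (tr b)) x y = 0%R.
  have d z : z != b -> z \notin p -> z != e ->
      (head e (unzip1 (spikes p tr)) == z) = false.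
    move=> zb zp ze; case: (p) zp => [_|c q] /=; first by rewrite eq_sym (negPf ze).
    by rewrite inE negb_or eq_sym => /andP[/negPf].
  by rewrite /tri /arr !delta_some !d // !(eq_sym b) (negPf xb) (negPf yb) /=; ring.
rewrite t0 add0r; case/predU1P: ap => [e1|ap].
  rewrite e1 chain_apart ?addr0 // => c cp; rewrite e1 in xa.
  by apply: (dp b c bb (sub c cp) _ x xa); apply: contraNneq nbp => ->.
rewrite tb_out ?add0r; last first.
  by apply: (dp a b (sub a ap) bb _ x xa); apply: contraNneq nbp => <-.
apply: IH => //; split=> //.
- by move=> c /sub; exact: ut.
- by move=> c d /sub cp /sub; exact: np.
- by move=> c d /sub cp /sub; exact: dp.
Qed.

Lemma chain_last a p tr x y : x \notin a :: p ->
  {in a :: p, forall b, x \notin labels (tr b)} ->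
  chain (spikes (a :: p) tr) x x y =
    (delta (troot (tr (last a p))) y - delta (Some (last a p)) y)%R.
Proof.
elim: p a => [|b p IH] a.
  rewrite inE => xa h; have := h a; rewrite inE eqxx => /(_ isT) xta.
  rewrite /= tb_out // /tri /arr delta_id (delta_neq (troot_neq xta)) !delta_some.
  by rewrite !(eq_sym a) (negPf xa) /=; ring.
rewrite inE negb_or => /andP[xa xp] h; rewrite spikes_cons /=.
have := IH b xp; rewrite /= => ->; last first.
  by move=> c cp; apply: h; rewrite inE cp orbT.
have xta : x \notin labels (tr a) by apply: h; rewrite inE eqxx.
have xb : x != b by move: xp; rewrite inE negb_or => /andP[].
rewrite tb_out // tri_out ?add0r ?troot_neq ?(inj_eq Some_inj) //.
- by rewrite eq_sym.
- by rewrite eq_sym.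
Qed.

Lemma prev_head x p : x \notin p -> prev (x :: p) x = last x p.
Proof.
have gen y : x \notin p -> prev_at x x y p = last y p.
  elim: p y => [|z p IH] y /=; first by rewrite eqxx.
  by rewrite inE negb_or => /andP[/negPf-> /IH].
exact: gen.
Qed.

(** A radius x lies on two triangles, one with [next p x] and the root of its own tree, one with
    [prev p x] and the root of the tree of [prev p x]. The list is rotated so that these are the
    first and the last summand of the chain. *)
Lemma cb_row p tr x y : wheel_labels p tr -> 1 < size p -> x \in p ->
  cb (Cyc (spikes p tr)) x y =
    (delta (Some (next p x)) y + delta (troot (tr (prev p x))) y
      - delta (Some (prev p x)) y - delta (troot (tr x)) y)%R.
Proof.
case=> up ut np dp sp xp; have [i q eq_] := rot_to xp.
have xx : x \in x :: q by rewrite inE eqxx.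
have mq b : (b \in x :: q) = (b \in p) by rewrite -eq_ mem_rot.
have uq : uniq (x :: q) by rewrite -eq_ rot_uniq.
have sq : 1 < size (x :: q) by rewrite -eq_ size_rot.
rewrite -(next_rot i up) -(prev_rot i up) eq_.
have -> : cb (Cyc (spikes p tr)) x y = cb (Cyc (spikes (x :: q) tr)) x y.
  rewrite -eq_ -{1}(cat_take_drop i p) /spikes map_cat cb_rot.
  by rewrite -map_cat.
case: q eq_ mq uq sq xx => // h q _ mq uq _ xx.
have nxq : x \notin h :: q by case/andP: uq.
rewrite prev_head // [next _ _]/= eqxx.
have lab b : b \in x :: h :: q -> x \notin labels (tr b).
  by rewrite mq => bp; exact: np bp xp.
have -> : cb (Cyc (spikes [:: x, h & q] tr)) x y =
  (tri (Some x) (Some h) (troot (tr x)) x y + tb (tr x) x y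
    + chain (spikes (h :: q) tr) x x y)%R by [].
rewrite chain_last //; last by move=> b bq; apply: lab; rewrite inE bq orbT.
rewrite tb_out ?lab // /tri /arr delta_id (delta_neq (troot_neq (lab x xx))).
rewrite !delta_some; have -> : (h == x) = false.
  by apply: contraNF nxq => /eqP->; rewrite inE eqxx.
by rewrite /=; ring.
Qed.

End WheelMatrix.

Section CyclicNeighbours.

Variables (T : eqType) (p : seq T).
Hypotheses (up : uniq p) (sp : 3 <= size p).

Lemma next_neq x : x \in p -> next p x != x.
Proof.
by move=> xp; apply: contraNneq (next_next up sp xp) => e; rewrite !e.
Qed.

Lemma prev_neq x : x \in p -> prev p x != x.
Proof.
move=> xp; apply: contraNneq (next_neq xp) => e.
by rewrite -{1}e next_prev.
Qed.

Lemma next_neq_prev x : x \in p -> next p x != prev p x.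
Proof.
move=> xp; apply: contraNneq (next_next up sp xp) => ->.
by rewrite next_prev.
Qed.

Lemma next_eq_prev x y : (x == next p y) = (y == prev p x).
Proof.
by apply/eqP/eqP => ->; rewrite ?prev_next ?next_prev.
Qed.

Lemma count_next x y : x \in p ->
  count_mem (x, y) [seq (a, next p a) | a <- p] = (y == next p x).
Proof.
move=> xp; rewrite count_uniq_mem; last by rewrite map_inj_uniq // => a b [].
congr nat_of_bool; apply/mapP/eqP => [[a _ [-> ->]]//|->].
by exists x.
Qed.

End CyclicNeighbours.

Section Wheel.

Variable Q : quiver.
Local Notation V := (vertex Q).
Implicit Types (a b x y : V) (p : seq V) (tr : V -> tree V).

Definition wheel p tr : Prop :=
  [/\ wheel_labels p tr,
      forall x, x \in p \/ exists2 a, a \in p & x \in labels (tr a),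
      forall x, x \in p -> forall y,
        narrows x y = (y == next p x) + (troot (tr (prev p x)) == Some y),
      forall x, x \in p -> forall y,
        narrows y x = (y == prev p x) + (troot (tr x) == Some y)
    & forall a x y, a \in p -> x \in labels (tr a) -> y \notin p ->
        bmat x y = tb (tr a) x y].

Lemma delta_bool (z : option V) y : delta z y = Posz (z == Some y).
Proof. by rewrite /delta; case: (z == _). Qed.

(** With at least three radii, [next] and [prev] differ, so the four terms of a row never cancel and
    the arrow counts in both directions can be read off the matrix. *)
Lemma realize_wheel p tr : 3 <= size p ->
  realize (Cyc (spikes p tr)) <-> wheel p tr.
Proof.
move=> sp; have sp2 : 1 < size p by exact: ltnW.
split.
  case=> /uniq_slabels wl _ cov bX; have [up ut np dp] := wl.
  have inl b y : troot (tr b) == Some y -> y \in labels (tr b) by exact: troot_in.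
  have row x : x \in p -> forall y,
      (narrows x y = (y == next p x) + (troot (tr (prev p x)) == Some y)) /\
      (narrows y x = (y == prev p x) + (troot (tr x) == Some y)).
    move=> xp y; have := bX x y; rewrite cb_row // !delta_bool !(inj_eq Some_inj).
    rewrite !(eq_sym _ y) => bxy.
    have xp' : prev p x \in p by rewrite mem_prev.
    have nn : ~~ ((y == next p x) && (y == prev p x)).
      apply/negP => /andP[/eqP e1 /eqP e2].
      by have := next_neq_prev up sp xp; rewrite -e1 e2 eqxx.
    have n1 a z : a \in p -> z \in p -> ~~ ((y == z) && (troot (tr a) == Some y)).
      move=> ap zp; apply/negP => /andP[/eqP e1 /inl yl].
      by have := np a z ap zp; rewrite -e1 yl.
    have xn : next p x \in p by rewrite mem_next.
    have n5 : ~~ ((troot (tr x) == Some y) && (troot (tr (prev p x)) == Some y)).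
      apply/negP => /andP[/inl yl /inl yl'].
      have xx : x != prev p x by rewrite eq_sym prev_neq.
      by have := dp x _ xp xp' xx y yl; rewrite yl'.
    move: bxy nn n5 (n1 _ _ xp xn) (n1 _ _ xp' xn) (n1 _ _ xp xp') (n1 _ _ xp'
      xp'); rewrite /bmat; case: (narrows_anti x y) => ->;
    case: (y == next p x); case: (y == prev p x);
    case: (troot (tr x) == _); case: (troot (tr _) == _) => //=; lia.
  split=> //.
  - by move=> x; have /mem_slabels := cov x.
  - by move=> x xp y; have [] := row x xp y.
  - by move=> x xp y; have [] := row x xp y.
  - move=> a x y ap xa yp; rewrite bX.
    have xp : x \notin p by apply: contraL xa => xp; exact: np ap xp.
    case: p sp sp2 wl ap xp yp {cov bX up ut np dp row} => // e q _ _ wl ap xp yp.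
    move: (xp) (yp); rewrite !inE !negb_or => /andP[xe _] /andP[ye _].
    exact: (chain_off wl ap xp yp xe ye xa).
case=> wl cov rout rin off; have [up ut np dp] := wl.
have row x y : x \in p -> bmat x y = cb (Cyc (spikes p tr)) x y.
  move=> xp; rewrite cb_row // /bmat rout // rin // !delta_bool !(inj_eq Some_inj).
  by rewrite !(eq_sym y) !PoszD; ring.
split.
- by apply/uniq_slabels.
- by rewrite /= size_map.
- by move=> x; apply/mem_slabels.
move=> x y; have [xp|xp] := boolP (x \in p); first exact: row.
have [yp|yp] := boolP (y \in p);
  first by rewrite bmat_antisymm row // cb_antisymm opprK.
case: (cov x) => [|[a ap xa]]; first by rewrite (negPf xp).
rewrite (off a x y ap xa yp);
  case: p {sp sp2 cov rout rin off row up ut np dp} wl ap xp yp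
  => // e q wl ap xp yp.
move: (xp) (yp); rewrite !inE !negb_or => /andP[xe _] /andP[ye _].
by rewrite -(chain_off wl ap xp yp xe ye xa).
Qed.

End Wheel.

Section TypeIV.

Variable Q : quiver.
Local Notation V := (vertex Q).
Implicit Types (a b x y : V) (p : seq V) (tr : V -> tree V).

Lemma count_triangle (T : eqType) (a b c : T) : a != b -> b != c -> a != c ->
  let E := [:: (a, b); (b, c); (c, a)] in
  [/\ count_mem (a, b) E = 1, count_mem (b, c) E = 1 & count_mem (c, a) E = 1] /\
  [/\ count_mem (b, a) E = 0, count_mem (c, b) E = 0 & count_mem (a, c) E = 0] /\
  [/\ count_mem (a, a) E = 0, count_mem (b, b) E = 0 & count_mem (c, c) E = 0].
Proof.
move=> /negPf ab /negPf bc /negPf ac /=; rewrite !xpair_eqE !eqxx.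
by rewrite [b == a]eq_sym [c == b]eq_sym [c == a]eq_sym ab bc ac.
Qed.

Lemma wheel_type_IV p tr : 3 <= size p -> wheel p tr -> type_IV Q.
Proof.
move=> sp [wl cov rout rin off]; have [up ut np dp] := wl.
have inl b y : troot (tr b) = Some y -> y \in labels (tr b).
  by move=> e; apply: troot_in; rewrite e.
have rp b y : b \in p -> y \in p -> (troot (tr b) == Some y) = false.
  by move=> bp yp; apply/negbTE/troot_neq/np.
have dt b c y : b \in p -> c \in p -> b != c -> troot (tr b) = Some y ->
    (troot (tr c) == Some y) = false.
  by move=> bp cp bc /inl yb; apply/negbTE/troot_neq/(dp b c).
exists p; split=> //.
  split=> // x y xp yp; rewrite rout // rp ?mem_prev // addn0.
  by rewrite count_next.
set A := ~: [set a in p]; set R := delete_vertices _.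
pose tip a : option (vertex R) :=
  if troot (tr a) is Some c then insub c else None.
have tipP a (v : vertex R) : tip a = Some v <-> troot (tr a) = Some (sub_incl v).
  rewrite /tip; split.
    by case: (troot (tr a)) => // c; case: insubP => // u _ <- [->].
  by move=> ->; rewrite /sub_incl; exact: valK.
have Rp (v : vertex R) : sub_incl v \notin p.
  by have := sub_incl_in v; rewrite !inE.
have surj y : y \notin p -> exists v : vertex R, sub_incl v = y.
  by move=> yp; apply: sub_incl_surj; rewrite !inE.
have ct a v : a \in p -> tip a = Some v -> component_tree v (tr a).
  move=> ap /tipP rv; split=> //.
  - exact: ut.
  - by move=> x xa; rewrite !inE; apply: contraL xa => xp; exact: np.
  - by move=> x y xa; rewrite bmat_full (off a).
exists tip; split.
- move=> a v ap /tipP rv; have nap : next p a \in p by rewrite mem_next.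
  have vp := Rp v; have an : a != next p a by rewrite eq_sym next_neq.
  have nv : next p a != sub_incl v by apply: contraNneq vp => <-.
  have av : a != sub_incl v by apply: contraNneq vp => <-.
  split; first by rewrite /= !inE negb_or an av nv.
  have ne z : z \in p -> (sub_incl v == z) = false.
    by move=> zp; apply: contraNF vp => /eqP->.
  have [[e1 e2 e3] [[e4 e5 e6] [e7 e8 e9]]] := count_triangle an nv av.
  have pa : prev p a \in p by rewrite mem_prev.
  have vprev : (troot (tr (prev p a)) == Some (sub_incl v)) = false.
    by apply: (dt a _ _ ap pa _ rv); rewrite eq_sym prev_neq.
  have vnext : (troot (tr (next p a)) == Some (sub_incl v)) = false.
    exact: (dt a _ _ ap nap an rv).
  move=> x y; rewrite !inE => /or3P[]/eqP-> /or3P[]/eqP->.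
  + by rewrite e7 narrows_loop.
  + by rewrite e1 rout // eqxx rp.
  + by rewrite e6 rout // ne ?mem_next // add0n vprev.
  + rewrite e4 rout // rp ?mem_prev // addn0.
    by rewrite [_ == _]eq_sym (negPf (next_next up sp ap)).
  + by rewrite e8 narrows_loop.
  + by rewrite e2 rout // ne ?mem_next // prev_next // rv eqxx.
  + by rewrite e3 rin // rv eqxx ne.
  + by rewrite e5 rin // ne ?mem_prev // add0n vnext.
  + by rewrite e9 narrows_loop.
- move=> z; case/orP=> zp.
    have : 0 < narrows (qtail z) (qhead z) by apply/narrows_gt0P; exists z.
    rewrite rout // addn_gt0 !lt0b => /orP[/eqP e|/eqP e].
      by exists (qtail z) => //; left; rewrite -e.
    have hp : qhead z \notin p.
      by apply/negP => hp; have := rp (prev p (qtail z)) _ _ hp;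
         rewrite mem_prev e eqxx => /(_ zp).
    have [v ev] := surj _ hp; exists (prev p (qtail z)); first by rewrite mem_prev.
    right; exists v; first by apply/tipP; rewrite ev.
    by left; rewrite ev next_prev.
  have : 0 < narrows (qtail z) (qhead z) by apply/narrows_gt0P; exists z.
  rewrite rin // addn_gt0 !lt0b => /orP[/eqP e|/eqP e].
    exists (prev p (qhead z)); first by rewrite mem_prev.
    by left; rewrite next_prev // e.
  have hp : qtail z \notin p.
    by apply/negP => hp; have := rp _ _ zp hp; rewrite e eqxx.
  have [v ev] := surj _ hp; exists (qhead z) => //.
  by right; exists v; [apply/tipP; rewrite ev | right; rewrite ev].
- move=> w; case: (cov (sub_incl w)) => [|[a ap wa]]; first by rewrite (negPf (Rp w)).
  have [c rc] : exists c, troot (tr a) = Some c.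
    by case: (tr a) wa => // c l r _; exists c.
  have cp : c \notin p.
    by apply/negP => cp; have := rp a c ap cp; rewrite rc eqxx.
  have [v ev] := surj c cp.
  have ta : tip a = Some v by apply/tipP; rewrite ev.
  exists a, v; split=> //.
  by rewrite -(component_tree_labels (ct a v ap ta)).
- move=> a a' v v' ap ap' ta ta' e; apply/eqP/negPn/negP => naa.
  have va : sub_incl v \in labels (tr a).
    by rewrite (component_tree_labels (ct a v ap ta)) component_refl.
  have := dp a a' ap ap' naa _ va.
  by rewrite (component_tree_labels (ct a' v' ap' ta')) -e component_refl.
- by move=> a v ap ta; apply/component_treeP; exists (tr a); exact: ct.
Qed.

Lemma type_IV_wheel : type_IV Q -> exists p tr, 3 <= size p /\ wheel p tr.
Proof.
case=> p [sp [up cnt] [tip [spike arrows cov comp ma]]].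
(* A tree is chosen for every vertex at once; outside p the requirement is void. *)
have [tr htr] : exists tr : V -> tree V, forall a,
    if a \in p then if tip a is Some v then component_tree v (tr a) else tr a = E
    else true.
  apply: (@fin_all_exists V (fun=> tree V) (fun a t =>
    if a \in p then if tip a is Some v then component_tree v t else t = E
    else true)).
  move=> a; have [ap|_] := boolP (a \in p); last by exists E.
  case ea: (tip a) => [v|]; last by exists E.
  by apply/component_treeP; exact: ma ap ea.
have tE a : a \in p -> tip a = None -> tr a = E.
  by move=> ap ea; have := htr a; rewrite ap ea.
have tT a v : a \in p -> tip a = Some v -> component_tree v (tr a).
  by move=> ap ea; have := htr a; rewrite ap ea.
have tl a x : a \in p -> x \in labels (tr a) -> exists2 v, tip a = Some v &
    component_tree v (tr a).
  move=> ap; case ea: (tip a) => [v|]; last by rewrite (tE a).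
  by exists v => //; exact: tT.
have sub a x : a \in p -> x \in labels (tr a) -> x \notin p.
  move=> ap xa; have [v _ [_ _ s _]] := tl a x ap xa.
  by have := s x xa; rewrite !inE.
have Rp (v : vertex (delete_vertices [set a in p])) : sub_incl v \notin p.
  by have := sub_incl_in v; rewrite !inE.
have surj y : y \notin p ->
    exists v : vertex (delete_vertices [set a in p]), sub_incl v = y.
  by move=> yp; apply: sub_incl_surj; rewrite !inE.
have rp b y : b \in p -> y \in p -> (troot (tr b) == Some y) = false.
  by move=> bp yp; apply/negbTE/troot_neq; apply: contraL yp; exact: sub.
have rt a y : a \in p -> troot (tr a) = Some y ->
    exists2 v, tip a = Some v & sub_incl v = y.
  move=> ap; case ea: (tip a) => [v|]; last by rewrite (tE a).
  by have [-> _ _ _ [<-]] := tT a v ap ea; exists v.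
have tr_tip a v : a \in p -> tip a = Some v -> troot (tr a) = Some (sub_incl v).
  by move=> ap /(tT a v ap)[].
have spk a v : a \in p -> tip a = Some v ->
    narrows (next p a) (sub_incl v) = 1 /\ narrows (sub_incl v) a = 1.
  move=> ap ea; have [un cn] := spike a v ap ea.
  move: un; rewrite /= !inE negb_or andbT => /andP[/andP[an av] nv].
  have [[e1 e2 e3] _] := count_triangle an nv av.
  by rewrite !cn ?e2 ?e3 // !inE eqxx ?orbT.
exists p, tr; split=> //; split.
- split=> //.
  + move=> a ap; case ea: (tip a) => [v|]; last by rewrite (tE a).
    by have [] := tT a v ap ea.
  + by move=> a b ap bp; apply: contraL bp; exact: sub.
  + move=> a b ap bp ab x xa; apply/negP => xb.
    have [v ea hv] := tl a x ap xa; have [w eb hw] := tl b x bp xb.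
    have [x' ex] := surj x (sub a x ap xa); subst x.
    case/eqP: ab; apply: (comp a b v w) => //.
    by apply: (@component_eq _ _ _ x');
      rewrite -(component_tree_labels hv, component_tree_labels hw).
- move=> x; have [|xp] := boolP (x \in p); [by left|right].
  have [w ew] := surj x xp; have [a [v [ap ea wv]]] := cov w.
  by exists a => //; rewrite -ew (component_tree_labels (tT a v ap ea)).
- move=> x xp y; have [yp|yp] := boolP (y \in p).
    by rewrite cnt // count_next // rp ?mem_prev // addn0.
  have pp : prev p x \in p by rewrite mem_prev.
  have -> : (y == next p x) = false.
    by apply: contraNF yp => /eqP->; rewrite mem_next.
  rewrite add0n; case: eqP => [/(rt _ _ pp)[v ea <-]|nt].
    by have [+ _] := spk _ v pp ea; rewrite next_prev.
  apply/eqP; rewrite -leqn0 leqNgt; apply/negP => /narrows_gt0P[z [tz hz]].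
  have [|a ap] := arrows z; first by rewrite tz xp.
  rewrite tz hz; case=> [[_ e]|[v ea [[e1 e2]|[e1 e2]]]].
  + by rewrite e mem_next ap in yp.
  + by apply: nt; rewrite e1 prev_next // e2; exact: tr_tip.
  + by have := Rp v; rewrite -e1 xp.
- move=> x xp y; have [yp|yp] := boolP (y \in p).
    by rewrite cnt // count_next // rp // addn0 next_eq_prev.
  have pp : prev p x \in p by rewrite mem_prev.
  have -> : (y == prev p x) = false by apply: contraNF yp => /eqP->.
  rewrite add0n; case: eqP => [/(rt _ _ xp)[v ea <-]|nt].
    by have [_ ->] := spk _ v xp ea.
  apply/eqP; rewrite -leqn0 leqNgt; apply/negP => /narrows_gt0P[z [tz hz]].
  have [|a ap] := arrows z; first by rewrite hz xp orbT.
  rewrite tz hz; case=> [[e _]|[v ea [[e1 e2]|[e1 e2]]]].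
  + by rewrite e ap in yp.
  + by have := Rp v; rewrite -e2 xp.
  + by apply: nt; rewrite e2 e1; exact: tr_tip.
- move=> a x y ap xa yp; have [v ea [_ _ _ bv]] := tl a x ap xa.
  have [x' ex] := surj x (sub a x ap xa); have [y' ey] := surj y yp.
  by subst x y; rewrite -bv // bmat_full.
Qed.

End TypeIV.

(** * The four types and realizability *)

Lemma spikes_of (V : eqType) (s : seq (V * tree V)) : uniq (slabels s) ->
  exists p tr, s = spikes p tr.
Proof.
elim: s => [|[a t] s IH]; first by exists [::], (fun=> E).
rewrite slabels_cons /= mem_cat negb_or cat_uniq.
case/and4P=> /andP[_ as_] _ _ /IH[p [tr es]].
(* Distinct labels keep a apart from the later radii, so overriding [tr] at a leaves their trees
   unchanged. *)
exists (a :: p), (fun b => if b == a then t else tr b).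
rewrite /spikes /= eqxx es; congr (_ :: _); apply/eq_in_map => b bp.
case: eqP => [eb|//]; case/negP: as_; rewrite es -eb.
by apply/mem_slabels; left.
Qed.

(** A tagged pair with two nonempty trees is Type II, two radii with two nonempty trees are Type
    III, an empty tree in either case gives Type I, and three or more radii give Type IV. *)
Lemma MD_realized (n : nat) (Q : quiver) : 4 <= n -> #|vertex Q| = n ->
  MD n Q <-> exists X : dtri (vertex Q), realize X.
Proof.
move=> n4 cQ; split.
  case=> _ []; rewrite -?cQ.
  - case/type_IP=> a [b [c [t [ea [eb h]]]]]; exact: forked_realize h.
  - by case/type_IIP=> a [b [l [r [_ _ h]]]]; exists (Dbl a b l r).
  - by case/type_IIIP=> a [b [l [r [_ _ h]]]]; exists (Cyc [:: (a, l); (b, r)]).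
  - case/type_IV_wheel=> p [tr [sp /realize_wheel h]].
    by exists (Cyc (spikes p tr)); exact: h.
rewrite -cQ in n4 *; case=> -[a b l r|s] rX; split=> //.
  case el: l => [|c l1 l2].
    by constructor 1; apply/type_IP; apply: (realize_dbl_leaf n4 rX); left.
  case er: r => [|d r1 r2].
    by constructor 1; apply/type_IP; apply: (realize_dbl_leaf n4 rX); right.
  by constructor 2; apply/type_IIP; exists a, b, l, r; rewrite el er in rX *.
have [us gs _ _] := rX.
case: s => [|[a l] [|[b r] [|q s]]] // in rX us gs *.
  case el: l => [|c l1 l2].
    by constructor 1; apply/type_IP; apply: (realize_cyc2_leaf n4 rX); left.
  case er: r => [|d r1 r2].
    by constructor 1; apply/type_IP; apply: (realize_cyc2_leaf n4 rX); right.
  by constructor 3; apply/type_IIIP; exists a, b, l, r; rewrite el er in rX *.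
have [p [tr es]] := spikes_of us; rewrite es in rX.
have sp : 3 <= size p by move/(congr1 size): es; rewrite size_map => <-.
by constructor 4; apply: (@wheel_type_IV _ p tr sp);
  case: (@realize_wheel _ p tr sp) => h _; exact: h.
Qed.

Theorem theorem3p1 (n : nat) (n_ge4 : 4 <= n) (Q : quiver) :
  mutation_equivalent Q (D_quiver n) <-> MD n Q.
Proof.
have cD : #|vertex (D_quiver n)| = n by rewrite card_ord.
have [X0 rX0] : exists X, @realize (D_quiver n) X.
  case: n n_ge4 {cD} => [|[|m]] // m2;
    exists (Dbl (inord m) (inord m.+1) E (comb (below m.+1 m))).
  exact: D_quiver_realize.
split=> [mQ|[cQ mD]].
  suff [cQ hX] : #|vertex Q| = n /\ exists X, @realize Q X by apply/MD_realized.
  (* The mutation sequence may run from [Q] to the D_n quiver or the other way; realizability is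
     transported in both directions. *)
  rewrite -cD; case: mQ => m; first exact: mutates_realize_inv rX0.
  by have [-> hX] := mutates_realize m rX0.
have /MD_realized : MD n Q by [].
by case=> // X rX; left; exact: mutates_realized rX.
Qed.
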